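(* Let $\mathcal{D}=(d_1,\ldots,d_m)$ be positive integers with sum $N$. For $I,J\in\mathrm{OSP}(\mathcal{D})$ with $\Omega_J\subseteq\overline{\Omega_I}\subseteq\mathrm{Fl}_{\mathcal{D}}(\mathbb{R}^N)$ and $\dim\Omega_J=\dim\Omega_I-1$, let $c_{IJ}\in\mathbb{F}_2$ be the mod 2 reduction of $|[\Omega_I,\Omega_J]/2|$, where $[\Omega_I,\Omega_J]\in\{0,\pm2\}$ is the incidence coefficient. Then in $H^*(\mathrm{Fl}_{\mathcal{D}}(\mathbb{R}^N);\mathbb{F}_2)$ $$\mathrm{Sq}^1[\sigma_I]=\sum_J c_{IJ}[\sigma_J],$$ the sum being over all such $J$.
   Context: $\mathrm{Fl}_{\mathcal{D}}(\mathbb{R}^N)$ is the manifold of flags $F_1\subset\cdots\subset F_m=\mathbb{R}^N$ with $\dim F_i=d_1+\cdots+d_i$. $\mathrm{OSP}(\mathcal{D})$ is the set of ordered set partitions $I=(I_1,\ldots,I_m)$ of $[N]$ with $|I_j|=d_j$; $I$ is also regarded as a function $[N]\to[m]$ with $I(k)=j$ iff $k\in I_j$. With $E_k=\langle e_1,\ldots,e_k\rangle$, the Schubert cell is $\Omega_I=\{F_\bullet:\dim (F_i\cap E_k)=|\{l\in I_1\cup\cdots\cup I_i:\ l\le k\}| \text{ for all } i,k\}$, and $\sigma_I=\overline{\Omega_I}$. The cochain complex with basis the (cooriented) Schubert cells graded by codimension and differential $d\Omega_I=\sum_J[\Omega_I,\Omega_J]\Omega_J$ computes $H^*(\mathrm{Fl}_{\mathcal{D}}(\mathbb{R}^N);\mathbb{Z})$;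 all $[\Omega_I,\Omega_J]$ are $0$ or $\pm2$. Explicitly, if $\Omega_J\subseteq\overline{\Omega_I}$ and $\dim\Omega_J=\dim\Omega_I-1$, then $J$ is obtained from $I$ by interchanging some $a\in I_\alpha$ with some $b\in I_\beta$, $a>b$, $\alpha<\beta$, and $[\Omega_I,\Omega_J]=\pm2$ if $N_I(a,b)=|\{d>a:\alpha<I(d)\le\beta\}|+|\{d<b:\alpha\le I(d)\le\beta-1\}|$ is odd, and $0$ if it is even. Consequently every $\sigma_I$ has a mod 2 cohomology class $[\sigma_I]\in H^{\operatorname{codim}\sigma_I}(\mathrm{Fl}_{\mathcal{D}}(\mathbb{R}^N);\mathbb{F}_2)$, and these form a basis. $\mathrm{Sq}^1$ is the first Steenrod square. *)

(* Defs.v *)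
From HB Require Import structures.
From mathcomp Require Import all_boot all_order all_algebra.
From mathcomp Require Import ring_quotient.
From mathcomp Require Import all_classical all_reals all_analysis.

Set Implicit Arguments.
Unset Strict Implicit.
Unset Printing Implicit Defensive.

Import Order.TTheory GRing.Theory Num.Theory.
Import numFieldNormedType.Exports.

Local Open Scope classical_set_scope.
Local Open Scope quotient_scope.
Local Open Scope ring_scope.

Definition std_simplex (R : realType) (n : nat) : set 'rV[R]_n.+1 :=
  [set t | (forall i, 0 <= t ord0 i) /\ \sum_i t ord0 i = 1].
Arguments std_simplex : clear implicits.

Section VertexMap.
Variables (R : realType) (k n : nat) (f : 'I_k.+1 -> 'I_n.+1).

(* The affine map sending the vertex i of the source to the vertex f i. *)
Definition vertex_mx (t : 'rV[R]_k.+1) : 'rV[R]_n.+1 :=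
  \row_j \sum_(i | f i == j) t ord0 i.

Lemma vertex_mx_simplex t : std_simplex R k t -> std_simplex R n (vertex_mx t).
Proof.
case=> t0 t1; split=> [j|]; first by rewrite mxE; apply: sumr_ge0.
rewrite -t1 [RHS](partition_big f predT) //=.
by apply: eq_bigr => j _; rewrite mxE.
Qed.

Definition vertex_map (t : std_simplex R k) : std_simplex R n :=
  SigSub (mem_set (vertex_mx_simplex (set_valP t))).

Lemma vertex_mx_continuous : continuous vertex_mx.
Proof.
move=> t P [Q tQ QP]; rewrite nbhs_simpl /=.
suff H : forall i j, \forall u \near t, Q i j (vertex_mx u i j).
  have : \forall u \near t, forall i j, Q i j (vertex_mx u i j).
    apply: (filter_forall (F := nbhs t)) => i.
    by apply: (filter_forall (F := nbhs t)) => j; exact: H.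
  by apply: filterS => u Qu; exact: QP.
move=> i j.
have cont : continuous (fun u : 'rV[R]_k.+1 => vertex_mx u i j).
  have -> : (fun u => vertex_mx u i j) =
            (fun u : 'rV[R]_k.+1 => \sum_(l | f l == j) u ord0 l).
    by apply/funext => u; rewrite mxE.
  apply: continuous_big => [|l _]; first exact: add_continuous.
  exact: coord_continuous.
exact: (cont t) (tQ i j).
Qed.

Lemma vertex_map_continuous : continuous vertex_map.
Proof.
apply: continuous_comp_initial => t.
apply: (@continuous_comp _ _ _ set_val vertex_mx).
  exact: initial_continuous.
exact: vertex_mx_continuous.
Qed.

HB.instance Definition _ :=
  @isContinuous.Build _ _ vertex_map vertex_map_continuous.

End VertexMap.

(* The singular simplices of all dimensions are put together: a cochain is then
   a family of cochains, one in each degree, and no degree casts are needed. *)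
Definition singular_simplex (R : realType) (X : topologicalType) : Type :=
  {n : nat & continuousType (std_simplex R n) X}.

Section SingularCohomology.
Variables (R : realType) (X : topologicalType) (A : comNzRingType).

Definition sub_simplex n (s : continuousType (std_simplex R n) X) k
    (f : 'I_k.+1 -> 'I_n.+1) : singular_simplex R X :=
  existT _ k (s \o vertex_map f : continuousType _ _).

Definition cochain : Type := singular_simplex R X -> A^o.
HB.instance Definition _ := GRing.Lmodule.on cochain.

Implicit Types (a b c : cochain) (U V : set X).

Definition coboundary c : cochain := fun x =>
  let: existT n s := x in
  match n return continuousType (std_simplex R n) X -> A with
  | 0 => fun=> 0
  | n'.+1 => fun s => \sum_(i < n'.+2) (-1) ^+ i * c (sub_simplex s (lift i))
  end s.

Lemma coboundary_is_linear : linear coboundary.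
Proof.
move=> k a b; apply/funext => -[[|n] s].
  by transitivity (k * 0 + 0 : A); first by rewrite mulr0 addr0.
pose d c (i : 'I_n.+2) : A := (-1) ^+ i * c (sub_simplex s (lift i)).
transitivity (k * (\sum_(i < n.+2) d a i) + \sum_(i < n.+2) d b i) => //.
rewrite mulr_sumr -big_split /=; apply: eq_bigr => i _.
by rewrite /d mulrCA -mulrDr.
Qed.

HB.instance Definition _ :=
  GRing.isLinear.Build A cochain cochain _ coboundary coboundary_is_linear.

Definition cocycles : {pred cochain} := [pred c | `[< coboundary c = 0 >]].

Lemma cocycles_submod_closed : submod_closed cocycles.
Proof.
split=> [|k a b /asboolP a0 /asboolP b0]; apply/asboolP; first exact: linear0.
by rewrite coboundary_is_linear a0 b0 scaler0 addr0.
Qed.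

HB.instance Definition _ :=
  GRing.isSubmodClosed.Build A cochain cocycles cocycles_submod_closed.

Record cocycle : Type := Cocycle {
  cocycle_val :> cochain;
  cocycleP : cocycle_val \in cocycles }.

HB.instance Definition _ := [isSub for cocycle_val].
HB.instance Definition _ := [Choice of cocycle by <:].
HB.instance Definition _ := [SubChoice_isSubLmodule of cocycle by <:].

Definition coboundaries : {pred cocycle} :=
  [pred z | `[< exists b, cocycle_val z = coboundary b >]].

Lemma coboundaries_submod_closed : submod_closed coboundaries.
Proof.
split=> [|k a b /asboolP[u au] /asboolP[v bv]]; apply/asboolP.
  by exists 0; rewrite linear0.
by exists (k *: u + v); rewrite coboundary_is_linear -au -bv.
Qed.

HB.instance Definition _ :=
  GRing.isSubmodClosed.Build A cocycle coboundaries coboundaries_submod_closed.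

Definition cohomology : Type := Quotient.quot coboundaries.

HB.instance Definition _ := GRing.Zmodule.on cohomology.
HB.instance Definition _ := ZmodQuotient.on cohomology.

Definition cohomology_scale (k : A) (x : cohomology) : cohomology :=
  \pi_cohomology (k *: repr x).

Lemma cohomology_scaleE k (z : cocycle) :
  cohomology_scale k (\pi_cohomology z) = \pi_cohomology (k *: z).
Proof.
apply/eqP; rewrite /cohomology_scale -Quotient.idealrBE -scalerBr.
apply: rpredZ.
by rewrite Quotient.idealrBE reprK.
Qed.

Lemma cohomology_scaleA k l x :
  cohomology_scale k (cohomology_scale l x) = cohomology_scale (k * l) x.
Proof.
rewrite -[x]reprK; move: (repr x) => z.
by rewrite !(cohomology_scaleE _ z) cohomology_scaleE scalerA.
Qed.

Lemma cohomology_scale1 : left_id 1 cohomology_scale.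
Proof. by move=> x; rewrite -[x]reprK cohomology_scaleE scale1r. Qed.

Lemma cohomology_scaleDr : right_distributive cohomology_scale +%R.
Proof.
move=> k x y; rewrite -[x]reprK -[y]reprK; move: (repr x) (repr y) => u v.
rewrite -[_ + _](raddfD (\pi_cohomology : {additive _ -> _})).
by rewrite !cohomology_scaleE scalerDr raddfD.
Qed.

Lemma cohomology_scaleDl x : {morph cohomology_scale^~ x : k l / k + l}.
Proof.
move=> k l; rewrite -[x]reprK; move: (repr x) => z.
by rewrite !(cohomology_scaleE _ z) scalerDl raddfD.
Qed.

HB.instance Definition _ := GRing.Zmodule_isLmodule.Build A cohomology
  cohomology_scaleA cohomology_scale1 cohomology_scaleDr cohomology_scaleDl.

End SingularCohomology.

Section SteenrodSquares.
Variables (R : realType) (X : topologicalType).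

Notation cochain2 := (cochain R X 'F_2).

Definition face n (s : continuousType (std_simplex R n) X)
    (V : {set 'I_n.+1}) : singular_simplex R X :=
  sub_simplex s (fun i : 'I_(#|V|.-1).+1 => nth ord0 (enum V) i).

(* The cut points C split [0, n] into #|C| + 1 intervals, numbered from 0, each
   sharing its endpoints with its neighbours; this is the union of the
   intervals whose number has parity b. *)
Definition cup_blocks n (C : {set 'I_n.+1}) (b : bool) : {set 'I_n.+1} :=
  [set v | (v \in C) || (odd #|[set c in C | (c < v)%N]| == b)].

(* Steenrod's cup-i product mod 2. *)
Definition cup (i : nat) (a b : cochain2) : cochain2 := fun x =>
  let: existT n s := x in
  \sum_(C : {set 'I_n.+1} | #|C| == i.+1)
    (a (face s (cup_blocks C false)) * b (face s (cup_blocks C true))).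

Definition component (p : nat) (c : cochain2) : cochain2 := fun x =>
  if projT1 x == p then c x else 0.

(* Sq^k c = c cup_(p - k) c for c of degree p, zero if p < k; the degree n of
   the value is p + k. *)
Definition Sq_cochain (k : nat) (c : cochain2) : cochain2 := fun x =>
  let n := projT1 x in
  if (k.*2 <= n)%N then
    cup (n - k.*2) (component (n - k) c) (component (n - k) c) x
  else 0.

(* Sq_cochain of a cocycle is a cocycle, so the default 0 is not used. *)
Definition Sq (k : nat) (x : cohomology R X 'F_2) : cohomology R X 'F_2 :=
  \pi_(cohomology R X 'F_2) (insubd 0 (Sq_cochain k (repr x))).

End SteenrodSquares.

Section RelativeCohomology.
Variables (R : realType) (X : topologicalType) (A : comNzRingType).
Implicit Types (a b c : cochain R X A) (U V : set X).

Definition in_degree (p : nat) c := forall x, projT1 x != p -> c x = 0.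

Definition vanishes_on U c :=
  forall x : singular_simplex R X, range (projT2 x) `<=` U -> c x = 0.

(* For V contained in U, cochains of the pair (U, V) are represented by
   cochains of X vanishing on V, considered up to cochains vanishing on U. *)
Definition rel_cocycle U V (p : nat) c :=
  [/\ in_degree p c, vanishes_on V c & vanishes_on U (coboundary c)].

Definition rel_cohomologous U V a b :=
  exists2 c, vanishes_on V c & vanishes_on U (a - b - coboundary c).

End RelativeCohomology.

Section Flags.
Variables (R : realType) (m N : nat) (d : 'I_m -> nat).

Definition partial_dim (i : 'I_m) : nat := (\sum_(j < m | j <= i) d j)%N.

Definition is_flag (F : {ffun 'I_m -> {vspace 'rV[R]_N}}) : bool :=
  [forall i, \dim (F i) == partial_dim i] &&
  [forall i : 'I_m, forall j : 'I_m, (i <= j)%N ==> (F i <= F j)%VS].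

Record flag : Type := Flag {
  flag_val :> {ffun 'I_m -> {vspace 'rV[R]_N}};
  flagP : is_flag flag_val }.

HB.instance Definition _ := [isSub for flag_val].
HB.instance Definition _ := [Choice of flag by <:].

Definition adapted (g : 'M[R]_N) (F : flag) : Prop :=
  g \in unitmx /\
  forall i, F i = <<[seq row l g | l : 'I_N <- enum 'I_N & (l < partial_dim i)%N]>>%VS.

(* The quotient topology for the map from GL_N(R) to flags that sends g to the
   flag spanned by the first rows of g. *)
Definition flag_open (O : set flag) : Prop :=
  forall F g, O F -> adapted g F ->
    \forall h \near g, forall F', adapted h F' -> O F'.

Lemma flag_openT : flag_open setT.
Proof. by move=> F g _ _; exact: (filterE (F := nbhs g)). Qed.

Lemma flag_openI : setI_closed flag_open.
Proof.
move=> O P oO oP F g [OF PF] gF.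
near=> h => F' hF'; split.
  by move: F' hF'; near: h; exact: oO gF.
by move: F' hF'; near: h; exact: oP gF.
Unshelve. all: by end_near. Qed.

Lemma flag_open_bigU (I : Type) (O : I -> set flag) :
  (forall i, flag_open (O i)) -> flag_open (\bigcup_i O i).
Proof.
move=> oO F g [i _ OF] gF.
near=> h => F' hF'; exists i => //; move: F' hF'; near: h.
exact: oO gF.
Unshelve. all: by end_near. Qed.

HB.instance Definition _ :=
  isOpenTopological.Build flag flag_openT flag_openI flag_open_bigU.

Record osp : predArgType := Osp {
  osp_val :> {ffun 'I_N -> 'I_m};
  ospP : [forall j, #|[set k | osp_val k == j]| == d j] }.

HB.instance Definition _ := [isSub for osp_val].
HB.instance Definition _ := [Finite of osp by <:].

Definition coord_subspace (k : nat) : {vspace 'rV[R]_N} :=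
  <<[seq delta_mx ord0 l | l : 'I_N <- enum 'I_N & (l < k)%N]>>%VS.

Definition schubert_cell (I : osp) : set flag :=
  [set F : flag | forall (i : 'I_m) (k : nat), \dim (F i :&: coord_subspace k) =
     #|[set l : 'I_N | (I l <= i)%N && (l < k)%N]| ].

Definition schubert_variety (I : osp) : set flag := closure (schubert_cell I).

(* The number of entries that are free in the reduced row echelon form of a
   flag in the cell. *)
Definition cell_dim (I : osp) : nat :=
  #|[set p : 'I_N * 'I_N | (p.1 < p.2)%N && (I p.2 < I p.1)%N]|.

Definition flag_dim : nat := (\sum_(i < m) \sum_(j < m | i < j) d i * d j)%N.

Definition cell_codim (I : osp) : nat := (flag_dim - cell_dim I)%N.

Definition cell_covers (I J : osp) : bool :=
  `[< schubert_cell J `<=` closure (schubert_cell I) >] &&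
  ((cell_dim J).+1 == cell_dim I).

(* The open union of the cells of codimension at most k. *)
Definition codim_le (k : nat) : set flag :=
  [set F | exists2 I : osp, (cell_codim I <= k)%N & schubert_cell I F].

(* A coorientation of the cell: a generator of the infinite cyclic group
   H^codim(U, U \ cell; Z), where the cell is closed in the open set U. *)
Definition coorientation (I : osp) (w : cochain R flag int) : Prop :=
  let U := codim_le (cell_codim I) in
  let V := U `\` schubert_cell I in
  rel_cocycle U V (cell_codim I) w /\
  forall z, rel_cocycle U V (cell_codim I) z ->
    exists! k : int, rel_cohomologous U V z (k *: w).

(* [inc] is the matrix, in the basis [w], of the connecting homomorphisms
   H^c(U_c, U_(c-1); Z) -> H^(c+1)(U_(c+1), U_c; Z), U_c = codim_le c. *)
Definition incidence_coefficients (w : osp -> cochain R flag int)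
    (inc : osp -> osp -> int) : Prop :=
  forall I : osp,
    rel_cohomologous (codim_le (cell_codim I).+1) (codim_le (cell_codim I))
      (coboundary (w I))
      (\sum_(J | cell_codim J == (cell_codim I).+1) inc I J *: w J).

(* The image in H^codim(Fl; F_2) of the class with support in the Schubert
   variety that restricts to the reduction of the coorientation. *)
Definition schubert_class (w : osp -> cochain R flag int) (I : osp)
    (x : cohomology R flag 'F_2) : Prop :=
  let U := codim_le (cell_codim I) in
  exists z : cocycle R flag 'F_2,
    [/\ x = \pi_(cohomology R flag 'F_2) z,
        in_degree (cell_codim I) z,
        vanishes_on (~` schubert_variety I) z &
        rel_cohomologous U (U `\` schubert_cell I) z
          (fun s => (w I s)%:~R)].

End Flags.

(* Main.v *)
(** Let z be a cocycle of degree p over F_2. On a (p+1)-simplex with faces s_u, the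
cochain Sq^1 z is the sum of z(s_u) z(s_v) over the pairs u < v of equal parity
(the other cuts have a block of the wrong dimension). If l is the lift of
z with values 0 and 1, an elementary count shows that this sum is the reduction
of (d l)/2. So Sq^1 is the Bockstein homomorphism, on the level of cochains.

Let c be the codimension of the cell I and U_k the union of the cells of
codimension at most k. On U_(c+1), the integral lift l differs from the
coorientation of the cell I by a coboundary, by an even cochain and by a cochain
vanishing on U_c. The incidence relation then gives, on U_(c+1),
d l = sum_J [I:J] w_J + d q + 2 d e with q zero on U_c. Reducing modulo 2 near
one cell J shows that [I:J] is even, because w_J is not zero modulo 2 near J.
Since H^c(U_(c+1), U_c; F_2) = 0, one may take q even, and halving gives
Sq^1 [sigma_I] = sum_J ([I:J]/2) [sigma_J] on U_(c+1). If J is not in the closure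
of I, the left-hand side vanishes near J, so that [I:J]/2 is even. Finally
H^(c+1)(X, U_(c+1); F_2) = 0 extends the equality to the flag manifold X.

The two vanishing statements are proved by attaching one cell at a time. By
excision, it suffices to know that the complement of a coordinate subspace of
codimension k in a real vector space has no reduced cohomology below degree k - 1,
which follows from a Mayer-Vietoris argument with two star-shaped open sets. *)

Require Import Defs.
From HB Require Import structures.
From mathcomp Require Import all_boot all_order all_algebra fingroup perm.
From mathcomp Require Import all_classical all_reals all_analysis.
From mathcomp Require Import ring lra zify.

Set Implicit Arguments.
Unset Strict Implicit.
Unset Printing Implicit Defensive.

Import Order.TTheory GRing.Theory Num.Theory.
Import numFieldNormedType.Exports.

Local Open Scope classical_set_scope.
Local Open Scope ring_scope.

(** * Barycentric subdivision of tuples *)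

(** No relative groups or exact sequences are formed. A class of a pair is a cochain that is zero on
    the simplices inside an open set, and each vanishing theorem produces an explicit primitive with
    the same support. These theorems are proved over F_2, where subdivision has no signs; an
    integral identity is reached by lifting a mod 2 primitive to values 0 and 1 and halving what has
    become even. Evenness is known on an open set only, so halves are extended by zero. The error is
    confined to simplices that do not lie in this set; the cochain q collects this error and the
    primitive from the incidence relation. A cochain has components in all degrees, so a primitive
    found by excision is cut down to the wanted degrees before it is used again. A coorientation is
    given by its universal property alone. It is nonzero modulo 2 near its cell because the
    generator would otherwise be twice a class. The attaching argument uses no closure relations,
    only that a chart around a cell meets, besides that cell, cells of smaller codimension. *)

Lemma addrr_F2 (x : 'F_2) : x + x = 0.
Proof. by case: x => [[|[|]]] // ?; apply/val_inj. Qed.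

Lemma oppr_F2 (x : 'F_2) : - x = x.
Proof. by apply/eqP; rewrite eq_sym -addr_eq0 addrr_F2. Qed.

Lemma signr_F2 n : (-1) ^+ n = 1 :> 'F_2.
Proof. by rewrite oppr_F2 expr1n. Qed.

Section DeleteItem.
Variables (T : Type) (A : comNzRingType).
Implicit Types (l : seq T) (f g : seq T -> A).

Definition del i l := take i l ++ drop i.+1 l.

Lemma size_del i l : (i < size l)%N -> size (del i l) = (size l).-1.
Proof. by move=> il; rewrite size_cat size_take size_drop il; lia. Qed.

Lemma nth_del x0 i j l : (i < size l)%N -> nth x0 (del i l) j = nth x0 l (bump i j).
Proof.
move=> il; rewrite nth_cat size_take il /bump; case: ltnP => ji.
  by rewrite nth_take // leqNgt ji.
by rewrite nth_drop; congr (nth _ _ _); lia.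
Qed.

Lemma map_del (U : Type) (h : T -> U) i l :
  map h (take i l ++ drop i.+1 l) = take i (map h l) ++ drop i.+1 (map h l).
Proof. by rewrite map_cat map_take map_drop. Qed.

Definition dsum f l : A := \sum_(i < size l) (-1) ^+ i * f (del i l).

(** The boundary formula of a cone, d(x l) = l - x d(l). It drives the inductions on tuples
    below. *)
Lemma dsum_cons f x l : dsum f (x :: l) = f l - dsum (fun k => f (x :: k)) l.
Proof.
rewrite /dsum big_ord_recl /= {1}/del /= drop0 mul1r -sumrN; congr (_ + _).
by apply: eq_bigr => i _; rewrite exprS mulN1r mulNr.
Qed.

Lemma dsumD f g l : dsum (fun k => f k + g k) l = dsum f l + dsum g l.
Proof. by rewrite /dsum -big_split; apply: eq_bigr => i _; rewrite mulrDr. Qed.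

Lemma dsumN f l : dsum (fun k => - f k) l = - dsum f l.
Proof. by rewrite /dsum -sumrN; apply: eq_bigr => i _; rewrite mulrN. Qed.

Lemma dsum_dsum f l : dsum (dsum f) l = 0.
Proof.
elim: l f => [|x l IH] f; first by rewrite /dsum big_ord0.
rewrite dsum_cons.
rewrite (_ : (fun k => _) = fun k => f k + - dsum (fun j => f (x :: j)) k).
  by rewrite dsumD dsumN IH oppr0 addr0 subrr.
by apply/funext => k; rewrite dsum_cons.
Qed.

Lemma eq_dsum f g l : (forall k, (size k).+1 = size l -> f k = g k) ->
  dsum f l = dsum g l.
Proof.
move=> fg; apply: eq_bigr => i _; congr (_ * _).
by apply: fg; rewrite size_del //; case: (size l) i => // -[].
Qed.

End DeleteItem.

Lemma dsumF2 (T : Type) (f : seq T -> 'F_2) l :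
  dsum f l = \sum_(i < size l) f (del i l).
Proof. by apply: eq_bigr => i _; rewrite signr_F2 mul1r. Qed.

Lemma dsum_consF2 (T : Type) (f : seq T -> 'F_2) x l :
  dsum f (x :: l) = f l + dsum (fun k => f (x :: k)) l.
Proof. by rewrite dsum_cons oppr_F2. Qed.

Section Subdivision.
Variables (T : Type) (bary : seq T -> T).
Implicit Types (l : seq T) (f g : seq T -> 'F_2).

(* Cochain form of the subdivision [Sd l = b (Sd (d l))], where [b] is the
   barycenter of [l] and [b k] the cone on [k]; [sdh] is the form of the chain
   homotopy [T l = b (l + T (d l))]. *)
Fixpoint sd_rec n f l : 'F_2 :=
  if n is n'.+1 then
    \sum_(i < size l) sd_rec n' (fun k => f (bary l :: k)) (del i l)
  else f l.

Definition sd f l := sd_rec (size l) f l.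

Fixpoint sdh_rec n f l : 'F_2 :=
  if n is n'.+1 then
    f (bary l :: l) +
    \sum_(i < size l) sdh_rec n' (fun k => f (bary l :: k)) (del i l)
  else 0.

Definition sdh f l := sdh_rec (size l) f l.

Lemma sdE f l : (0 < size l)%N ->
  sd f l = dsum (sd (fun k => f (bary l :: k))) l.
Proof.
case: l => // x l _; rewrite dsumF2; apply: eq_bigr => i _.
by rewrite /sd size_del.
Qed.

Lemma sdhE f l : (0 < size l)%N ->
  sdh f l = f (bary l :: l) + dsum (sdh (fun k => f (bary l :: k))) l.
Proof.
case: l => // x l _; rewrite dsumF2; congr (_ + _); apply: eq_bigr => i _.
by rewrite /sdh size_del.
Qed.

Lemma sd0 f : sd f [::] = f [::]. Proof. by []. Qed.
Lemma sdh0 f : sdh f [::] = 0. Proof. by []. Qed.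

Lemma sd_recD n f g l :
  sd_rec n (fun k => f k + g k) l = sd_rec n f l + sd_rec n g l.
Proof.
elim: n f g l => //= n IH f g l; rewrite -big_split; apply: eq_bigr => i _.
exact: IH.
Qed.

Lemma sdD f g l : sd (fun k => f k + g k) l = sd f l + sd g l.
Proof. exact: sd_recD. Qed.

Lemma sdh_recD n f g l :
  sdh_rec n (fun k => f k + g k) l = sdh_rec n f l + sdh_rec n g l.
Proof.
elim: n f g l => [|n IH] f g l /=; first by rewrite addr0.
rewrite addrACA -big_split; congr (_ + _); apply: eq_bigr => i _.
exact: IH.
Qed.

Lemma sdhD f g l : sdh (fun k => f k + g k) l = sdh f l + sdh g l.
Proof. exact: sdh_recD. Qed.

(** Evaluated on a cone, [dsum f] splits into [f] on the base and the [dsum] of the cone cochain. By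
    induction the second part is a [dsum], which the outer [dsum] kills. *)
Lemma sd_dsum f l : sd (dsum f) l = dsum (sd f) l.
Proof.
have [n] := ubnP (size l); elim: n l f => // n IH l f /ltnSE le_ln.
case: (posnP (size l)) => [/size0nil ->|l0].
  by rewrite sd0 /dsum !big_ord0.
rewrite sdE //.
rewrite (@eq_dsum _ _ _ (fun k => sd f k + dsum (sd (fun k => f (bary l :: k))) k)).
  by rewrite dsumD dsum_dsum addr0.
move=> k kl; rewrite -IH ?kl // -sdD; congr (sd _ k).
by apply/funext => j; rewrite dsum_consF2.
Qed.

(** The identity for shorter tuples is applied to the cone cochain; the remaining terms cancel in
    pairs in characteristic 2. *)
Lemma sd_homotopy f l : f l + sd f l = sdh (dsum f) l + dsum (sdh f) l.
Proof.
have [n] := ubnP (size l); elim: n l f => // n IH l f /ltnSE le_ln.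
case: (posnP (size l)) => [/size0nil ->|l0].
  by rewrite sd0 addrr_F2 sdh0 /dsum big_ord0 addr0.
rewrite sdhE // dsum_consF2; set fb := fun k => f (bary l :: k).
rewrite [X in _ = _ + X + _](@eq_dsum _ _ _ (fun k => sdh f k + (fb k + sd fb k + dsum (sdh fb) k))); last first.
  move=> k kl; rewrite (IH k) ?kl // -addrA addrr_F2 addr0 -sdhD.
  by congr (sdh _ k); apply/funext => j; rewrite dsum_consF2.
rewrite !dsumD dsum_dsum addr0 -sdE // -/fb.
set a := f l; set b := dsum fb l; set c := dsum (sdh f) l; set e := sd f l.
transitivity (a + e + (b + b) + (c + c)); first by rewrite !addrr_F2 !addr0.
by ring.
Qed.

End Subdivision.

(** * Affine singular simplices *)

Section AffineSimplices.
Variable R : realType.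
Implicit Types (n k : nat).

Lemma vertex_simplex n (i : 'I_n.+1) : std_simplex R n (delta_mx ord0 i).
Proof.
split=> [j|]; first by rewrite mxE ler0n.
rewrite (bigD1 i) //= mxE !eqxx big1 ?addr0 // => j ji.
by rewrite mxE (negPf ji) andbF.
Qed.

Definition vertex n (i : nat) : std_simplex R n :=
  SigSub (mem_set (vertex_simplex (inord i))).

Definition comb n k (p : nat -> 'rV[R]_n.+1) (t : 'rV[R]_k.+1) : 'rV[R]_n.+1 :=
  \sum_(i < k.+1) t ord0 i *: p i.

Lemma combE n k (p : nat -> 'rV[R]_n.+1) (t : 'rV[R]_k.+1) j :
  comb p t ord0 j = \sum_(i < k.+1) t ord0 i * p i ord0 j.
Proof. by rewrite summxE; apply: eq_bigr => i _; rewrite mxE. Qed.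

Lemma comb_simplex n k (p : nat -> 'rV[R]_n.+1) t :
  (forall i, std_simplex R n (p i)) -> std_simplex R k t ->
  std_simplex R n (comb p t).
Proof.
move=> pn [t0 t1]; split=> [j|].
  by rewrite combE; apply: sumr_ge0 => i _; apply: mulr_ge0 => //; case: (pn i).
under eq_bigr do rewrite combE.
rewrite exchange_big /= -[RHS]t1; apply: eq_bigr => i _.
by rewrite -mulr_sumr; case: (pn i) => _ ->; rewrite mulr1.
Qed.

(** Vertices are indexed by [nat], so that a list of any length can supply them through [nth]; the
    values beyond [k] do not matter. *)
Definition aff n k (p : nat -> std_simplex R n) (t : std_simplex R k) :
    std_simplex R n :=
  SigSub (mem_set (comb_simplex (fun i => set_valP (p i)) (set_valP t))).

Lemma aff_val n k (p : nat -> std_simplex R n) (t : std_simplex R k) :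
  set_val (aff p t) = comb (fun i => set_val (p i)) (set_val t).
Proof. by []. Qed.

Lemma matrix_continuous (T : topologicalType) m n (f : T -> 'M[R]_(m, n)) x :
  (forall i j, {for x, continuous (fun t => f t i j)}) -> {for x, continuous f}.
Proof.
move=> fc P [Q tQ QP]; rewrite nbhs_simpl /=.
have : \forall u \near x, forall i j, Q i j (f u i j).
  apply: (filter_forall (F := nbhs x)) => i.
  by apply: (filter_forall (F := nbhs x)) => j; exact: (fc i j) (tQ i j).
by apply: filterS => u Qu; exact: QP.
Qed.

Lemma aff_continuous n k (p : nat -> std_simplex R n) :
  continuous (@aff n k p).
Proof.
apply: continuous_comp_initial => t; apply: matrix_continuous => i j.
move: t; rewrite -/(continuous _) (_ : (fun _ => _) = (fun t : std_simplex R k =>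
    \sum_(l < k.+1) set_val t ord0 l * set_val (p l) ord0 j)); last first.
  by apply/funext => u /=; rewrite ord1 aff_val combE.
apply: continuous_big => [|l _]; first exact: add_continuous.
move=> u; apply: (@continuousM R (std_simplex R k) (fun t => set_val t ord0 l)
  (cst (set_val (p l) ord0 j))); last exact: cst_continuous.
apply: (@continuous_comp _ _ _ set_val (fun v : 'rV[R]_k.+1 => v ord0 l)).
  exact: initial_continuous.
exact: coord_continuous.
Qed.

HB.instance Definition _ n k (p : nat -> std_simplex R n) :=
  @isContinuous.Build _ _ (@aff n k p) (@aff_continuous n k p).

Lemma simplex_inj n (u v : std_simplex R n) : set_val u = set_val v -> u = v.
Proof. exact: val_inj. Qed.

Lemma aff_aff n k l (p : nat -> std_simplex R n) (q : nat -> std_simplex R k)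
    (t : std_simplex R l) :
  aff p (aff q t) = aff (fun i => aff p (q i)) t.
Proof.
apply: simplex_inj; rewrite !aff_val /comb.
under eq_bigr do rewrite summxE scaler_suml.
rewrite exchange_big /=; apply: eq_bigr => i _.
rewrite aff_val scaler_sumr; apply: eq_bigr => j _.
by rewrite mxE scalerA.
Qed.

Lemma eq_aff n k (p q : nat -> std_simplex R n) (t : std_simplex R k) :
  (forall i, (i <= k)%N -> p i = q i) -> aff p t = aff q t.
Proof.
move=> pq; apply: simplex_inj; rewrite !aff_val; apply: eq_bigr => i _.
by rewrite pq // -ltnS.
Qed.

Lemma aff_vertices n (t : std_simplex R n) : aff (vertex n) t = t.
Proof.
apply: simplex_inj; rewrite aff_val; apply/rowP => j.
rewrite combE (bigD1 j) //= mxE eqxx inord_val eqxx mulr1 big1 ?addr0 // => i ij.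
by rewrite mxE inord_val eq_sym (negPf ij) andbF mulr0.
Qed.

Lemma aff_vertex n k (p : nat -> std_simplex R n) i : (i <= k)%N ->
  aff p (vertex k i) = p i.
Proof.
move=> ik; apply: simplex_inj; rewrite aff_val; apply/rowP => j.
have vi : (inord i : 'I_k.+1) = i :> nat by rewrite inordK.
rewrite combE (bigD1 (inord i)) //= mxE !eqxx mul1r vi big1 ?addr0 // => l il.
by rewrite mxE (negPf il) andbF mul0r.
Qed.

Lemma vertex_mapE n k (f : 'I_k.+1 -> 'I_n.+1) (t : std_simplex R k) :
  vertex_map f t = aff (fun i => vertex n (f (inord i))) t.
Proof.
apply: simplex_inj; rewrite aff_val; apply/rowP => j.
rewrite combE [LHS]mxE big_mkcond /=; apply: eq_bigr => i _.
rewrite mxE eqxx /= !inord_val eq_sym; case: eqP => _; by rewrite ?mulr1 ?mulr0.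
Qed.

End AffineSimplices.

Section AffineSingular.
Variables (R : realType) (X : topologicalType).
Local Notation Delta := (std_simplex R).

Lemma eq_simplex n (s s' : continuousType (Delta n) X) : s =1 s' ->
  existT (fun n => continuousType (Delta n) X) n s = existT _ n s'.
Proof. by move/continuousEP => ->. Qed.

(** The list carries the dimension in its length, so faces need no casts. The empty list yields a
    meaningless 0-simplex, which [pullback] discards. *)
Definition asx n (s : continuousType (Delta n) X) (l : seq (Delta n)) :
    singular_simplex R X :=
  existT _ (size l).-1
    (s \o aff (nth (vertex R n 0) l) : continuousType (Delta (size l).-1) X).

(** The identification of [k] with [(size l).-1] in the dependent pair is made here once; afterwards
    simplices are compared through their lists of vertices. *)
Lemma asx_intro n (s : continuousType (Delta n) X) (l : seq (Delta n)) k
    (u : continuousType (Delta k) X) (p : nat -> Delta n) :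
  size l = k.+1 -> (forall t, u t = s (aff p t)) ->
  (forall i, (i <= k)%N -> p i = nth (vertex R n 0) l i) ->
  existT _ k u = asx s l.
Proof.
move=> lk up pl; have e : k = (size l).-1 by rewrite lk.
rewrite /asx; case: _ / e; apply: eq_simplex => t.
by rewrite up /=; congr (s _); exact: eq_aff.
Qed.

Definition vertices n : seq (Delta n) := mkseq (vertex R n) n.+1.

Lemma size_vertices n : size (vertices n) = n.+1.
Proof. exact: size_mkseq. Qed.

Lemma asx_vertices n (s : continuousType (Delta n) X) :
  asx s (vertices n) = existT _ n s.
Proof.
symmetry; apply: (asx_intro (p := vertex R n)); first exact: size_vertices.
  by move=> t; rewrite aff_vertices.
by move=> i il; rewrite nth_mkseq.
Qed.

Lemma asx_asx n (s : continuousType (Delta n) X) l l' : (0 < size l')%N ->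
  asx (projT2 (asx s l)) l' =
  asx s (map (aff (nth (vertex R n 0) l)) l').
Proof.
case: l' => // y l' _.
apply: (asx_intro (p := fun i => aff (nth (vertex R n 0) l) (nth (vertex R _ 0) (y :: l') i))).
- by rewrite size_map.
- by move=> t; rewrite /= aff_aff.
- by move=> i /= il; rewrite (nth_map (vertex R _ 0) _ _ (s := y :: l')).
Qed.

Lemma sub_simplex_asx n (s : continuousType (Delta n) X) k (f : 'I_k.+1 -> 'I_n.+1) :
  sub_simplex s f = asx s (mkseq (fun i => vertex R n (f (inord i))) k.+1).
Proof.
apply: asx_intro; first exact: size_mkseq.
  by move=> t /=; rewrite vertex_mapE.
by move=> i ik; rewrite nth_mkseq.
Qed.

Lemma face_vertices n (s : continuousType (Delta n.+1) X) (i : 'I_n.+2) :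
  sub_simplex s (lift i) = asx s (del i (vertices n.+1)).
Proof.
rewrite sub_simplex_asx; congr (asx s _).
apply: (@eq_from_nth _ (vertex R n.+1 0)).
  by rewrite size_mkseq size_del size_vertices.
move=> j; rewrite size_mkseq => jn; rewrite nth_del ?size_vertices //.
rewrite !nth_mkseq //; last by rewrite /bump; lia.
by rewrite /= inordK.
Qed.

Definition inside (U : set X) (x : singular_simplex R X) : Prop :=
  range (projT2 x) `<=` U.

Lemma inside_asx U n (s : continuousType (Delta n) X) l :
  inside U (existT _ n s) -> inside U (asx s l).
Proof. by move=> sU _ [t _ <-]; apply: sU; exists (aff (nth (vertex R n 0) l) t). Qed.

Lemma inside_sub_simplex U n (s : continuousType (Delta n) X) k (f : 'I_k.+1 -> 'I_n.+1) :
  inside U (existT _ n s) -> inside U (sub_simplex s f).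
Proof. by rewrite sub_simplex_asx; exact: inside_asx. Qed.

Lemma insideS U V x : U `<=` V -> inside U x -> inside V x.
Proof. by move=> UV xU; exact: subset_trans xU UV. Qed.

Lemma insideI U V x : inside (U `&` V) x <-> inside U x /\ inside V x.
Proof. by rewrite /inside subsetI. Qed.

Section Pullback.
Variable A : comNzRingType.
Implicit Type c : cochain R X A.

(** The value 0 on the empty tuple suppresses the augmentation: [dsum] then gives the coboundary in
    degree 0 too. *)
Definition pullback c n (s : continuousType (Delta n) X) (l : seq (Delta n)) : A :=
  if l is [::] then 0 else c (asx s l).

Lemma pullbackE c n (s : continuousType (Delta n) X) l :
  (0 < size l)%N -> pullback c s l = c (asx s l).
Proof. by case: l. Qed.

Lemma coboundaryE c n (s : continuousType (Delta n) X) :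
  coboundary c (existT _ n s) = dsum (pullback c s) (vertices n).
Proof.
rewrite /dsum size_vertices; case: n s => [|n] s.
  by rewrite big_ord1 mulr0.
apply: eq_bigr => i _; rewrite face_vertices pullbackE //.
by rewrite size_del size_vertices.
Qed.

Lemma pullback_asx c n (s : continuousType (Delta n) X) l :
  pullback c (projT2 (asx s l)) =
  fun l' => pullback c s (map (aff (nth (vertex R n 0) l)) l').
Proof. by apply/funext => -[|y l'] //=; rewrite asx_asx. Qed.

Lemma map_vertices n (l : seq (Delta n)) : (0 < size l)%N ->
  map (aff (nth (vertex R n 0) l)) (vertices (size l).-1) = l.
Proof.
move=> l0; apply: (@eq_from_nth _ (vertex R n 0)).
  by rewrite size_map size_vertices prednK.
move=> i; rewrite size_map size_vertices => il.
by rewrite (nth_map (vertex R _ 0)) ?size_vertices // nth_mkseq // aff_vertex.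
Qed.

Lemma coboundary_asx c n (s : continuousType (Delta n) X) l :
  (0 < size l)%N -> coboundary c (asx s l) = dsum (pullback c s) l.
Proof.
move=> l0; rewrite coboundaryE pullback_asx -[in RHS](map_vertices l0).
by rewrite /dsum size_map; apply: eq_bigr => i _; rewrite map_del.
Qed.

Lemma pullback_coboundary c n (s : continuousType (Delta n) X) :
  pullback (coboundary c) s = dsum (pullback c s).
Proof.
apply/funext => -[|y l]; first by rewrite /dsum big_ord0.
by rewrite pullbackE // coboundary_asx.
Qed.

Lemma coboundary_coboundary c : coboundary (coboundary c) = 0.
Proof.
by apply/funext => -[n s]; rewrite coboundaryE pullback_coboundary dsum_dsum.
Qed.

Lemma coboundary_inside0 U c x : (forall y, inside U y -> c y = 0) ->
  inside U x -> coboundary c x = 0.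
Proof.
move=> c0; case: x => -[|n] s sU //; apply: big1 => i _.
by rewrite c0 ?mulr0 //; exact: inside_sub_simplex.
Qed.

Lemma coboundary_eq_inside U c c' x : (forall y, inside U y -> c y = c' y) ->
  inside U x -> coboundary c x = coboundary c' x.
Proof.
move=> cc' xU; apply/eqP; rewrite -subr_eq0; apply/eqP.
transitivity (coboundary (c - c') x); first by rewrite linearB.
by apply: coboundary_inside0 xU => y yU; apply/eqP; rewrite subr_eq0 cc'.
Qed.

End Pullback.

End AffineSingular.

(** * Small simplices and excision *)

Section SubdivisionMap.
Variables (T U : Type) (baryT : seq T -> T) (baryU : seq U -> U) (h : T -> U).
Hypothesis hb : forall l, (0 < size l)%N -> h (baryT l) = baryU (map h l).

(** Naturality of subdivision. For affine maps it says that subdividing a face on its own or inside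
    the whole simplex gives the same result. *)
Lemma sd_map f l : sd baryU f (map h l) = sd baryT (f \o map h) l.
Proof.
have [n] := ubnP (size l); elim: n f l => // n IH f l /ltnSE le_ln.
have [/size0nil -> //|l0] := posnP (size l).
rewrite !sdE ?size_map // !dsumF2 size_map; apply: eq_bigr => i _.
rewrite /del -map_del IH -?hb //.
by rewrite -/(del _ _) size_del //; lia.
Qed.

Lemma sdh_map f l : sdh baryU f (map h l) = sdh baryT (f \o map h) l.
Proof.
have [n] := ubnP (size l); elim: n f l => // n IH f l /ltnSE le_ln.
have [/size0nil -> //|l0] := posnP (size l).
rewrite !sdhE ?size_map // !dsumF2 size_map -hb //; congr (_ + _).
apply: eq_bigr => i _; rewrite /del -map_del IH -?hb //.
by rewrite -/(del _ _) size_del //; lia.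
Qed.

End SubdivisionMap.

Lemma sd_zero (T : Type) (b : seq T -> T) l : sd b (fun=> 0) l = 0.
Proof.
rewrite /sd; move: (size l) => m; elim: m l => //= m IH l; apply: big1 => i _; exact: IH.
Qed.

Lemma sdh_zero (T : Type) (b : seq T -> T) l : sdh b (fun=> 0) l = 0.
Proof.
rewrite /sdh; move: (size l) => m; elim: m l => //= m IH l; rewrite add0r.
by apply: big1 => i _; exact: IH.
Qed.

Section Barycenter.
Variable R : realType.
Local Notation Delta := (std_simplex R).

Lemma center_simplex k : std_simplex R k (const_mx k.+1%:R^-1).
Proof.
split=> [i|]; first by rewrite mxE invr_ge0 ler0n.
under eq_bigr do rewrite mxE.
by rewrite sumr_const card_ord -[LHS]mulr_natl mulfV // pnatr_eq0.
Qed.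

Definition center k : Delta k := SigSub (mem_set (center_simplex k)).

Definition bary n (l : seq (Delta n)) : Delta n :=
  aff (nth (vertex R n 0) l) (center (size l).-1).

Lemma bary_aff n k (p : nat -> Delta n) (l : seq (Delta k)) : (0 < size l)%N ->
  aff p (bary l) = bary (map (aff p) l).
Proof.
move=> l0; rewrite /bary aff_aff size_map; apply: eq_aff => i il.
by rewrite (nth_map (vertex R _ 0)) //; lia.
Qed.

Lemma bary_coord n (l : seq (Delta n)) j : (0 < size l)%N ->
  set_val (bary l) ord0 j = (size l)%:R^-1 * \sum_(u <- l) set_val u ord0 j.
Proof.
move=> l0; rewrite aff_val combE (big_nth (vertex R n 0)) big_mkord mulr_sumr.
have : (size l).-1.+1 = size l by lia.
case: (size l) => //= k _; by apply: eq_bigr => i _; rewrite mxE.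
Qed.

End Barycenter.

Section SingularSubdivision.
Variables (R : realType) (X : topologicalType).
Local Notation Delta := (std_simplex R).
Local Notation cochain2 := (cochain R X 'F_2).
Implicit Type c : cochain2.

Definition Sd c : cochain2 := fun x =>
  sd (@bary R (projT1 x)) (pullback c (projT2 x)) (vertices R (projT1 x)).

Definition Sdh c : cochain2 := fun x =>
  sdh (@bary R (projT1 x)) (pullback c (projT2 x)) (vertices R (projT1 x)).

Lemma pullback_Sd c n (s : continuousType (Delta n) X) :
  pullback (Sd c) s = sd (@bary R n) (pullback c s).
Proof.
apply/funext => l; case: (posnP (size l)) => [/size0nil -> //|l0].
rewrite pullbackE // /Sd pullback_asx -[in RHS](map_vertices l0).
by rewrite (sd_map (@bary_aff _ _ _ _)).
Qed.

Lemma pullback_Sdh c n (s : continuousType (Delta n) X) :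
  pullback (Sdh c) s = sdh (@bary R n) (pullback c s).
Proof.
apply/funext => l; case: (posnP (size l)) => [/size0nil -> //|l0].
rewrite pullbackE // /Sdh pullback_asx -[in RHS](map_vertices l0).
by rewrite (sdh_map (@bary_aff _ _ _ _)).
Qed.

Lemma Sd_homotopy c : c + Sd c = Sdh (coboundary c) + coboundary (Sdh c).
Proof.
apply/funext => -[n s]; have := sd_homotopy (@bary R n) (pullback c s) (vertices R n).
rewrite -pullback_Sdh -coboundaryE -pullback_coboundary.
by rewrite {1}pullbackE ?size_vertices // asx_vertices.
Qed.

Lemma coboundary_Sd c : coboundary (Sd c) = Sd (coboundary c).
Proof.
apply/funext => -[n s].
by rewrite coboundaryE pullback_Sd -sd_dsum -pullback_coboundary.
Qed.

Lemma pullback_inside0 c U n (s : continuousType (Delta n) X) :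
  (forall y, inside U y -> c y = 0) -> inside U (existT _ n s) ->
  pullback c s = fun=> 0.
Proof.
move=> c0 sU; apply/funext => -[|y l] //; rewrite pullbackE //.
by apply: c0; exact: inside_asx.
Qed.

Lemma Sd_inside0 c U : (forall y, inside U y -> c y = 0) ->
  forall y, inside U y -> Sd c y = 0.
Proof.
by move=> c0 [n s] sU; rewrite /Sd (pullback_inside0 c0 sU) sd_zero.
Qed.

Lemma Sdh_inside0 c U : (forall y, inside U y -> c y = 0) ->
  forall y, inside U y -> Sdh c y = 0.
Proof.
by move=> c0 [n s] sU; rewrite /Sdh (pullback_inside0 c0 sU) sdh_zero.
Qed.

Lemma pullback_iter_Sd m c n (s : continuousType (Delta n) X) :
  pullback (iter m Sd c) s = iter m (sd (@bary R n)) (pullback c s).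
Proof. by elim: m => //= m <-; rewrite pullback_Sd. Qed.

Lemma coboundary_iter_Sd m c :
  coboundary (iter m Sd c) = iter m Sd (coboundary c).
Proof. by elim: m => //= m <-; rewrite coboundary_Sd. Qed.

Lemma iter_Sd_inside0 m c U : (forall y, inside U y -> c y = 0) ->
  forall y, inside U y -> iter m Sd c y = 0.
Proof. by move=> c0; elim: m => //= m; exact: Sd_inside0. Qed.

End SingularSubdivision.

(** * Mesh of iterated barycentric subdivisions *)

Section Mesh.
Variables (R : realType) (n : nat).
Local Notation Delta := (std_simplex R n).
Local Notation coord u j := (set_val u ord0 j).
Implicit Types (l k : seq Delta) (r : R).

(** The diameter in the maximum norm, measured on the vertices only. *)
Definition diamle r l : Prop :=
  forall u v j, u \in l -> v \in l -> `|coord u j - coord v j| <= r.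

(** The smallest coordinate box around [l] stands in for the convex hull: it contains the barycenter
    and shrinks when [l] is replaced by a face. *)
Definition inbox l (v : Delta) : Prop := forall j a b,
  (forall u, u \in l -> a <= coord u j <= b) -> a <= coord v j <= b.

Lemma mem_del (l : seq Delta) i u : u \in del i l -> u \in l.
Proof. by rewrite mem_cat => /orP[/mem_take|/mem_drop]. Qed.

(** The vertex [u] contributes 0 to the average, so a factor (s - 1) / s of [r] remains, where s is
    [size l]. The bound s <= M + 1 makes the factor uniform over all faces. *)
Lemma bary_near l M r u j : (size l <= M.+1)%N -> diamle r l -> u \in l ->
  `|coord (bary l) j - coord u j| <= M%:R / M.+1%:R * r.
Proof.
move=> lM lr ul; have l0 : (0 < size l)%N by case: l ul {lM lr}.
have r0 : 0 <= r by apply: le_trans (lr u u j ul ul).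
have sl : (size l)%:R != 0 :> R by rewrite pnatr_eq0 -lt0n.
have -> : coord (bary l) j - coord u j =
    (size l)%:R^-1 * \sum_(v <- l) (coord v j - coord u j).
  rewrite bary_coord // sumrB mulrBr; congr (_ - _).
  by rewrite big_const_seq count_predT iter_addr_0 -[X in _ * X]mulr_natl mulKf.
rewrite normrM ger0_norm ?invr_ge0 //.
have sum_le : `|\sum_(v <- l) (coord v j - coord u j)| <= (size l).-1%:R * r.
  rewrite (perm_big _ (perm_to_rem ul)) big_cons /= subrr add0r.
  apply: le_trans (ler_norm_sum _ _ _) _.
  apply: (@le_trans _ _ (\sum_(v <- rem u l) r)).
    by rewrite big_seq [leRHS]big_seq; apply: ler_sum => v /mem_rem vl; exact: lr.
  by rewrite big_const_seq count_predT iter_addr_0 size_rem // mulr_natl.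
apply: le_trans (ler_wpM2l _ sum_le) _; first by rewrite invr_ge0.
rewrite mulrA; apply: ler_wpM2r => //.
have sl0 : 0 < (size l)%:R :> R by rewrite ltr0n.
rewrite ler_pdivlMr ?ltr0n // -mulrA ler_pdivrMl // -!natrM ler_nat; nia.
Qed.

Lemma bary_inbox l : (0 < size l)%N -> inbox l (bary l).
Proof.
move=> l0 j a b lab; rewrite bary_coord //.
have sl0 : 0 < (size l)%:R :> R by rewrite ltr0n.
have sumc z : \sum_(u <- l) z = (size l)%:R * z :> R.
  by rewrite big_const_seq count_predT iter_addr_0 mulr_natl.
rewrite ler_pdivlMl // ler_pdivrMl // -!sumc !(big_seq_cond xpredT) /=.
by apply/andP; split; apply: ler_sum => u; rewrite andbT => /lab/andP[].
Qed.

Lemma sd_mesh M r f l : (size l <= M.+1)%N -> diamle r l ->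
  (forall k, size k = size l -> diamle (M%:R / M.+1%:R * r) k -> f k = 0) ->
  sd (@bary R n) f l = 0.
Proof.
move=> lM lr f0.
(* The claim is strengthened for the induction: [f] has to vanish only on tuples in the box of [l].
   This is what bounds the distance from the barycenter of [l] to the vertices that subdivide a
   face. *)
have {f0} : forall k, size k = size l -> (forall v, v \in k -> inbox l v) ->
  diamle (M%:R / M.+1%:R * r) k -> f k = 0 by move=> k kl _; exact: f0.
move=> f0; suff key : forall m, size l = m -> sd_rec (@bary R n) m f l = 0 by exact: key.
move=> m; elim: m l f lM lr f0 => [|m IH] l f lM lr f0 lm.
  by move/size0nil: lm => -> /= in f0 *; apply: f0 => // ? ?; rewrite in_nil.
apply: big1 => i _; have il : (i < size l)%N by [].
have l0 : (0 < size l)%N by rewrite lm.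
have r0 : 0 <= r.
  have xl : nth (vertex R n 0) l 0 \in l by exact: mem_nth.
  exact: le_trans (normr_ge0 _) (lr _ _ ord0 xl xl).
apply: IH => [|u v j /mem_del ul /mem_del vl|k|].
- by rewrite size_del //; lia.
- exact: lr.
- move: i il => /= [i /= _] il; rewrite size_del // lm /= => km kl kr.
  have kb v : v \in k -> inbox l v.
    by move=> vk j a b lab; apply: (kl v vk) => u /mem_del; exact: lab.
  have near v j : v \in k -> `|set_val (bary l) ord0 j - set_val v ord0 j| <= M%:R / M.+1%:R * r.
    move=> vk; rewrite ler_distlC; apply: (kb v vk) => u ul.
    by rewrite -ler_distlC; exact: bary_near.
  apply: f0; first by rewrite /= km lm.
    by move=> v; rewrite inE => /orP[/eqP ->|/kb //]; exact: bary_inbox.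
  move=> u v j; rewrite !inE => /orP[/eqP ->|uk] /orP[/eqP ->|vk].
  - by rewrite subrr normr0 mulr_ge0 ?divr_ge0.
  - exact: near.
  - by rewrite distrC; exact: near.
  - exact: kr.
- by rewrite size_del // lm.
Qed.

Lemma iter_sd_mesh m M r f l : (size l <= M.+1)%N -> diamle r l ->
  (forall k, size k = size l -> diamle ((M%:R / M.+1%:R) ^+ m * r) k -> f k = 0) ->
  iter m (sd (@bary R n)) f l = 0.
Proof.
elim: m r l => [|m IH] r l lM lr f0 /=; first by apply: f0; rewrite // expr0 mul1r.
apply: (sd_mesh lM lr) => k kl kr; apply: (IH _ _ _ kr); first by rewrite kl.
by move=> k' k'k k'r; apply: f0; rewrite ?k'k // exprSr -mulrA.
Qed.

End Mesh.

(** * Lebesgue numbers of coverings by two open sets *)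

Section Lebesgue.
Variable R : realType.
Local Notation Delta := (std_simplex R).

Lemma std_simplex_le1 n (t : 'rV[R]_n.+1) i : std_simplex R n t -> 0 <= t ord0 i <= 1.
Proof.
case=> t0 t1; rewrite t0 -t1 (bigD1 i) //= lerDl; exact: sumr_ge0.
Qed.

Lemma std_simplex_compact n : compact (std_simplex R n).
Proof.
have cube := @rV_compact R n.+1 (fun=> `[0, 1]%classic)
  (fun=> @segment_compact R 0 1).
apply: subclosed_compact cube _; last first.
  by move=> t /std_simplex_le1 t01 i /=; rewrite in_itv /=.
have -> : std_simplex R n =
    \bigcap_(i in setT) [set t : 'rV[R]_n.+1 | 0 <= t ord0 i] `&`
    [set t | \sum_i t ord0 i = 1].
  rewrite predeqE => t; split=> [[t0 t1]|[t0 t1]]; first by split=> // i _; exact: t0.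
  by split=> // i; exact: t0 i I.
apply: closedI.
  apply: closed_bigI => i _.
  apply: (@preimage_closed _ _ (fun t : 'rV[R]_n.+1 => t ord0 i) [set x | 0 <= x]).
    by move=> ? _; exact: coord_continuous.
  exact: closed_ge.
apply: (@preimage_closed _ _ (fun t : 'rV[R]_n.+1 => \sum_i t ord0 i) [set x | x = 1]).
  move=> + _; apply: continuous_big => [|i _]; [exact: add_continuous|exact: coord_continuous].
exact: closed_eq.
Qed.

Definition boxnear n (r : R) (v u : 'rV[R]_n.+1) : Prop :=
  forall j, `|u ord0 j - v ord0 j| <= r.

Variable X : topologicalType.

Lemma preimage_box n (s : continuousType (Delta n) X) U (t : Delta n) :
  open U -> U (s t) ->
  exists2 e : R, 0 < e & forall u : Delta n, boxnear e (set_val t) (set_val u) -> U (s u).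
Proof.
move=> oU Ust.
have [W [oW Wt WU]] : exists W, [/\ open W, W (set_val t) &
    forall u : Delta n, W (set_val u) -> U (s u)].
  have := cts_fun (s := s) t _ (open_nbhs_nbhs (conj oU Ust)).
  rewrite nbhs_simpl => -[V [[W oW WV] Vt] VU]; exists W; split=> //.
    by rewrite -WV in Vt.
  by move=> u Wu; apply: VU; rewrite -WV.
have /nbhs_ballP[e e0 eW] : nbhs (set_val t) W by exact: open_nbhs_nbhs.
exists (e / 2); first by rewrite divr_gt0.
move=> u tu; apply: WU; apply: eW; split=> // i j; rewrite ord1 /ball /= distrC.
by apply: le_lt_trans (tu j) _; rewrite ltr_pdivrMr // ltr_pMr // ltr1n.
Qed.

Lemma lebesgue_number n (s : continuousType (Delta n) X) (P Q : set X) :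
  open P -> open Q -> range s `<=` P `|` Q ->
  exists2 e : R, 0 < e & forall v : Delta n,
    (forall u : Delta n, boxnear e (set_val v) (set_val u) -> P (s u)) \/
    (forall u : Delta n, boxnear e (set_val v) (set_val u) -> Q (s u)).
Proof.
move=> oP oQ sPQ.
pose good (U : set X) e (v : 'rV[R]_n.+1) :=
  forall u : Delta n, boxnear e v (set_val u) -> U (s u).
have local U (t : Delta n) : open U -> U (s t) ->
    \forall v \near set_val t & e \near 0^'+, good U e v.
  move=> oU /(preimage_box oU)[d d0 dU].
  (* Half of the radius is spent on moving the center, half is left for the box around it. *)
  exists (ball (set_val t) (d / 2), [set e : R | e < d / 2]).
    split; first by apply: nbhsx_ballx; rewrite divr_gt0.
    by apply: nbhs_right_lt; rewrite divr_gt0.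
  move=> [v e] [/= tv ed] u vu; apply: dU => j.
  have tvj : `|v ord0 j - set_val t ord0 j| < d / 2.
    by rewrite distrC; have := tv.2 ord0 j.
  rewrite (_ : _ - _ = set_val u ord0 j - v ord0 j + (v ord0 j - set_val t ord0 j)); last by ring.
  apply: le_trans (ler_normD _ _) _; rewrite [d in _ <= d]splitr.
  by apply: lerD; [exact: le_trans (vu j) (ltW ed)|exact: ltW].
have /compact_near_coveringP cov := @std_simplex_compact n.
have : \forall e \near 0^'+, std_simplex R n `<=` [set v | good P e v \/ good Q e v].
  apply: cov => t tn; pose t' : Delta n := SigSub (mem_set tn).
  have [Pt|Qt] : (P `|` Q) (s t') by apply: sPQ; exists t'.
    by apply: filterS (local P t' oP Pt) => -[v e] /=; left.
  by apply: filterS (local Q t' oQ Qt) => -[v e] /=; right.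
move=> good_near.
have [e [e0 eH]] : exists e : R, 0 < e /\
    (std_simplex R n `<=` [set v | good P e v \/ good Q e v]).
  near (0 : R)^'+ => e; exists e; split; first by near: e; exact: nbhs_right_gt.
  by near: e.
exists e => // v; exact: (eH _ (set_valP v)).
Unshelve. all: by end_near. Qed.

End Lebesgue.

Section SmallSimplices.
Variables (R : realType) (X : topologicalType) (P Q : set X).
Hypotheses (oP : open P) (oQ : open Q).
Local Notation Delta := (std_simplex R).
Local Notation cochain2 := (cochain R X 'F_2).
Implicit Type c : cochain2.

Let small c := (forall x, inside P x -> c x = 0) /\ (forall x, inside Q x -> c x = 0).

(** The bound [m0] depends on the simplex and not on the cochain. This uniformity makes the infinite
    sum of [small_cochain] finite on every simplex. *)
Lemma iter_Sd_small (x : singular_simplex R X) : inside (P `|` Q) x ->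
  exists m0, forall m c, (m0 <= m)%N -> small c -> iter m (@Sd R X) c x = 0.
Proof.
case: x => n s sPQ; have [e e0 eH] := lebesgue_number oP oQ sPQ.
have rho1 : `|n%:R / n.+1%:R : R| < 1.
  by rewrite ger0_norm ?divr_ge0 // ltr_pdivrMr ?ltr0n // mul1r ltr_nat.
have /cvgrPdist_lt/(_ e e0)[m0 _ m0P] := cvg_expr rho1.
exists m0 => m c m0m [cP cQ].
have -> : iter m (@Sd R X) c (existT _ n s) =
    pullback (iter m (@Sd R X) c) s (vertices R n).
  by rewrite pullbackE ?size_vertices // asx_vertices.
rewrite pullback_iter_Sd; apply: (@iter_sd_mesh _ _ _ n 1).
- by rewrite size_vertices.
- move=> u v j _ _; have := std_simplex_le1 j (set_valP u).
  by have := std_simplex_le1 j (set_valP v); rewrite ler_norml; lra.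
move=> k; rewrite size_vertices mulr1 => kn kr.
have ke : diamle e k.
  move=> u v j uk vk; apply: le_trans (kr u v j uk vk) _; apply: ltW.
  apply: le_lt_trans (m0P m m0m); rewrite sub0r normrN ler_norm //.
have k0 : (0 < size k)%N by rewrite kn.
rewrite pullbackE //; set v := nth (vertex R n 0) k 0.
have close (t : Delta (size k).-1) :
    boxnear e (set_val v) (set_val (aff (nth (vertex R n 0) k) t)).
  move=> j; rewrite aff_val combE.
  have [t0 t1] := set_valP t.
  rewrite -[set_val v ord0 j]mul1r -t1 mulr_suml -sumrB.
  apply: le_trans (ler_norm_sum _ _ _) _.
  rewrite -[e]mul1r -t1 mulr_suml; apply: ler_sum => i _.
  rewrite -mulrBr normrM ger0_norm //; apply: ler_wpM2l => //.
  have ik : (i < size k)%N by apply: leq_trans (ltn_ord i) _; rewrite prednK.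
  by apply: ke; exact: mem_nth.
by case: (eH v) => h; [apply: cP|apply: cQ] => _ [t _ <-]; exact: h (close t).
Qed.

Lemma iter_SdD m c c' :
  iter m (@Sd R X) (c + c') = iter m (@Sd R X) c + iter m (@Sd R X) c'.
Proof.
elim: m => //= m ->; apply/funext => -[n s]; rewrite /Sd -[RHS]sdD.
by congr (sd _ _ _); apply/funext => -[|y l] //=; rewrite addr0.
Qed.

Lemma iter_Sd_homotopy m c :
  iter m (@Sd R X) c + iter m.+1 (@Sd R X) c =
  iter m (@Sd R X) (Sdh (coboundary c)) + coboundary (iter m (@Sd R X) (Sdh c)).
Proof.
by rewrite coboundary_iter_Sd iterSr -(iter_SdD m c (Sd c))
  -(iter_SdD m (Sdh (coboundary c)) (coboundary (Sdh c))) Sd_homotopy.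
Qed.

(* The primitive is the sum of the cochains [Sd^i (Sdh c)] over all [i]; on a given
   simplex only finitely many of them are not zero. *)
Lemma small_cochain c :
  (forall x, inside (P `|` Q) x -> coboundary c x = 0) -> small c ->
  exists2 y, small y & forall x, inside (P `|` Q) x -> c x = coboundary y x.
Proof.
move=> cc0 csmall; pose z i := iter i (@Sd R X) (Sdh c); pose y_ M := \sum_(i < M) z i.
have zsmall i : small (z i).
  by split; apply: iter_Sd_inside0; apply: Sdh_inside0; apply csmall.
(* The homotopies between consecutive subdivisions telescope, since each intermediate term occurs
   twice. *)
have dy M x : inside (P `|` Q) x -> coboundary (y_ M) x = c x + iter M (@Sd R X) c x.
  elim: M x => [|M IH] x xPQ.
    by rewrite /y_ big_ord0 linear0 addrr_F2.
  rewrite /y_ big_ord_recr linearD /= -/(y_ M).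
  transitivity (coboundary (y_ M) x + coboundary (z M) x) => //; rewrite IH //.
  have : iter M (@Sd R X) c x + iter M.+1 (@Sd R X) c x =
      iter M (@Sd R X) (Sdh (coboundary c)) x + coboundary (z M) x.
    exact: (congr1 (fun f : cochain2 => f x) (iter_Sd_homotopy M c)).
  rewrite (@iter_Sd_inside0 _ _ M (Sdh (coboundary c)) (P `|` Q)) //; last exact: Sdh_inside0 cc0.
  by rewrite add0r => <-; rewrite addrA -[X in X + _]addrA addrr_F2 addr0.
have /choice[N NP] (x : singular_simplex R X) : exists m0, inside (P `|` Q) x ->
    forall m c, (m0 <= m)%N -> small c -> iter m (@Sd R X) c x = 0.
  case: (pselect (inside (P `|` Q) x)) => [xPQ|nx]; last by exists 0%N.
  by have [m0 m0P] := iter_Sd_small xPQ; exists m0 => _.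
pose y : cochain2 := fun x => y_ (N x) x.
have sum_at M x : y_ M x = \sum_(i < M) z i x.
  by elim: M => [|M IH]; rewrite /y_ ?big_ord0 // !big_ord_recr /= -IH.
have yE x M : inside (P `|` Q) x -> (N x <= M)%N -> y x = y_ M x.
  move=> xPQ; rewrite /y => /subnK <-; elim: (M - N x)%N => // k ->.
  rewrite addSn /y_ big_ord_recr /= -/(y_ _).
  transitivity (y_ (k + N x)%N x + z (k + N x)%N x) => //.
  have [zP zQ] : small (Sdh c) by split; apply: Sdh_inside0; apply csmall.
  by rewrite /z NP ?addr0 // leq_addl.
exists y => [|x xPQ].
  by split=> x xU; rewrite /y sum_at; apply: big1 => i _;
    have [zP zQ] := zsmall i; [exact: zP|exact: zQ].
(* [M] exceeds the bounds of the simplex and of all its faces, so one partial sum computes the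
   coboundary. *)
case: x xPQ => n s sPQ; pose M := (N (existT _ n s) + \sum_(j < n.+1)
  N (asx s (del j (vertices R n))))%N.
have -> : coboundary y (existT _ n s) = coboundary (y_ M) (existT _ n s).
  rewrite !coboundaryE; apply: eq_bigr => j _; congr (_ * _).
  rewrite /pullback; case E : (del j _) => [//|u l]; rewrite -E.
  apply: yE; first exact: inside_asx.
  move: j E; rewrite size_vertices => j E.
  by apply: leq_trans (leq_addl _ _); rewrite (bigD1 j) //= leq_addr.
by rewrite dy // NP ?addr0 // leq_addr.
Qed.

(* The cochain [u], extended by zero, is a primitive of [c] up to a cochain that
   vanishes on the simplices in [P] and on those in [Q]. *)
Lemma excision c u : (forall x, inside (P `|` Q) x -> coboundary c x = 0) ->
  (forall x, inside Q x -> c x = 0) ->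
  (forall x, inside (P `&` Q) x -> u x = 0) ->
  (forall x, inside P x -> c x = coboundary u x) ->
  exists2 v, (forall x, inside Q x -> v x = 0) &
    forall x, inside (P `|` Q) x -> c x = coboundary v x.
Proof.
move=> dc cQ uPQ cu.
pose u1 : cochain2 := fun x => if `[< inside P x >] then u x else 0.
have u1P x : inside P x -> u1 x = u x by rewrite /u1 => /asboolP ->.
have u1Q x : inside Q x -> u1 x = 0.
  by move=> xQ; rewrite /u1; case: asboolP => // xP; apply/uPQ/insideI.
have [||y [yP yQ] cy] := @small_cochain (c - coboundary u1).
- move=> x xPQ; rewrite linearB /= coboundary_coboundary subr0; exact: dc.
- split=> x xU.
    transitivity (c x - coboundary u1 x) => //.
    rewrite (coboundary_eq_inside u1P xU) cu // subrr //.
  transitivity (c x - coboundary u1 x) => //.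
  by rewrite cQ // (coboundary_inside0 u1Q xU) subrr.
exists (u1 + y) => x xU; first by transitivity (u1 x + y x); rewrite // u1Q // yQ // addr0.
rewrite linearD; transitivity (coboundary u1 x + coboundary y x) => //.
rewrite -cy //; transitivity (coboundary u1 x + (c x - coboundary u1 x)) => //.
by rewrite subrKC.
Qed.

End SmallSimplices.

(** * Cones and complements of coordinate subspaces *)

Lemma continuous_for_initial (Y : choiceType) (X Z : topologicalType) (w : Y -> Z)
  (f : X -> initial_topology w) x :
  {for x, continuous (w \o f)} -> {for x, continuous f}.
Proof.
move=> cf U [?/= [[W oW <-]]] /= Wsfz /filterS; apply; apply: cf.
exact: open_nbhs_nbhs.
Qed.

Section Cone.
Variables (R : realType) (m n : nat).
Local Notation E := 'M[R]_(m, n).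
Local Notation Delta := (std_simplex R).

(** Used for continuity of the cone at its apex: the point of the base has no limit there, but it is
    bounded and its weight tends to 0. *)
Lemma simplex_bounded k (s : continuousType (Delta k) E) i j :
  exists B : R, forall u, `|s u i j| <= B.
Proof.
have /compact_near_coveringP cov := @std_simplex_compact R k.
have : \forall B \near +oo, std_simplex R k `<=`
    [set v | forall u : Delta k, set_val u = v -> `|s u i j| <= B].
  apply: cov => t tk; pose t' : Delta k := SigSub (mem_set tk).
  pose U := [set x : E | `|x i j| < `|s t' i j| + 1].
  have oU : open U.
    apply: (@open_comp _ _ (fun x : E => `|x i j|) [set r | r < `|s t' i j| + 1]).
      move=> x _; apply: (@continuous_comp _ _ _ (fun x : E => x i j) Num.norm).
        exact: coord_continuous.
      exact: norm_continuous.
    exact: open_lt.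
  have [|e e0 eU] := preimage_box (s := s) (t := t') oU; first by rewrite /U /= ltrDl.
  exists (ball t e, [set B : R | `|s t' i j| + 1 < B]).
    by split; [exact: nbhsx_ballx|exact: nbhs_pinfty_gt].
  move=> [v B] [/= tv tB] u uv; apply/ltW/(lt_trans _ tB).
  by apply: eU => l; rewrite uv distrC; apply/ltW; exact: tv.2.
move=> near_B; have [B BP] : exists B : R, std_simplex R k `<=`
    [set v | forall u : Delta k, set_val u = v -> `|s u i j| <= B].
  by near (+oo : set_system R) => B; exists B; near: B.
by exists B => u; exact: (BP _ (set_valP u)).
Unshelve. all: by end_near. Qed.

Definition base_row k (t : 'rV[R]_k.+2) : 'rV[R]_k.+1 :=
  \row_i (t ord0 (lift ord0 i) / (1 - t ord0 ord0)).

Lemma base_row_simplex k (t : 'rV[R]_k.+2) : std_simplex R k.+1 t ->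
  t ord0 ord0 != 1 -> std_simplex R k (base_row t).
Proof.
move=> tk t1; have := std_simplex_le1 ord0 tk; case: tk => t0 tsum => /andP[_ tle].
have d0 : 0 < 1 - t ord0 ord0 by rewrite subr_gt0 lt_neqAle t1.
split=> [i|]; first by rewrite mxE divr_ge0 // ltW.
under eq_bigr do rewrite mxE.
have e : \sum_i t ord0 (lift ord0 i) = 1 - t ord0 ord0.
  by rewrite -tsum [in RHS]big_ord_recl addrAC subrr add0r.
by rewrite -mulr_suml e divff // gt_eqF.
Qed.

(** The projection from the vertex 0 onto the opposite face. The default at the apex is harmless:
    [cone] multiplies it by 0. *)
Definition base k (t : Delta k.+1) : Delta k :=
  insubd (vertex R k 0) (base_row (set_val t)).

Lemma base_val k (t : Delta k.+1) : set_val t ord0 ord0 != 1 ->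
  set_val (base t) = base_row (set_val t).
Proof.
move=> t1; rewrite /base -[LHS]/(val _) insubdK //.
by apply: mem_set; apply: base_row_simplex => //; exact: set_valP.
Qed.

Section ConeMap.
Variables (p : E) (k : nat) (s : continuousType (Delta k) E).

Definition cone (t : Delta k.+1) : E :=
  let t0 := set_val t ord0 ord0 in t0 *: p + (1 - t0) *: s (base t).

Lemma simplex_coord_continuous l (i : 'I_l.+1) :
  continuous (fun t : Delta l => set_val t ord0 i).
Proof.
move=> t; apply: (@continuous_comp _ _ _ set_val (fun v : 'rV[R]_l.+1 => v ord0 i)).
  exact: initial_continuous.
exact: coord_continuous.
Qed.

Lemma base_continuous (t : Delta k.+1) : set_val t ord0 ord0 != 1 ->
  {for t, continuous (@base k)}.
Proof.
move=> t1; apply: continuous_for_initial; apply: matrix_continuous => i j.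
have near_ne : nbhs t [set u : Delta k.+1 | set_val u ord0 ord0 != 1].
  have o1 : open [set r : R | r != 1] by exact: open_neq.
  exact: (@simplex_coord_continuous k.+1 ord0 t _ (open_nbhs_nbhs (conj o1 t1))).
pose f (u : Delta k.+1) := set_val u ord0 (lift ord0 j) / (1 - set_val u ord0 ord0).
have ef : nbhs t [set u | f u = set_val (base u) i j].
  by apply: filterS near_ne => u /= u1; rewrite base_val // ord1 mxE.
apply: cvg_trans (near_eq_cvg ef) _.
rewrite (_ : (set_val \o @base k) t i j = f t); last first.
  by rewrite /= base_val // mxE.
apply: cvgM; first exact: simplex_coord_continuous.
apply: cvgV; first by rewrite subr_eq0 eq_sym.
by apply: cvgB; [exact: cvg_cst|exact: simplex_coord_continuous].
Qed.

Lemma cone_continuous : continuous cone.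
Proof.
move=> t; apply: matrix_continuous => i j.
rewrite (_ : (fun _ => _) = fun u : Delta k.+1 => set_val u ord0 ord0 * p i j +
  (1 - set_val u ord0 ord0) * s (base u) i j); last first.
  by apply/funext => u; rewrite /cone !mxE.
have t0c := simplex_coord_continuous (i := ord0 : 'I_k.+2).
have t0c' : continuous (fun u : Delta k.+1 => 1 - set_val u ord0 ord0).
  by move=> u; apply: (@continuousB R R (Delta k.+1) (cst 1)); [exact: cst_continuous|exact: t0c].
apply: continuousD; first by apply: continuousM; [exact: t0c|exact: cst_continuous].
have [t1|t1] := eqVneq (set_val t ord0 ord0) 1.
  have [B BP] := simplex_bounded s i j.
  rewrite /prop_for /continuous_at t1 subrr mul0r.
  suff : (fun u : Delta k.+1 => (1 - set_val u ord0 ord0) * s (base u) i j) x @[x --> t] --> (0 : R) by [].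
  apply/(@cvgrPdist_le _ _ _ _ (nbhs_filter t)) => e e0.
  have B1 : 0 < `|B| + 1 by rewrite ltr_wpDl.
  have : nbhs t [set u : Delta k.+1 | `|0 - (1 - set_val u ord0 ord0)| <= e / (`|B| + 1)].
    have := t0c' t; rewrite /continuous_at t1 subrr => /(@cvgrPdist_le _ _ _ _ (nbhs_filter t)); apply.
    by rewrite divr_gt0.
  apply: filterS => u /=; rewrite !sub0r !normrN normrM => h.
  have : `|s (base u) i j| <= `|B| + 1.
    by apply: le_trans (BP _) _; rewrite (le_trans (ler_norm B)) // lerDl.
  move=> h2; apply: le_trans (ler_pM _ _ h h2) _ => //.
  by rewrite divfK // gt_eqF.
apply: continuousM; first exact: t0c'.
apply: (@continuous_comp _ _ _ (@base k) (fun v => s v i j)).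
  exact: base_continuous.
apply: (@continuous_comp _ _ _ s (fun v : E => v i j)); first exact: cts_fun.
exact: coord_continuous.
Qed.

HB.instance Definition _ := @isContinuous.Build _ _ cone cone_continuous.

End ConeMap.
End Cone.

Section ConeFaces.
Variables (R : realType) (m n : nat).
Local Notation E := 'M[R]_(m, n).
Local Notation Delta := (std_simplex R).
Variable p : E.

Definition point_simplex : singular_simplex R E :=
  existT _ 0 (cst p : continuousType (Delta 0) E).

Definition cone_simplex (x : singular_simplex R E) : singular_simplex R E :=
  existT _ (projT1 x).+1 (cone p (projT2 x) : continuousType _ _).

Lemma vertex_map_coord k l (f : 'I_k.+1 -> 'I_l.+1) (t : Delta k) j :
  set_val (vertex_map f t) ord0 j = \sum_(i | f i == j) set_val t ord0 i.
Proof. by rewrite [LHS]mxE. Qed.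

Lemma cone_face0 k (s : continuousType (Delta k) E) :
  sub_simplex (cone p s : continuousType _ _) (lift ord0) = existT _ k s.
Proof.
apply: eq_simplex => t /=.
have t0 : set_val (vertex_map (lift ord0) t) ord0 ord0 = 0.
  by rewrite vertex_map_coord big1 // => i /eqP.
rewrite /cone t0 scale0r add0r subr0 scale1r; congr (s _); apply: simplex_inj.
rewrite base_val ?t0 ?(eq_sym 0) ?oner_eq0 //; apply/rowP => j.
rewrite mxE t0 subr0 divr1 vertex_map_coord (bigD1 j) //= big1 ?addr0 // => i.
by case/andP => /eqP /lift_inj ->; rewrite eqxx.
Qed.

Lemma cone_faceS k (s : continuousType (Delta k.+1) E) (i : 'I_k.+2) :
  sub_simplex (cone p s : continuousType _ _) (lift (lift ord0 i)) =
  cone_simplex (sub_simplex s (lift i)).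
Proof.
apply: eq_simplex => t /=.
have ll l : lift (lift ord0 i) (lift ord0 l) = lift ord0 (lift i l).
  by apply: val_inj; rewrite /= /bump; lia.
have l0 : lift (lift ord0 i) ord0 = ord0 by apply: val_inj.
have t0 : set_val (vertex_map (lift (lift ord0 i)) t) ord0 ord0 = set_val t ord0 ord0.
  rewrite vertex_map_coord (bigD1 ord0) ?l0 //= big1 ?addr0 // => j.
  case/andP => /eqP; rewrite -[RHS]l0 => /lift_inj ->; by rewrite eqxx.
rewrite /cone t0; have [t1|t1] := eqVneq (set_val t ord0 ord0) 1.
  by rewrite t1 subrr !scale0r.
congr (_ + _ *: s _); apply: simplex_inj; apply/rowP => j.
rewrite base_val ?t0 // mxE t0 !vertex_map_coord base_val //.
rewrite (eq_bigr (fun l => set_val t ord0 (lift ord0 l) / (1 - set_val t ord0 ord0))); last first.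
  by move=> l _; rewrite mxE.
rewrite -mulr_suml big_mkcond big_ord_recl l0 /= add0r; congr (_ / _).
rewrite [RHS]big_mkcond; apply: eq_bigr => l _; rewrite ll.
by rewrite (inj_eq (@lift_inj _ ord0)).
Qed.

Lemma cone_face1 (s : continuousType (Delta 0) E) (i : 'I_1) :
  sub_simplex (cone p s : continuousType _ _) (lift (lift ord0 i)) = point_simplex.
Proof.
apply: eq_simplex => t /=.
have l0 : lift (lift ord0 i) ord0 = ord0 by apply: val_inj.
rewrite /cone vertex_map_coord (bigD1 ord0) ?l0 //= big1 ?addr0; last first.
  by move=> j; rewrite (ord1 j) eqxx andbF.
have [_] := set_valP t; rewrite big_ord1 => ->.
by rewrite subrr scale1r scale0r addr0.
Qed.

Definition star (P : set E) : Prop :=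
  forall x (a : R), P x -> 0 <= a <= 1 -> P (a *: p + (1 - a) *: x).

Lemma inside_cone P x : star P -> inside P x -> inside P (cone_simplex x).
Proof.
case: x => k s Pp sP _ [t _ <-]; apply: Pp; first by apply: sP; exists (base t).
exact: std_simplex_le1 (set_valP t).
Qed.

(** The unit cocycle, equal to 1 on every point. Acyclicity below means being a coboundary up to a
    multiple of it. *)
Definition dim0 (X : topologicalType) : cochain R X 'F_2 :=
  fun x => (projT1 x == 0)%:R.

(** The cocycle condition is written on the cone over [x]: face 0 is [x] and the other faces are
    cones over faces of [x]. Over a point the other face is the apex, whence the term in [dim0]. *)
Lemma star_cocycle P (z : cochain R E 'F_2) : star P ->
  (forall x, inside P x -> coboundary z x = 0) ->
  forall x, inside P x ->
    z x = coboundary (z \o cone_simplex : cochain R E 'F_2) x + z point_simplex * dim0 x.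
Proof.
move=> Pp dz [[|k] s] sP; have := dz _ (inside_cone Pp sP);
  rewrite /= big_ord_recl cone_face0 mul1r => /eqP; rewrite addr_eq0 oppr_F2 => /eqP ->.
  by rewrite big_ord1 cone_face1 signr_F2 mul1r mulr1 add0r.
rewrite mulr0 addr0; apply: eq_bigr => i _.
by rewrite cone_faceS !signr_F2.
Qed.

End ConeFaces.

Lemma coboundary_dim0 (R : realType) (X : topologicalType) :
  coboundary (@dim0 R X) = 0.
Proof.
apply/funext => -[[|[|k]] s] //; last by apply: big1 => i _; rewrite mulr0.
transitivity (\sum_(i < 2) (1 : 'F_2)).
  by apply: eq_bigr => i _; rewrite signr_F2 mul1r.
by rewrite big_ord_recl big_ord1; exact: addrr_F2.
Qed.

Section CochainArithmetic.
Variables (R : realType) (X : topologicalType) (A : comNzRingType).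
Implicit Types (c d : cochain R X A) (x : singular_simplex R X) (a : A).

Lemma cochainDE c d x : (c + d) x = c x + d x. Proof. by []. Qed.
Lemma cochainBE c d x : (c - d) x = c x - d x. Proof. by []. Qed.
Lemma cochainZE a c x : (a *: c) x = a * c x. Proof. by []. Qed.

Lemma coboundaryD c d x :
  coboundary (c + d) x = coboundary c x + coboundary d x.
Proof. by rewrite linearD. Qed.

Lemma coboundaryB c d x :
  coboundary (c - d) x = coboundary c x - coboundary d x.
Proof. by rewrite linearB. Qed.

Lemma coboundaryZ a c x : coboundary (a *: c) x = a * coboundary c x.
Proof. by rewrite linearZ. Qed.

Lemma coboundary_coboundaryE c x : coboundary (coboundary c) x = 0.
Proof. by rewrite coboundary_coboundary. Qed.

End CochainArithmetic.

Section CoordinateComplement.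
Variables (R : realType) (m n : nat).
Local Notation E := 'M[R]_(m, n).
Implicit Types (L : seq ('I_m * 'I_n)) (z : cochain R E 'F_2).

(** The complement of a coordinate subspace, of codimension [size L] when [L] has no repetition. *)
Definition off L : set E :=
  [set x | exists2 ij, ij \in L & x ij.1 ij.2 != 0].

Lemma off_open L : open (off L).
Proof.
rewrite (_ : off L = \bigcup_(ij in [set` L])
    (fun x : E => x ij.1 ij.2) @^-1` [set r | r != 0]); last first.
  by rewrite predeqE => x; split=> -[ij ijL x0]; exists ij.
apply: bigcup_open => ij _; apply: open_comp; last exact: open_neq.
by move=> x _; exact: coord_continuous.
Qed.

Lemma half_open (b : bool) (e : 'I_m * 'I_n) :
  open [set x : E | 0 < (-1) ^+ b * x e.1 e.2].
Proof.
apply: (@open_comp _ _ (fun x : E => (-1) ^+ b * x e.1 e.2) [set r | 0 < r]).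
  move=> x _; apply: (@continuousM R E (cst ((-1) ^+ b)) (fun x => x e.1 e.2)).
    exact: cst_continuous.
  exact: coord_continuous.
exact: open_gt.
Qed.

(** As [e] is not in [L], moving towards a signed unit vector in direction [e] only rescales the
    entries listed in [L], and it keeps the sign of the entry [e]. *)
Lemma star_half (b : bool) e L : e \notin L ->
  star ((-1) ^+ b *: delta_mx e.1 e.2)
    ([set x : E | 0 < (-1) ^+ b * x e.1 e.2] `|` off L).
Proof.
move=> eL x a Px /andP[a0 a1]; have [->|an1] := eqVneq a 1.
  rewrite subrr scale0r addr0 scale1r; left=> /=.
  by rewrite !mxE !eqxx mulr1 -expr2 sqrr_sign.
have a1' : 0 < 1 - a by rewrite subr_gt0 lt_neqAle an1.
case: Px => [xe|[ij ijL xij]].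
  left; rewrite /= !mxE !eqxx mulr1 mulrDr mulrCA -expr2 sqrr_sign mulr1.
  by rewrite ltr_wpDl // mulrCA mulr_gt0.
right; exists ij => //; rewrite !mxE.
have -> : (ij.1 == e.1) && (ij.2 == e.2) = false.
  apply: contraNF eL => /andP[/eqP ei /eqP ej].
  by rewrite (surjective_pairing e) -ei -ej -surjective_pairing.
by rewrite !mulr0 add0r mulf_neq0 // gt_eqF.
Qed.

Lemma off_cons e L : off (e :: L) =
  ([set x : E | 0 < (-1) ^+ false * x e.1 e.2] `|` off L) `|`
  ([set x : E | 0 < (-1) ^+ true * x e.1 e.2] `|` off L).
Proof.
rewrite predeqE => x; rewrite /= expr0 expr1 mul1r mulN1r oppr_gt0; split.
  move=> [ij]; rewrite inE => /orP[/eqP ->|ijL] x0; last by left; right; exists ij.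
  by have [] := ltgtP 0 (x e.1 e.2) => xe; [left; left|right; left|rewrite -xe eqxx in x0].
by move=> [] [xe|[ij ijL x0]]; do ?[by exists ij => //; rewrite inE ijL orbT];
  exists e; rewrite ?mem_head // ?(gt_eqF xe) ?(lt_eqF xe).
Qed.

Lemma off_cap e L :
  ([set x : E | 0 < (-1) ^+ false * x e.1 e.2] `|` off L) `&`
  ([set x : E | 0 < (-1) ^+ true * x e.1 e.2] `|` off L) `<=` off L.
Proof.
move=> x [[xe|//] [xe'|//]]; move: xe xe' => /=.
by rewrite expr0 expr1 mul1r mulN1r oppr_gt0 => /ltW; rewrite leNgt => /negP.
Qed.

Lemma inside_point p (U : set E) : U p -> inside U (point_simplex p).
Proof. by move=> Up _ [t _ <-]. Qed.

Lemma inside_nonempty (X : topologicalType) (U : set X) (x : singular_simplex R X) :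
  inside U x -> exists u, U u.
Proof. by case: x => k s sU; exists (s (vertex R k 0)); apply: sU; exists (vertex R k 0). Qed.

(** The set has the homotopy type of a sphere of dimension [size L - 1], and [z] lives in lower
    degrees. The two star-shaped halves of [off (e :: L)] meet in [off L], where their primitives
    differ by a cocycle of one degree less. *)
Lemma off_acyclic L z : uniq L ->
  (forall x, inside (off L) x -> coboundary z x = 0) ->
  (forall x, ((size L).-1 <= projT1 (x : singular_simplex R E))%N -> z x = 0) ->
  exists u a, forall x, inside (off L) x -> z x = coboundary u x + a * dim0 x.
Proof.
elim: L z => [|e L IH] z.
  by move=> _ _ _; exists 0, 0 => x /inside_nonempty[u []].
move=> /andP[eL uL] dz zlow.
(* For one coordinate the set is disconnected, but the degree bound then forces [z] to be 0. *)
case: (posnP (size L)) => [/size0nil L0|L_gt0].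
  exists 0, 0 => x _; rewrite linear0 mul0r addr0.
  by apply: zlow; rewrite L0.
pose H (b : bool) := [set x : E | 0 < (-1) ^+ b * x e.1 e.2] `|` off L.
pose p (b : bool) : E := (-1) ^+ b *: delta_mx e.1 e.2.
pose a b := z (point_simplex (p b)).
pose zc b : cochain R E 'F_2 := z \o cone_simplex (p b).
have offE : off (e :: L) = H false `|` H true by exact: off_cons.
have zE b x : inside (H b) x -> z x = coboundary (zc b) x + a b * dim0 x.
  have dzH y : inside (H b) y -> coboundary z y = 0.
    by move=> yH; apply: dz; apply: insideS yH; rewrite offE => u;
      case: b {x} => Hu; [right|left].
  exact: (star_cocycle (@star_half b e L eL) dzH).
have dw x : inside (off L) x ->
    coboundary (zc false - zc true) x = (a true - a false) * dim0 x.
  move=> xL; have xH b : inside (H b) x by apply: insideS xL => u; right.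
  have := zE false x (xH false); rewrite (zE true x (xH true)) => e1.
  rewrite coboundaryB; apply/eqP; rewrite subr_eq mulrBl addrAC eq_sym subr_eq eq_sym.
  by rewrite -e1 addrC.
(* The two constants agree because the overlap contains a point, [L] being nonempty. *)
have aE : a true = a false.
  have [ij ijL] : exists ij, ij \in L by case: (L) L_gt0 => // ij l; exists ij; exact: mem_head.
  pose q : E := delta_mx ij.1 ij.2.
  have : inside (off L) (point_simplex q).
    by apply: inside_point; exists ij => //; rewrite mxE !eqxx oner_eq0.
  by move/dw; rewrite mulr1 => /esym /eqP; rewrite subr_eq0 => /eqP.
have {}dw x : inside (off L) x -> coboundary (zc false - zc true) x = 0.
  by move/dw => ->; rewrite aE subrr mul0r.
have [|r [b rb]] := IH _ uL dw.
  move=> x xlow; rewrite cochainBE /zc /= !zlow ?subrr //=; lia.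
(* [c] is zero on the half [H true]. On [H false] its primitive is the difference of the two cone
   primitives, corrected so as to vanish on the overlap; excision extends it to the union. *)
pose u := zc false - zc true - coboundary r - b *: @dim0 R E.
pose c := z - coboundary (zc true) - a false *: @dim0 R E.
have oH side : open (H side) by apply: openU; [exact: half_open|exact: off_open].
have [|||| v _ cv] := @excision R E (H false) (H true) (oH _) (oH _) c u.
- move=> x xH; rewrite /c !coboundaryB coboundaryZ coboundary_dim0 mulr0 subr0.
  by rewrite coboundary_coboundaryE subr0; apply: dz; rewrite offE.
- by move=> x xH; rewrite /c !cochainBE cochainZE (zE true) // aE [X in X - _]addrAC subrr add0r subrr.
- move=> x xH; rewrite /u !cochainBE cochainZE -cochainBE rb; last first.
    by apply: insideS xH; exact: off_cap.
  by rewrite [X in X - _]addrAC subrr add0r subrr.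
- move=> x xH; rewrite /c /u !coboundaryB coboundaryZ coboundary_dim0 coboundary_coboundaryE.
  rewrite mulr0 !subr0 !cochainBE cochainZE (zE false) //.
  by rewrite [X in X - _ = _]addrAC -[LHS]addrA subrr addr0.
exists (v + zc true), (a false) => x; rewrite offE => xH.
rewrite coboundaryD -cv // /c !cochainBE cochainZE.
by rewrite [RHS]addrAC !subrK.
Qed.

(** Coning at the origin gives a primitive on the whole space. On [off L] it is a cocycle of one
    degree less, hence up to a constant a coboundary, which is subtracted. *)
Lemma coordinate_complement L z : uniq L ->
  (forall x, coboundary z x = 0) ->
  (forall x, inside (off L) x -> z x = 0) ->
  (forall x, (size L <= projT1 (x : singular_simplex R E))%N -> z x = 0) ->
  exists2 u, (forall x, inside (off L) x -> u x = 0) & forall x, z x = coboundary u x.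
Proof.
move=> uL dz zL zlow.
case: (posnP (size L)) => [/size0nil L0|L_gt0].
  exists 0 => // x; rewrite linear0; by apply: zlow; rewrite L0.
pose u0 : cochain R E 'F_2 := z \o cone_simplex (0 : E).
have zE x : z x = coboundary u0 x + z (point_simplex 0) * dim0 x.
  by apply: (@star_cocycle R m n 0 setT) => // y _; exact: dz.
have a0 : z (point_simplex 0) = 0.
  have [ij ijL] : exists ij, ij \in L by case: (L) L_gt0 => // ij l; exists ij; exact: mem_head.
  pose q : E := delta_mx ij.1 ij.2.
  have := zE (point_simplex q); rewrite mulr1 add0r => <-; apply: zL.
  by apply: inside_point; exists ij => //; rewrite mxE !eqxx oner_eq0.
have {}zE x : z x = coboundary u0 x by rewrite zE a0 mul0r addr0.
have [||v [b vb]] := @off_acyclic L u0 uL.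
- by move=> x xL; rewrite -zE zL.
- move=> x xlow; rewrite /u0 /= zlow //=; lia.
exists (u0 - coboundary v - b *: @dim0 R E) => x.
  by move=> xL; rewrite !cochainBE cochainZE vb // [X in X - _]addrAC subrr add0r subrr.
by rewrite !coboundaryB coboundaryZ coboundary_dim0 coboundary_coboundaryE mulr0 !subr0.
Qed.

End CoordinateComplement.

Lemma coboundary_face (R : realType) (X Y : topologicalType) (A : comNzRingType)
    (c : cochain R X A) (d : cochain R Y A) k (s : continuousType (std_simplex R k) X)
    (t : continuousType (std_simplex R k) Y) :
  (forall l (f : 'I_l.+1 -> 'I_k.+1), c (sub_simplex s f) = d (sub_simplex t f)) ->
  coboundary c (existT _ k s) = coboundary d (existT _ k t).
Proof. by case: k s t => // k s t cd; apply: eq_bigr => i _; rewrite cd. Qed.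

(** * Transport through a chart and attachment of one cell *)

Section Charts.
Variables (R : realType) (m n : nat) (X : topologicalType).
Local Notation E := 'M[R]_(m, n).
Local Notation Delta := (std_simplex R).

Variables (f : continuousType E X) (g : X -> E).

Definition push (x : singular_simplex R E) : singular_simplex R X :=
  existT _ (projT1 x) (f \o projT2 x : continuousType _ _).

Lemma coboundary_push (A : comNzRingType) (c : cochain R X A) x :
  coboundary (c \o push : cochain R E A) x = coboundary c (push x).
Proof.
case: x => k s; apply: coboundary_face => l h /=; congr (c _).
exact: eq_simplex.
Qed.

(** [g] is continuous on [T] only, so a simplex whose composite with [g] is not continuous gets a
    default value. *)
Definition pull (x : singular_simplex R X) : singular_simplex R E :=
  if pselect (continuous (g \o projT2 x)) is left gc
  then existT _ (projT1 x) (mkcts gc : continuousType _ _)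
  else point_simplex 0.

Variable T : set X.
Hypothesis gT : forall x, T x -> {for x, continuous g}.
Hypothesis fgK : forall x, T x -> f (g x) = x.

Lemma pull_inside k (s : continuousType (Delta k) X) (h : continuousType (Delta k) E) :
  inside T (existT _ k s) -> (forall t, h t = g (s t)) ->
  pull (existT _ k s) = existT _ k h.
Proof.
move=> sT hE; rewrite /pull; case: pselect => [gc|[]]; first exact: eq_simplex.
move=> t; apply: continuous_comp; first exact: cts_fun.
by apply: gT; apply: sT; exists t.
Qed.

Lemma pullE k (s : continuousType (Delta k) X) : inside T (existT _ k s) ->
  exists2 h : continuousType (Delta k) E, (forall t, h t = g (s t)) &
    pull (existT _ k s) = existT _ k h.
Proof.
move=> sT; have gc : continuous (g \o s).
  move=> t; apply: continuous_comp; first exact: cts_fun.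
  by apply: gT; apply: sT; exists t.
exists (mkcts gc : continuousType _ _) => //; exact: pull_inside.
Qed.

Lemma coboundary_pull (A : comNzRingType) (c : cochain R E A) x : inside T x ->
  coboundary (c \o pull : cochain R X A) x = coboundary c (pull x).
Proof.
case: x => k s sT; have [h hE ->] := pullE sT.
apply: coboundary_face => l v /=; congr (c _).
by apply: pull_inside => [|t]; [exact: inside_sub_simplex|exact: hE].
Qed.

Lemma push_pull x : inside T x -> push (pull x) = x.
Proof.
case: x => k s sT; have [h hE ->] := pullE sT.
by apply: eq_simplex => t /=; rewrite hE fgK //; apply: sT; exists t.
Qed.

(** Only [f (g x) = x] is available, because the chart ignores some of the matrix entries. A
    retraction suffices: [z] is pushed to matrices, and the primitive found there is composed with
    [pull]. *)
Lemma chart_acyclic (C : set X) L (z : cochain R X 'F_2) : uniq L ->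
  (forall e, T (f e)) -> (forall e, off L e -> ~ C (f e)) ->
  (forall x, T x -> ~ C x -> off L (g x)) ->
  (forall x, inside T x -> coboundary z x = 0) ->
  (forall x, inside (T `\` C) x -> z x = 0) ->
  (forall x : singular_simplex R X, (size L <= projT1 x)%N -> z x = 0) ->
  exists2 u : cochain R X 'F_2, (forall x, inside (T `\` C) x -> u x = 0) &
    forall x, inside T x -> z x = coboundary u x.
Proof.
move=> uL fT fC gC dz z0 zlow.
have [|||u u0 zu] := @coordinate_complement R m n L (z \o push) uL.
- move=> x; rewrite coboundary_push; apply: dz => _ [t _ <-]; exact: fT.
- move=> x xL; apply: z0 => _ [t _ <-]; split; first exact: fT.
  by apply: fC; apply: xL; exists t.
- by move=> x xlow; apply: zlow.
exists (u \o pull) => x xT.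
  case: x xT => k s sTC; have sT : inside T (existT _ k s).
    by apply: insideS sTC => ? [].
  have [h hE /= ->] := pullE sT; apply: u0 => _ [t _ <-] /=.
  by rewrite hE; have [] := sTC (s t) (ex_intro2 _ _ t I erefl); exact: gC.
by rewrite coboundary_pull // -zu /= push_pull.
Qed.

(** [T] and [V] without [C] form an open cover of [V], so excision reduces the pair to the chart. *)
Lemma attach_acyclic (V C : set X) L (z : cochain R X 'F_2) : uniq L ->
  (forall e, T (f e)) -> (forall e, off L e -> ~ C (f e)) ->
  (forall x, T x -> ~ C x -> off L (g x)) ->
  open T -> open (V `\` C) -> T `<=` V -> V `&` C `<=` T ->
  (forall x, inside V x -> coboundary z x = 0) ->
  (forall x, inside (V `\` C) x -> z x = 0) ->
  (forall x : singular_simplex R X, (size L <= projT1 x)%N -> z x = 0) ->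
  exists2 u : cochain R X 'F_2, (forall x, inside (V `\` C) x -> u x = 0) &
    forall x, inside V x -> z x = coboundary u x.
Proof.
move=> uL fT fC gC oT oVC TV VCT dz z0 zlow.
have [| |u u0 zu] := chart_acyclic uL fT fC gC _ _ zlow.
- by move=> x xT; apply: dz; exact: insideS xT.
- by move=> x xT; apply: z0; apply: insideS xT => y [/TV].
have VE : V = T `|` (V `\` C).
  rewrite predeqE => x; split=> [Vx|[/TV//|[]//]].
  by case: (pselect (C x)) => Cx; [left; exact: VCT|right].
rewrite {2}VE; apply: (@excision _ _ _ _ oT oVC z u) => //.
- by move=> x; rewrite -VE; exact: dz.
- by move=> x xT; apply: u0; apply: insideS xT => y [Ty [_]].
Qed.

End Charts.

(** * Ranks and inversions *)

Lemma split_last (T : Type) (p : pred T) (s : seq T) : has p s ->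
  exists x e y, [/\ s = x ++ e :: y, p e & ~~ has p y].
Proof.
elim: s => //= z s IH; case: (boolP (has p s)) => [/IH[x [e [y [-> pe py]]]] _|ps].
  by exists (z :: x), e, y.
by rewrite orbF => pz; exists [::], z, s.
Qed.

Section Inversions.
Implicit Types (s t x y : seq nat) (a b e i k : nat).

Fixpoint inversions s : nat :=
  if s is x :: s' then (count (fun z => z < x) s' + inversions s')%N else 0%N.

Lemma inversions_cat s t :
  inversions (s ++ t) = (inversions s + inversions t + \sum_(z <- s) count (fun v => v < z) t)%N.
Proof.
elim: s => [|z s IH] /=; first by rewrite big_nil addn0.
by rewrite count_cat IH big_cons /=; lia.
Qed.

Lemma inversions_rcons s a :
  inversions (rcons s a) = (inversions s + count (fun z => a < z) s)%N.
Proof.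
rewrite -cats1 inversions_cat /= !addn0; congr addn.
by elim: s => [|z s IH]; rewrite ?big_nil // big_cons IH /= addn0.
Qed.

Lemma inversions_swap x y b e : (b < e)%N ->
  (inversions (x ++ b :: rcons y e) < inversions (x ++ e :: rcons y b))%N.
Proof.
move=> be; rewrite !inversions_cat.
have -> : (\sum_(z <- x) count (fun v => v < z) (b :: rcons y e) =
    \sum_(z <- x) count (fun v => v < z) (e :: rcons y b))%N.
  by apply: eq_bigr => z _; rewrite /= -!cats1 !count_cat /=; lia.
rewrite /= !inversions_rcons -!cats1 !count_cat /=.
have : (count (fun z => z < b) y <= count (fun z => z < e) y)%N.
  by apply: sub_count => z /=; lia.
have : (count (fun z => e < z) y <= count (fun z => b < z) y)%N.
  by apply: sub_count => z /=; lia.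
lia.
Qed.

(* Swapping the last letter [b] of [t] with the last earlier letter in
   [(b, a]], where [a] is the last letter of [s], removes inversions from [t]
   and keeps its ranks below those of [s]. *)
Lemma inversions_rank s t : perm_eq s t ->
  (forall i k, count (fun z => z <= i) (take k t) <= count (fun z => z <= i) (take k s))%N ->
  (inversions s <= inversions t)%N /\ (inversions s = inversions t -> s = t).
Proof.
have [n] := ubnP (size s + inversions t)%N; elim: n s t => // n IH s t /ltnSE le_n st rk.
have sz := perm_size st.
case: (lastP s) st rk sz le_n => [|s' a] st rk.
  by move=> /esym /size0nil ->.
case: (lastP t) st rk => [|t' b] st rk; first by rewrite size_rcons.
rewrite !size_rcons => -[sz] le_n.
have cnt i : count (fun z => z <= i)%N (rcons s' a) = count (fun z => z <= i)%N (rcons t' b).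
  exact/seq.permP.
have drop_rk i k : (count (fun z => z <= i) (drop k (rcons s' a)) <=
    count (fun z => z <= i) (drop k (rcons t' b)))%N.
  have := cnt i; rewrite -{1}(cat_take_drop k (rcons s' a)) -{1}(cat_take_drop k (rcons t' b)).
  by rewrite !count_cat; have := rk i k; lia.
have ba : (b <= a)%N.
  have := drop_rk a (size s').
  rewrite -!cats1 (drop_size_cat [:: a] (erefl (size s'))).
  by rewrite (drop_size_cat [:: b] (esym sz)) /= leqnn; case: (b <= a)%N.
have [ab|nab] := eqVneq a b.
  subst b; have st' : perm_eq s' t' by rewrite -(perm_cat2r [:: a]) !cats1.
  have [|||le_st eq_st] := IH s' t'.
  - by move: le_n; rewrite inversions_rcons; lia.
  - done.
  - move=> i k; have [ks|ks] := leqP k (size s').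
      by have := rk i k; rewrite -!cats1 !takel_cat // -sz.
    have ks' : (size t' <= k)%N by rewrite -sz ltnW.
    by rewrite (take_oversize (ltnW ks)) (take_oversize ks') (seq.permP st').
  rewrite !inversions_rcons; have -> : count (fun z => a < z)%N s' = count (fun z => a < z)%N t'.
    exact/seq.permP.
  by split; [rewrite leq_add2r|move/addIn => /eq_st ->].
have {}ba : (b < a)%N by rewrite ltn_neqAle eq_sym nab.
have at' : has (fun z => b < z <= a)%N t'.
  apply/hasP; exists a; last by rewrite ba leqnn.
  have : a \in rcons t' b by rewrite -(perm_mem st) mem_rcons mem_head.
  by rewrite mem_rcons inE (negPf nab).
have [x [e [y [te /andP[be ea] /hasPn ny]]]] := split_last at'.
have tE : rcons t' b = x ++ e :: rcons y b by rewrite te rcons_cat.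
rewrite tE in st rk le_n cnt drop_rk *.
have lt_inv := @inversions_swap x y b e be.
set t1 := x ++ b :: rcons y e in lt_inv.
have st1 : perm_eq (rcons s' a) t1.
  apply: perm_trans st _; rewrite perm_cat2l.
  by apply/seq.permP => p; rewrite /= -!cats1 !count_cat /=; lia.
have sz1 : size s' = (size x + size y).+1 by rewrite sz te size_cat /= addnS.
have rk1 i k : (count (fun z => z <= i) (take k t1) <=
    count (fun z => z <= i) (take k (rcons s' a)))%N.
  have [kx|xk] := leqP k (size x).
    by have := rk i k; rewrite !takel_cat.
  have [ks|sk] := leqP k (size s'); last first.
    rewrite !take_oversize; first by move/seq.permP : st1 => ->.
      by rewrite size_rcons.
    by rewrite size_cat /= size_rcons; lia.
  have [j kj] : exists j, k = (size x + j.+1)%N by exists (k - size x).-1; lia.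
  have jy : (j <= size y)%N by lia.
  have tk c c' : take k (x ++ c :: rcons y c') = x ++ c :: take j y.
    by rewrite kj take_cat ltnNge leq_addr /= addKn /= -cats1 takel_cat.
  have := rk i k; rewrite !tk !count_cat /=.
  case: (leqP b i) => bi; last by case: (leqP e i) => //; lia.
  case: (leqP e i) => ei; first by [].
  move=> _.
  (* Here b <= i < e, and the swap raises the prefix count by one. After position [k] the letters of
     [t] that are at most [a] are already at most [i], while [s] still has its last letter [a] above
     [i]. So the prefix of [s] has a letter to spare. *)
  have dk : drop k (x ++ e :: rcons y b) = rcons (drop j y) b.
    by rewrite kj drop_cat ltnNge leq_addr /= addKn /= -cats1 drop_cat;
      case: ltngtP jy => // [_ _|-> _]; rewrite ?cats1 // subnn drop_size.
  have h1 := drop_rk a k; rewrite dk in h1.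
  have h2 : ((count (fun z => z <= i) (drop k (rcons s' a))).+1 <=
      count (fun z => z <= a) (drop k (rcons s' a)))%N.
    rewrite -cats1 (_ : drop k (s' ++ [:: a]) = drop k s' ++ [:: a]); last first.
      by rewrite drop_cat; case: ltngtP ks => // -> _; rewrite subnn drop_size.
    rewrite !count_cat /= leqnn.
    have : (count (fun z => z <= i) (drop k s') <= count (fun z => z <= a) (drop k s'))%N.
      by apply: sub_count => z /=; lia.
    have -> : (a <= i)%N = false by lia.
    lia.
  have h3 : count (fun z => z <= a)%N (rcons (drop j y) b) =
      count (fun z => z <= i)%N (rcons (drop j y) b).
    apply: eq_in_count => z; rewrite mem_rcons inE => /orP[/eqP ->|/mem_drop /ny]; lia.
  have := cnt i; rewrite -{1}(cat_take_drop k (rcons s' a)).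
  rewrite -{1}(cat_take_drop k (x ++ e :: rcons y b)) dk tk !count_cat /= leqNgt ei /=.
  lia.
have [|le1 eq1] := IH (rcons s' a) t1 _ st1 rk1.
  by move: le_n; rewrite size_rcons; lia.
by split; lia.
Qed.

End Inversions.

Lemma inversionsE (s : seq nat) : inversions s =
  (\sum_(p < size s) \sum_(q < size s) ((p < q) && (nth 0 s q < nth 0 s p)))%N.
Proof.
elim: s => [|x s IH]; first by rewrite big_ord0.
rewrite /= big_ord_recl big_ord_recl /= add0n; congr addn.
  by rewrite -sum1_count (big_nth 0) big_mkord big_mkcond; apply: eq_bigr => q _ /=; case: ifP.
by rewrite IH; apply: eq_bigr => p _; rewrite big_ord_recl.
Qed.

Lemma mem_cset (T : Type) (b : pred T) x : (x \in [set y | b y]%classic) = b x.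
Proof. by apply/idP/idP; rewrite in_setE. Qed.

Lemma card_cset (T : finType) (b : pred T) :
  #|[set x | b x]%classic| = (\sum_(x | b x) 1)%N.
Proof. by rewrite -sum1_card; apply: eq_bigl => x; exact: mem_cset. Qed.

(** * Ordered set partitions as words *)

Section Words.
Variables (m N : nat) (d : 'I_m -> nat).
Implicit Types (I J : osp N d) (i : 'I_m) (k : nat).

Definition word I : seq nat := [seq nat_of_ord (I l) | l <- enum 'I_N].

Lemma size_word I : size (word I) = N.
Proof. by rewrite size_map size_enum_ord. Qed.

Lemma nth_word I (l : 'I_N) : nth 0 (word I) l = I l.
Proof. by rewrite (nth_map l) ?size_enum_ord // nth_ord_enum. Qed.

Lemma word_inj I J : word I = word J -> I = J.
Proof.
move=> e; apply: val_inj; apply/ffunP => l; apply: val_inj.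
by rewrite /= -!nth_word e.
Qed.

Lemma card_letter I i : #|[set k | I k == i]| = d i.
Proof. by have /forallP/(_ i)/eqP := ospP I. Qed.

Lemma perm_word I J : perm_eq (word I) (word J).
Proof.
suff cnt K (a : nat) : count_mem a (word K) = (\sum_(i < m | i == a :> nat) d i)%N.
  by apply/allP => a _ /=; rewrite !cnt.
rewrite count_map -sum1_count big_enum_cond /=.
under [RHS]eq_bigr do rewrite -(card_letter K) card_cset.
rewrite (exchange_big_dep (fun l : 'I_N => K l == a :> nat)) /=.
  apply: eq_bigr => l /eqP Kl; rewrite (big_pred1 (K l)) // => i.
  rewrite /= -Kl; apply/andP/eqP => [[/eqP h _]|->]; first exact: val_inj.
  by rewrite !eqxx.
by move=> i l /eqP <- /eqP ->.
Qed.

Lemma inversions_word I : inversions (word I) = cell_dim I.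
Proof.
rewrite inversionsE size_word pair_bigA /cell_dim card_cset [RHS]big_mkcond.
by apply: eq_bigr => -[p q] _ /=; rewrite !nth_word; case: ifP.
Qed.

Definition rank I i k : nat := #|[set l : 'I_N | (I l <= i)%N && (l < k)%N]|.

Lemma count_word I (a k : nat) :
  count (fun z => z <= a)%N (take k (word I)) = #|[set l : 'I_N | (I l <= a)%N && (l < k)%N]|.
Proof.
rewrite card_cset -sum1_count.
have [kN|Nk] := leqP k N; last first.
  rewrite take_oversize ?size_word 1?ltnW // big_map big_enum_cond /=.
  by apply: eq_bigl => l; rewrite (ltn_trans (ltn_ord l) Nk) andbT.
rewrite (big_nth 0) big_mkord size_takel ?size_word //.
rewrite (big_ord_widen_cond _ (fun l => nth 0 (take k (word I)) l <= a)%N (fun=> 1%N) kN).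
by apply: eq_bigl => l; case: (ltnP l k) => lk; rewrite ?andbF // nth_take // nth_word.
Qed.

(** Rank inequalities are the Bruhat order on words, and the number of inversions is strictly
    monotone for it. *)
Lemma cell_dim_rank I J : (forall i k, (rank J i k <= rank I i k)%N) ->
  (cell_dim I <= cell_dim J)%N /\ (cell_dim I = cell_dim J -> I = J).
Proof.
move=> rk; rewrite -!inversions_word.
have [|le eq] := inversions_rank (perm_word I J).
  move=> a k; rewrite !count_word; have [am|ma] := ltnP a m.
    exact: (rk (Ordinal am) k).
  apply: subset_leq_card; apply/fintype.subsetP => l; rewrite !mem_cset => /andP[_ ->].
  by rewrite andbT (leq_trans _ ma) // ltnW.
by split=> // /eq /word_inj.
Qed.

(* The coordinates transverse to the cell in its chart: row [p.1] and column [p.2]. *)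
Definition transverse I : seq ('I_N * 'I_N) :=
  enum [pred p : 'I_N * 'I_N | (p.1 < p.2)%N && (I p.1 < I p.2)%N].

Lemma mem_transverse I p : (p \in transverse I) = (p.1 < p.2)%N && (I p.1 < I p.2)%N.
Proof. by rewrite mem_enum. Qed.

Lemma flag_dimE I : flag_dim d = (\sum_p \sum_(q | I p < I q) 1)%N.
Proof.
rewrite [RHS](partition_big (fun p => I p) predT) //=; apply: eq_bigr => i _.
transitivity (\sum_(p | I p == i) \sum_(j < m | i < j) d j)%N.
  rewrite sum_nat_const -big_distrr; congr muln.
  by rewrite -(card_letter I i); apply: eq_card => p; rewrite mem_cset.
apply: eq_bigr => p /eqP <-.
rewrite [RHS](partition_big (fun q => I q) (fun j => I p < j)%N) //=.
apply: eq_bigr => j pj; rewrite -(card_letter I) card_cset.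
by apply: eq_bigl => q; apply/idP/andP => [/eqP ->|[]].
Qed.

(** Two positions with different letters form either an inversion, a direction along the cell, or a
    transverse direction. In particular the subtraction in [cell_codim] is never truncated. *)
Lemma cell_dim_codim I : (cell_dim I + size (transverse I))%N = flag_dim d.
Proof.
rewrite -cardE -sum1_card /= (flag_dimE I) /cell_dim card_cset.
rewrite -(pair_big_dep predT (fun p q : 'I_N => (p < q)%N && (I q < I p)%N) (fun _ _ => 1%N)) /=.
rewrite -(pair_big_dep predT (fun p q : 'I_N => (p < q)%N && (I p < I q)%N) (fun _ _ => 1%N)) /=.
under [X in (X + _)%N]eq_bigr do rewrite big_mkcond.
rewrite exchange_big /= -big_split; apply: eq_bigr => p _ /=.
rewrite -big_mkcond [RHS](bigID (fun q : 'I_N => q < p)%N) /=; congr addn.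
  by apply: eq_bigl => q; rewrite andbC.
apply: eq_bigl => q; rewrite -leqNgt andbC.
by case: (ltngtP p q) => [_|_|/val_inj ->]; rewrite ?andbT ?andbF ?ltnn.
Qed.

Lemma size_transverse I : size (transverse I) = cell_codim I.
Proof. by rewrite /cell_codim -(cell_dim_codim I) addKn. Qed.

Lemma cell_codim_dim I J :
  cell_codim J = (cell_codim I).+1 -> (cell_dim J).+1 = cell_dim I.
Proof.
have := cell_dim_codim I; have := cell_dim_codim J; rewrite !size_transverse; lia.
Qed.

Lemma cell_dim_codimS I J :
  (cell_dim J).+1 = cell_dim I -> cell_codim J = (cell_codim I).+1.
Proof.
have := cell_dim_codim I; have := cell_dim_codim J; rewrite !size_transverse; lia.
Qed.

Lemma cell_codim_rank I J : (forall i k, (rank J i k <= rank I i k)%N) ->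
  (cell_codim J <= cell_codim I)%N /\ (cell_codim I = cell_codim J -> I = J).
Proof.
move=> /cell_dim_rank[le eq].
have := cell_dim_codim I; have := cell_dim_codim J; rewrite !size_transverse.
by split; [lia|move=> ?; apply: eq; lia].
Qed.

End Words.

(** * Charts of the flag manifold *)

Lemma span_ind (K : fieldType) (V : vectType K) (P : V -> Prop) (X : seq V) :
  P 0 -> (forall a u w, P u -> P w -> P (a *: u + w)) ->
  (forall x, x \in X -> P x) -> forall v, v \in <<X>>%VS -> P v.
Proof.
move=> P0 Plin PX v /(@coord_span _ _ _ (in_tuple X)) ->.
elim/big_rec: _ => // i w _ Pw; apply: Plin => //.
exact/PX/mem_nth.
Qed.

Section CoordinateSpan.
Variables (R : realType) (N : nat).
Local Notation V := 'rV[R]_N.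
Local Notation e_ l := (delta_mx ord0 l : V).
Implicit Types (S : pred 'I_N) (v : V).

Definition cspan S : {vspace V} := <<[seq e_ l | l <- enum S]>>%VS.

Lemma delta_mem S l : S l -> e_ l \in cspan S.
Proof. by move=> Sl; apply: memv_span; apply: map_f; rewrite mem_enum. Qed.

Lemma mem_cspan S v : v \in cspan S <-> forall l, ~~ S l -> v ord0 l = 0.
Proof.
split=> [|v0].
  move: v; apply: span_ind => [l _|a u w u0 w0 l Sl|x]; rewrite ?mxE //.
    by rewrite u0 // w0 // mulr0 addr0.
  case/mapP => k; rewrite mem_enum => Sk -> l Sl; rewrite mxE eqxx /=.
  by case: eqVneq Sl => // ->; rewrite [S k]Sk.
rewrite [v]row_sum_delta; apply: memv_suml => l _.
case: (boolP (S l)) => Sl; first by apply: memvZ; exact: delta_mem.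
by rewrite v0 // scale0r mem0v.
Qed.

Lemma cspanS S S' : (forall l, S l -> S' l) -> (cspan S <= cspan S')%VS.
Proof.
move=> SS'; apply/span_subvP => _ /mapP[l lS ->]; apply/delta_mem/SS'.
by rewrite mem_enum in lS.
Qed.

Lemma dim_rV : \dim {:V} = N.
Proof. by rewrite dimvf /dim /= mul1n. Qed.

Lemma cspan_full S (U : {vspace V}) : (cspan S <= U)%VS ->
  (forall l, ~~ S l -> e_ l \in U) -> U = fullv.
Proof.
move=> SU nSU; apply/vspaceP => v; rewrite memvf [v]row_sum_delta.
apply: memv_suml => l _; apply: memvZ.
case: (boolP (S l)) => Sl; last exact: nSU.
by apply: (subvP SU); exact: delta_mem.
Qed.

Lemma dim_cspan S : \dim (cspan S) = #|S|.
Proof.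
have le S' : (\dim (cspan S') <= #|S'|)%N.
  by apply: leq_trans (dim_span _) _; rewrite size_map -cardE.
have full : (cspan S + cspan (predC S))%VS = fullv.
  apply: (@cspan_full S); first exact: addvSl.
  by move=> l Sl; apply: (subvP (addvSr _ _)); exact: delta_mem.
have cC : (#|S| + #|predC S|)%N = N by rewrite cardC card_ord.
have := dimv_sum_cap (cspan S) (cspan (predC S)); rewrite full dim_rV.
by move: (le S) (le (predC S)) cC; set c := #|predC S|; lia.
Qed.

Lemma coord_subspaceE k : coord_subspace R N k = cspan (fun l => (l < k)%N).
Proof.
rewrite /coord_subspace /cspan; congr (<<_>>%VS); congr map.
by rewrite enumT.
Qed.

End CoordinateSpan.

Section FlagCharts.
Variables (R : realType) (m N : nat) (d : 'I_m -> nat).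
Local Notation V := 'rV[R]_N.
Local Notation e_ l := (delta_mx ord0 l : V).
Local Notation flag := (flag R N d).
Local Notation osp := (osp N d).
Implicit Types (I J : osp) (i : 'I_m) (F : flag) (M : 'M[R]_N).

Definition low I i : pred 'I_N := fun l => (I l <= i)%N.
Definition high I i : {vspace V} := cspan R (fun l => i < I l)%N.

Lemma card_low I i : #|low I i| = partial_dim d i.
Proof.
rewrite -sum1_card (partition_big (fun l => I l) (fun j => j <= i)%N) //=.
apply: eq_bigr => j ji; rewrite -(card_letter I j) card_cset.
by apply: eq_bigl => l; apply/andP/idP => [[]//|/eqP lj]; rewrite unfold_in /= lj.
Qed.

Lemma dim_flag F i : \dim (F i) = partial_dim d i.
Proof. by case/andP: (flagP F) => /forallP/(_ i)/eqP. Qed.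

Lemma flag_le F i i' : (i <= i')%N -> (F i <= F i')%VS.
Proof. by case/andP: (flagP F) => _ /forallP/(_ i)/forallP/(_ i')/implyP. Qed.

Lemma dim_high I i : (partial_dim d i + \dim (high I i))%N = N.
Proof.
rewrite dim_cspan -(card_low I) -[RHS]card_ord -(cardC (low I i)); congr addn.
by apply: eq_card => l; rewrite /in_mem /= /low ltnNge.
Qed.

Lemma flag_eq F F' : (forall i, (F i <= F' i)%VS) -> F = F'.
Proof.
move=> FF'; apply: val_inj; apply/ffunP => i.
by apply/eqP; rewrite eqEdim; apply/andP; split; [exact: FF'|rewrite (dim_flag F) (dim_flag F')].
Qed.

(** The translate of the open cell centered at the coordinate flag of [I]: the flags complementary
    to all the coordinate subspaces [high I i]. *)
Definition chart_domain I : set flag :=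
  [set F | forall i, (F i :&: high I i)%VS = 0%VS].

Lemma chart_domain_full I F i : chart_domain I F -> (F i + high I i)%VS = fullv.
Proof.
move=> FI; apply/eqP; rewrite eqEdim subvf dimvf /= /dim /= mul1n.
by rewrite (dimv_disjoint_sum (FI i)) dim_flag dim_high leqnn.
Qed.

(** Inside E_k, the subspace [F i] avoids the span of the coordinate vectors with letter above [i],
    so its dimension is at most the number of the others. *)
Lemma chart_domain_rank I F i k : chart_domain I F ->
  (\dim (F i :&: coord_subspace R N k) <= rank I i k)%N.
Proof.
move=> FI; rewrite coord_subspaceE.
pose S l := (i < I l)%N && (l < k)%N.
have cap0 : (F i :&: cspan R (fun l => l < k)%N :&: cspan R S)%VS = 0%VS.
  apply/eqP; rewrite -subv0 -(FI i); apply: capvS; first exact: capvSl.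
  by apply: cspanS => l /andP[].
have : (F i :&: cspan R (fun l => l < k)%N + cspan R S <= cspan R (fun l => l < k)%N)%VS.
  by rewrite subv_add capvSr; apply: cspanS => l /andP[].
move/dimvS; rewrite dimv_disjoint_sum // !dim_cspan.
have -> : #|(fun l : 'I_N => l < k)%N| = (rank I i k + #|S|)%N.
  rewrite /rank card_cset -!sum1_card (bigID (fun l => I l <= i)%N) /=.
  by congr addn; apply: eq_bigl => l; rewrite /in_mem /= /S -?ltnNge andbC.
by rewrite leq_add2r.
Qed.

(** The coordinates are the entries with I p < I l. The other entries are overwritten by those of
    the identity, so that the source of the chart can be a full matrix space. *)
Definition chart_mx I M : 'M[R]_N :=
  \matrix_(p, l) if (I l <= I p)%N then (p == l)%:R else M p l.

Lemma chart_mx_row I M p :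
  row p (chart_mx I M) - e_ p \in high I (I p).
Proof.
apply/mem_cspan => l; rewrite -leqNgt => lp; rewrite !mxE lp eqxx /=.
by rewrite (eq_sym l) subrr.
Qed.

(* Downward induction on [I l]: the row [l] of [chart_mx I M] is the [l]-th
   basis vector up to basis vectors of larger index. *)
Lemma chart_basis_ind I M (P : V -> Prop) :
  P 0 -> (forall a u w, P u -> P w -> P (a *: u + w)) ->
  (forall l, P (e_ l) \/ P (row l (chart_mx I M))) -> forall v, P v.
Proof.
move=> P0 Plin Prow.
have PB u w : P u -> P w -> P (u - w).
  by move=> Pu Pw; rewrite addrC -scaleN1r; apply: Plin.
have Pe l : P (e_ l).
  have [n] := ubnP (m - I l)%N; elim: n l => // n IH l /ltnSE ln.
  have [//|Pl] := Prow l; rewrite -[e_ l](subKr (row l (chart_mx I M))).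
  apply: PB => //; have := chart_mx_row I M l; apply: (span_ind P0 Plin).
  move=> _ /mapP[k + ->]; rewrite mem_enum /in_mem /= => lk; apply: IH.
  by have := ltn_ord (I k); lia.
move=> v; rewrite [v]row_sum_delta.
by elim/big_rec: _ => // l w _ Pw; exact: Plin.
Qed.

Definition chart_space I M i : {vspace V} :=
  <<[seq row p (chart_mx I M) | p <- enum (low I i)]>>%VS.

Lemma chart_space_row I M i p : (I p <= i)%N ->
  row p (chart_mx I M) \in chart_space I M i.
Proof. by move=> pi; apply: memv_span; apply: map_f; rewrite mem_enum. Qed.

Lemma chart_space_full I M i : (chart_space I M i + high I i)%VS = fullv.
Proof.
apply/vspaceP => v; rewrite memvf.
apply: (@chart_basis_ind I M (fun v => v \in _)); first exact: mem0v.
  by move=> a u w uU wU; rewrite memvD // memvZ.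
move=> l; have [li|il] := leqP (I l) i; [right|left].
  by apply: (subvP (addvSl _ _)); exact: chart_space_row.
by apply: (subvP (addvSr _ _)); exact: delta_mem.
Qed.

Lemma dim_chart_space I M i : \dim (chart_space I M i) = partial_dim d i.
Proof.
have le : (\dim (chart_space I M i) <= partial_dim d i)%N.
  by rewrite -(card_low I) cardE; apply: leq_trans (dim_span _) _; rewrite size_map.
have := dimv_sum_cap (chart_space I M i) (high I i).
rewrite chart_space_full dimvf /= /dim /= mul1n.
by have := dim_high I i; move: le; lia.
Qed.

Lemma chart_is_flag I M : is_flag d [ffun i => chart_space I M i].
Proof.
apply/andP; split; first by apply/forallP => i; rewrite ffunE dim_chart_space.
apply/forallP => i; apply/forallP => j; apply/implyP => ij; rewrite !ffunE.
apply/span_subvP => _ /mapP[p + ->]; rewrite mem_enum /in_mem /= => pi.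
by apply: chart_space_row; exact: leq_trans pi ij.
Qed.

Definition chart I M : flag := Flag (chart_is_flag I M).

Lemma chartE I M i : chart I M i = chart_space I M i.
Proof. by rewrite /chart /= ffunE. Qed.

Lemma chart_in_domain I M : chart_domain I (chart I M).
Proof.
move=> i; rewrite chartE; apply/eqP; rewrite -dimv_eq0.
have := dimv_sum_cap (chart_space I M i) (high I i).
rewrite chart_space_full dimvf /= /dim /= mul1n dim_chart_space dim_high; lia.
Qed.

(** Row [p] of the normal form is the only vector of [F (I p)] congruent to the basis vector modulo
    [high], that is, the projection of this basis vector along [high]. *)
Definition chart_inv I F : 'M[R]_N :=
  \matrix_p daddv_pi (F (I p)) (high I (I p)) (e_ p).

Lemma chart_inv_row I F p v : chart_domain I F ->
  v \in F (I p) -> v - e_ p \in high I (I p) -> row p (chart_inv I F) = v.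
Proof.
move=> FI vF vh; rewrite rowK; set w := daddv_pi _ _ _.
have wF : w \in F (I p) by exact: memv_pi.
have wh : e_ p - w \in high I (I p).
  rewrite -{1}(daddv_pi_add (FI (I p)) (w := e_ p)) ?chart_domain_full ?memvf //.
  by rewrite addrAC subrr add0r; exact: memv_pi.
apply/eqP; rewrite -subr_eq0 -memv0 -(FI (I p)); apply/memv_capP; split.
  exact: memvB.
rewrite (_ : w - v = - (v - e_ p) - (e_ p - w)); last by rewrite !opprB [RHS]addrC addrA subrK.
by rewrite memvB // memvN.
Qed.

Lemma chart_inv_mem I F p : row p (chart_inv I F) \in F (I p).
Proof. by rewrite rowK memv_pi. Qed.

Lemma chart_inv_high I F p : chart_domain I F ->
  row p (chart_inv I F) - e_ p \in high I (I p).
Proof.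
move=> FI; rewrite rowK -{2}(daddv_pi_add (FI (I p)) (w := e_ p)) ?chart_domain_full ?memvf //.
by rewrite opprD addrA subrr add0r memvN memv_pi.
Qed.

Lemma chart_invK I F : chart_domain I F -> chart I (chart_inv I F) = F.
Proof.
move=> FI; apply: flag_eq => i; rewrite chartE.
apply/span_subvP => _ /mapP[p + ->]; rewrite mem_enum /in_mem /= => pi.
have -> : row p (chart_mx I (chart_inv I F)) = row p (chart_inv I F).
  apply/rowP => l; rewrite !mxE; case: ifP => // lp.
  have /mem_cspan/(_ l) := chart_inv_high p FI; rewrite -leqNgt => /(_ lp).
  rewrite !mxE eqxx /= => /eqP; rewrite subr_eq0 => /eqP.
  by rewrite (eq_sym l) => ->.
by apply: (subvP (flag_le F pi)); exact: chart_inv_mem.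
Qed.

Lemma chartK I M : chart_inv I (chart I M) = chart_mx I M.
Proof.
apply/row_matrixP => p; apply: chart_inv_row; first exact: chart_in_domain.
  by rewrite chartE; exact: chart_space_row.
exact: chart_mx_row.
Qed.

Lemma mem_coord_subspace k (v : V) :
  v \in coord_subspace R N k <-> forall l : 'I_N, (k <= l)%N -> v ord0 l = 0.
Proof.
rewrite coord_subspaceE mem_cspan; split=> v0 l kl; apply: v0; first by rewrite -leqNgt.
by rewrite leqNgt.
Qed.

Lemma coord_subspaceS k k' : (k <= k')%N ->
  (coord_subspace R N k <= coord_subspace R N k')%VS.
Proof.
move=> kk'; rewrite !coord_subspaceE; apply: cspanS => l lk.
exact: leq_trans lk kk'.
Qed.

(** A vector of [F i] and [high I i] is pushed down the subspaces E_k. If the letter at [k] is at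
    most [i], its coordinate vanishes because the vector is in [high]; otherwise the rank does not
    jump at [k]. *)
Lemma cell_in_domain I F : schubert_cell I F -> chart_domain I F.
Proof.
move=> FI i; apply/eqP; rewrite -subv0; apply/subvP => v /memv_capP[vF vh].
suff key k : v \in coord_subspace R N k -> v \in 0%VS.
  by apply: (key N); apply/mem_coord_subspace => l; rewrite leqNgt ltn_ord.
elim: k => [/mem_coord_subspace v0|k IH vk].
  by rewrite memv0; apply/eqP/rowP => l; rewrite mxE v0.
apply: IH; have [kN|Nk] := ltnP k N; last first.
  apply/mem_coord_subspace => l kl; have := ltn_ord l.
  by rewrite ltnNge (leq_trans Nk kl).
have [li|il] := leqP (I (Ordinal kN)) i; last first.
  have : (F i :&: coord_subspace R N k.+1 <= F i :&: coord_subspace R N k)%VS.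
    rewrite -(geq_leqif (dimv_leqif_sup (capvS (subvv _) (coord_subspaceS (leqnSn k))))).
    rewrite !FI !card_cset; apply/eq_leq; apply: eq_bigl => l.
    apply/andP/andP => -[li lk]; split=> //; last exact: ltnW.
    rewrite ltn_neqAle -ltnS lk andbT; apply/eqP => kl.
    have lE : l = Ordinal kN by exact: val_inj.
    by move: il; rewrite -lE ltnNge li.
  move/subvP/(_ v); rewrite !memv_cap vF vk => /(_ isT) //.
apply/mem_coord_subspace => l; rewrite leq_eqVlt => /orP[/eqP kl|kl].
  rewrite (_ : l = Ordinal kN); last exact: val_inj.
  by move/mem_cspan : vh; apply; rewrite -leqNgt.
by move/mem_coord_subspace : vk; exact.
Qed.

(** On the cell, the rank condition makes [F i] and [high] already complementary inside E_(p+1), so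
    the projection of the basis vector stays there. Hence the transverse coordinates vanish. *)
Lemma cell_row I F p : schubert_cell I F ->
  row p (chart_inv I F) \in coord_subspace R N p.+1.
Proof.
move=> FI; have Fdom := cell_in_domain FI; pose i := I p.
pose E := coord_subspace R N p.+1; pose S l := (i < I l)%N && (l < p.+1)%N.
have SE : (cspan R S <= E)%VS by rewrite /E coord_subspaceE; apply: cspanS => l /andP[].
have Sh : (cspan R S <= high I i)%VS by apply: cspanS => l /andP[].
have cap0 : (F i :&: E :&: cspan R S)%VS = 0%VS.
  by apply/eqP; rewrite -subv0 -(Fdom i); apply: capvS => //; exact: capvSl.
have full : (F i :&: E + cspan R S)%VS = E.
  apply/eqP; rewrite eqEdim subv_add capvSr SE dimv_disjoint_sum //= FI.
  rewrite /E coord_subspaceE !dim_cspan card_cset -!sum1_card.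
  rewrite (bigID (fun l => I l <= i)%N) /=; apply: eq_leq.
  by congr addn; apply: eq_bigl => l; rewrite /in_mem /= /S -?ltnNge andbC.
have : e_ p \in (F i :&: E + cspan R S)%VS.
  by rewrite full /E coord_subspaceE; apply: delta_mem => /=.
case/memv_addP => v /memv_capP[vF vE] [w wS epE].
rewrite (chart_inv_row Fdom vF) // epE opprD addrA subrr add0r memvN.
exact: (subvP Sh).
Qed.

(** Without transverse entries the rows at positions below [k] lie in E_k, and they are numerous
    enough to attain the upper bound valid on the whole chart. *)
Lemma chart_in_cell I M : (forall ij, ij \in transverse I -> M ij.1 ij.2 = 0) ->
  schubert_cell I (chart I M).
Proof.
move=> M0 i k; apply/eqP; rewrite eqn_leq -/(rank I i k).
rewrite chart_domain_rank /=; last exact: chart_in_domain.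
pose S l := (I l <= i)%N && (l < k)%N.
pose U : {vspace V} := <<[seq row p (chart_mx I M) | p <- enum S]>>%VS.
apply: (@leq_trans (\dim U)); last first.
  apply: dimvS; rewrite subv_cap chartE; apply/andP.
  split; apply/span_subvP => _ /mapP[p + ->]; rewrite mem_enum => /andP[pi pk].
    exact: chart_space_row.
  apply/mem_coord_subspace => l kl; have pl := leq_trans pk kl.
  rewrite !mxE; case: ifP => [_|/negbT]; first by rewrite -val_eqE /= (ltn_eqF pl).
  by rewrite -ltnNge => lp; apply: (M0 (p, l)); rewrite mem_transverse /= pl.
have full : (U + cspan R (predC S))%VS = fullv.
  apply/vspaceP => v; rewrite memvf.
  apply: (@chart_basis_ind I M (fun v => v \in _)); first exact: mem0v.
    by move=> a u w uU wU; rewrite memvD // memvZ.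
  move=> l; case: (boolP (S l)) => Sl; [right|left].
    by apply: (subvP (addvSl _ _)); apply: memv_span; apply: map_f; rewrite mem_enum.
  by apply: (subvP (addvSr _ _)); exact: delta_mem.
have := dimv_sum_cap U (cspan R (predC S)); rewrite full dimvf /= /dim /= mul1n dim_cspan.
have cC : (#|S| + #|predC S|)%N = N by rewrite cardC card_ord.
have -> : rank I i k = #|S| by rewrite /rank card_cset -sum1_card.
by move: cC; set c := #|predC S|; lia.
Qed.

Lemma off_chart I M : off (transverse I) M -> ~ schubert_cell I (chart I M).
Proof.
case=> -[p l]; rewrite mem_transverse /= => /andP[pl Ipl] /eqP Mpl FI; apply: Mpl.
have /mem_coord_subspace/(_ l pl) := cell_row p FI.
by rewrite chartK !mxE leqNgt Ipl.
Qed.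

Lemma off_chart_inv I F : chart_domain I F -> ~ schubert_cell I F ->
  off (transverse I) (chart_inv I F).
Proof.
move=> FI nF; apply: contrapT => noff; apply: nF; rewrite -(chart_invK FI).
apply: chart_in_cell => ij ijI; apply: contrapT => /eqP M0.
by apply: noff; exists ij.
Qed.

Lemma domain_cell_rank I J F : chart_domain I F -> schubert_cell J F ->
  forall i k, (rank J i k <= rank I i k)%N.
Proof. by move=> FI FJ i k; rewrite /rank -FJ chart_domain_rank. Qed.

End FlagCharts.

(** * Continuity of the charts for the quotient topology *)

Section MatrixContinuity.
Variables (R : realType) (T : topologicalType) (x : T).

Definition mxcts m n (A : T -> 'M[R]_(m, n)) : Prop :=
  forall i j, {for x, continuous (fun t => A t i j)}.

Lemma sum_cts (I : finType) (F : T -> I -> R) :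
  (forall i, {for x, continuous (F ^~ i)}) ->
  {for x, continuous (fun t => \sum_i F t i)}.
Proof.
by move=> Fc; apply: cvg_big => [|i _]; [exact: add_continuous|exact: Fc].
Qed.

Lemma prod_cts (I : finType) (F : T -> I -> R) :
  (forall i, {for x, continuous (F ^~ i)}) ->
  {for x, continuous (fun t => \prod_i F t i)}.
Proof.
by move=> Fc; apply: cvg_big => [|i _]; [exact: mul_continuous|exact: Fc].
Qed.

Lemma mul_cts m n k (A : T -> 'M[R]_(m, n)) (B : T -> 'M[R]_(n, k)) :
  mxcts A -> mxcts B -> mxcts (fun t => A t *m B t).
Proof.
move=> Ac Bc i j.
rewrite (_ : (fun t => _) = fun t => \sum_l A t i l * B t l j); last first.
  by apply/funext => t; rewrite mxE.
by apply: sum_cts => l; apply: continuousM; [exact: Ac|exact: Bc].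
Qed.

Lemma det_cts n (A : T -> 'M[R]_n) :
  mxcts A -> {for x, continuous (fun t => \det (A t))}.
Proof.
move=> Ac; apply: sum_cts => s; apply: continuousM; first exact: cst_continuous.
by apply: prod_cts => i; exact: Ac.
Qed.

Lemma adj_cts n (A : T -> 'M[R]_n) : mxcts A -> mxcts (fun t => \adj (A t)).
Proof.
move=> Ac i j.
rewrite (_ : (fun t => _) = fun t => (-1) ^+ (j + i) * \det (row' j (col' i (A t)))); last first.
  by apply/funext => t; rewrite mxE.
apply: continuousM; first exact: cst_continuous.
apply: det_cts => k l.
rewrite (_ : (fun t => _) = fun t => A t (lift j k) (lift i l)); first exact: Ac.
by apply/funext => t; rewrite !mxE.
Qed.

End MatrixContinuity.

Lemma sorted_count (w : seq nat) a i : sorted leq w -> (a < size w)%N ->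
  (nth 0 w a <= i)%N = (a < count (fun z => z <= i) w)%N.
Proof.
elim: w a => //= x w IH a xw aw; have sw := path_sorted xw.
case: (leqP x i) => xi; first by case: a aw => //= a aw; rewrite add1n ltnS IH.
have c0 : count (fun z => z <= i)%N w = 0%N.
  apply/eqP; rewrite -leqn0 leqNgt -has_count; apply/hasPn => z zw.
  by rewrite -ltnNge (leq_trans xi) //; move: (order_path_min leq_trans xw) => /allP/(_ z zw).
rewrite add0n c0 ltn0; case: a aw => [|a] aw /=; first by rewrite leqNgt xi.
by rewrite IH // c0 ltn0.
Qed.

Section FlagTopology.
Variables (R : realType) (m N : nat) (d : 'I_m -> nat).
Local Notation V := 'rV[R]_N.
Local Notation e_ l := (delta_mx ord0 l : V).
Local Notation flag := (flag R N d).
Local Notation osp := (osp N d).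
Implicit Types (I : osp) (i : 'I_m) (F : flag) (M g : 'M[R]_N).

Definition sorted_positions I : seq 'I_N := sort (fun x y => I x <= I y)%N (enum 'I_N).

Lemma size_sorted_positions I : size (sorted_positions I) = N.
Proof. by rewrite size_sort size_enum_ord. Qed.

Definition sorting_fun I (a : 'I_N) : 'I_N := nth a (sorted_positions I) a.

Lemma sorting_fun_inj I : injective (sorting_fun I).
Proof.
move=> a b; rewrite /sorting_fun (set_nth_default a) ?size_sorted_positions //.
move/eqP; rewrite nth_uniq ?size_sorted_positions ?sort_uniq ?enum_uniq //.
by move/eqP/val_inj.
Qed.

(** Adapted matrices list their rows block by block, charts index them by positions; this
    permutation translates between the two. *)
Definition sorting I : {perm 'I_N} := perm (@sorting_fun_inj I).

Lemma sorting_low I i (a : 'I_N) : (I (sorting I a) <= i)%N = (a < partial_dim d i)%N.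
Proof.
rewrite permE /sorting_fun.
have -> : nat_of_ord (I (nth a (sorted_positions I) a)) =
    nth 0%N [seq nat_of_ord (I l) | l <- sorted_positions I] a.
  by rewrite (nth_map a) // size_sorted_positions.
rewrite sorted_count ?size_map ?size_sorted_positions //; last first.
  rewrite sorted_map; apply: sort_sorted => x y; exact: leq_total.
congr (_ < _)%N; rewrite count_map -(card_low I) cardE size_filter.
by rewrite (seq.permP (permEl (perm_sort _ _))) enumT.
Qed.

Definition prefix_mx (A : 'I_N -> V) i g : 'M[R]_N :=
  \matrix_a (if (a < partial_dim d i)%N then row a g else A a).

(** The rows of [g] that span [F i], completed by the basis vectors of [high I i]; it is invertible
    for all [i] exactly on the chart. Its inverse followed by [cut_mx] is the projection onto [F i]
    along [high]. *)
Definition frame_mx I := prefix_mx (fun a => e_ (sorting I a)).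
Definition cut_mx := prefix_mx (fun=> 0).

Lemma row_mulE (v : V) M : v *m M = \sum_a v ord0 a *: row a M.
Proof. exact: mulmx_sum_row. Qed.

Lemma adapted_mem g F i (a : 'I_N) : adapted g F -> (a < partial_dim d i)%N ->
  row a g \in F i.
Proof.
move=> [_ ->] ai; apply: memv_span; apply: map_f.
by rewrite mem_filter ai mem_enum.
Qed.

Lemma cut_mem g F i (v : V) : adapted g F -> v *m cut_mx i g \in F i.
Proof.
move=> gF; rewrite row_mulE; apply: memv_suml => a _; apply: memvZ.
by rewrite rowK; case: ifP => [/(adapted_mem gF)//|_]; exact: mem0v.
Qed.

Lemma frame_high I g i (v : V) : v *m frame_mx I i g - v *m cut_mx i g \in high R I i.
Proof.
rewrite -mulmxBr row_mulE; apply: memv_suml => a _; apply: memvZ.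
rewrite linearB /= !rowK; case: ifP => [_|ai]; first by rewrite subrr mem0v.
by rewrite subr0; apply: delta_mem; rewrite ltnNge sorting_low ai.
Qed.

Lemma frame_domain I g F : adapted g F ->
  chart_domain I F <-> forall i, frame_mx I i g \in unitmx.
Proof.
move=> gF; split=> [FI i|gu i].
  rewrite -row_full_unit -sub1mx; apply/row_subP => l.
  have : row l 1%:M \in (F i + high R I i)%VS by rewrite chart_domain_full ?memvf.
  case/memv_addP => v vF [w wh ->]; apply: addmx_sub.
    rewrite gF.2 in vF; move: v vF; apply: span_ind => [|a u w' uG wG|_ /mapP[a + ->]].
    - exact: sub0mx.
    - by apply: addmx_sub => //; exact: scalemx_sub.
    rewrite mem_filter => /andP[ai _].
    suff -> : row a g = row a (frame_mx I i g) by exact: row_sub.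
    by rewrite rowK ai.
  move: w wh; apply: span_ind => [|a u w' uG wG|_ /mapP[a + ->]].
  - exact: sub0mx.
  - by apply: addmx_sub => //; exact: scalemx_sub.
  rewrite mem_enum /in_mem /= => ai.
  suff -> : e_ a = row ((sorting I)^-1%g a) (frame_mx I i g) by exact: row_sub.
  by rewrite rowK -(sorting_low I) permKV leqNgt ai.
apply/eqP; rewrite -dimv_eq0.
have full : (F i + high R I i)%VS = fullv.
  apply/vspaceP => v; rewrite memvf -[v](mulmxKV (gu i)).
  set x := _ *m invmx _; rewrite -[x *m _](subrK (x *m cut_mx i g)).
  by rewrite addrC memv_add ?frame_high ?cut_mem.
have := dimv_sum_cap (F i) (high R I i).
rewrite full dimvf /= /dim /= mul1n dim_flag dim_high; lia.
Qed.

(** Determinant and adjugate replace the inverse, so that continuity reduces to polynomials and one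
    nonvanishing denominator. *)
Definition chart_inv_mx I g : 'M[R]_N :=
  \matrix_p ((\det (frame_mx I (I p) g))^-1 *:
    (e_ p *m \adj (frame_mx I (I p) g) *m cut_mx (I p) g)).

Lemma chart_inv_adapted I g F : adapted g F -> chart_domain I F ->
  chart_inv I F = chart_inv_mx I g.
Proof.
move=> gF FI; have gu := (frame_domain I gF).1 FI.
apply/row_matrixP => p; rewrite [RHS]rowK; set G := frame_mx I (I p) g.
have -> : (\det G)^-1 *: (e_ p *m \adj G *m cut_mx (I p) g) =
    e_ p *m invmx G *m cut_mx (I p) g.
  by rewrite /invmx gu -scalemxAr -scalemxAl.
apply: chart_inv_row => //; first exact: cut_mem.
rewrite -{2}[e_ p](mulmxKV (gu (I p))) -memvN opprB; exact: frame_high.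
Qed.

Lemma mxcts_prefix A i g : mxcts g (prefix_mx A i).
Proof.
move=> a l; case: (boolP (a < partial_dim d i)%N) => ai.
  rewrite (_ : (fun t => _) = fun t : 'M[R]_N => t a l); first exact: coord_continuous.
  by apply/funext => t; rewrite mxE ai mxE.
rewrite (_ : (fun t => _) = cst (A a ord0 l)); first exact: cst_continuous.
by apply/funext => t; rewrite mxE (negPf ai).
Qed.

Lemma chart_inv_mx_continuous I g : (forall i, frame_mx I i g \in unitmx) ->
  {for g, continuous (chart_inv_mx I)}.
Proof.
move=> gu; apply: matrix_continuous => p l.
rewrite (_ : (fun t => _) = fun t => (\det (frame_mx I (I p) t))^-1 *
  (e_ p *m \adj (frame_mx I (I p) t) *m cut_mx (I p) t) ord0 l); last first.
  by apply/funext => t; rewrite !mxE.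
apply: continuousM.
  apply: continuousV; first by have := gu (I p); rewrite unitmxE unitfE.
  by apply: det_cts; exact: mxcts_prefix.
apply: mul_cts; last exact: mxcts_prefix.
apply: mul_cts; last by apply: adj_cts; exact: mxcts_prefix.
by move=> a b; exact: cst_continuous.
Qed.

End FlagTopology.

Section FlagOpenSets.
Variables (R : realType) (m N : nat) (d : 'I_m -> nat).
Local Notation V := 'rV[R]_N.
Local Notation e_ l := (delta_mx ord0 l : V).
Local Notation flag := (flag R N d).
Local Notation osp := (osp N d).
Implicit Types (I J : osp) (i : 'I_m) (F : flag) (M g : 'M[R]_N).

Lemma flag_openE (O : set flag) : open O = flag_open O.
Proof. by []. Qed.

Lemma chart_mx_unit I M : chart_mx I M \in unitmx.
Proof.
rewrite -row_full_unit -sub1mx; apply/row_subP => l.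
apply: (@chart_basis_ind R m N d I M (fun v => (v <= chart_mx I M)%MS)).
- exact: sub0mx.
- by move=> a u w uG wG; apply: addmx_sub => //; exact: scalemx_sub.
- by move=> k; right; exact: row_sub.
Qed.

Lemma chart_adapted I M : adapted (row_perm (sorting I) (chart_mx I M)) (chart I M).
Proof.
split; first by rewrite row_permE unitmx_mul unitmx_perm chart_mx_unit.
move=> i; rewrite chartE; apply/eqP; rewrite eqEsubv; apply/andP; split; apply/span_subvP => _ /mapP[a + ->].
  rewrite mem_enum /in_mem /= => ai; apply: memv_span; apply/mapP.
  exists ((sorting I)^-1%g a); first by rewrite mem_filter mem_enum andbT -(sorting_low I) permKV; exact: ai.
  by apply/rowP => l; rewrite !mxE permKV.
rewrite mem_filter => /andP[ai _].
rewrite (_ : row a _ = row (sorting I a) (chart_mx I M)); last by apply/rowP => l; rewrite !mxE.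
by apply: chart_space_row; rewrite sorting_low.
Qed.

Lemma chart_continuous I : continuous (chart I : 'M[R]_N -> flag).
Proof.
move=> M O; rewrite nbhsE => -[B [oB BM] BO].
have cts : {for M, continuous (fun M => row_perm (sorting I) (chart_mx I M))}.
  apply: matrix_continuous => p l.
  have [lp|lp] := leqP (I l) (I (sorting I p)).
    rewrite (_ : (fun t => _) = cst (sorting I p == l)%:R); first exact: cst_continuous.
    by apply/funext => t; rewrite !mxE lp.
  rewrite (_ : (fun t => _) = fun t : 'M[R]_N => t (sorting I p) l); first exact: coord_continuous.
  by apply/funext => t; rewrite !mxE leqNgt lp.
rewrite flag_openE in oB; have near_B := oB _ _ BM (chart_adapted I M).
have := cts _ near_B; rewrite nbhs_simpl /=; apply: filterS => M' /= B'.
by apply: BO; apply: B'; exact: chart_adapted.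
Qed.

HB.instance Definition _ I := @isContinuous.Build _ _ (chart I) (@chart_continuous I).

Lemma frame_near I g : (forall i, frame_mx I i g \in unitmx) ->
  \forall h \near g, forall i, frame_mx I i h \in unitmx.
Proof.
move=> gu; apply: (filter_forall (F := nbhs g)) => i.
have : {for g, continuous (fun h => \det (frame_mx I i h))}.
  by apply: det_cts; exact: mxcts_prefix.
move=> cts; have near0 : nbhs (\det (frame_mx I i g)) [set r : R | r != 0].
  by apply: open_nbhs_nbhs; split; [exact: open_neq|have := gu i; rewrite unitmxE unitfE].
have := cts _ near0; rewrite nbhs_simpl /=; apply: filterS => h /=.
by rewrite unitmxE unitfE.
Qed.

Lemma chart_domain_open I : open (chart_domain I : set flag).
Proof.
move=> F g FI gF; apply: filterS (frame_near ((frame_domain I gF).1 FI)) => h hu F' hF'.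
exact/(frame_domain I hF').
Qed.

Lemma chart_inv_continuous I F : chart_domain I F ->
  {for F, continuous (chart_inv I : flag -> 'M[R]_N)}.
Proof.
move=> FI B; rewrite nbhsE => -[B' [oB' B'F] B'B].
change (nbhs F (chart_inv I @^-1` B)); rewrite nbhsE.
exists (chart_domain I `&` chart_inv I @^-1` B'); last by move=> F' [_ /B'B].
split=> //; rewrite flag_openE; move=> F0 g [F0I B'F0] gF0.
have gu := (frame_domain I gF0).1 F0I.
have near_B' : nbhs g (chart_inv_mx I @^-1` B').
  apply: (chart_inv_mx_continuous gu); rewrite -(chart_inv_adapted gF0 F0I).
  exact: open_nbhs_nbhs.
near=> h => F' hF'.
have F'I : chart_domain I F' by apply/(frame_domain I hF'); near: h; exact: frame_near.
split=> //=; rewrite (chart_inv_adapted hF' F'I).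
by near: h; exact: near_B'.
Unshelve. all: by end_near. Qed.

(** Monotonicity of the codimension confines the chart to its own cell and cells of strictly smaller
    codimension. Disjointness of cells and openness of unions of cells rest on this. *)
Lemma chart_domain_codim I J F : chart_domain I F -> schubert_cell J F ->
  (cell_codim J <= cell_codim I)%N /\ (cell_codim I = cell_codim J -> I = J).
Proof. by move=> FI FJ; apply: cell_codim_rank; exact: domain_cell_rank FI FJ. Qed.

Lemma cell_disjoint I J F : schubert_cell I F -> schubert_cell J F -> I = J.
Proof.
move=> FI FJ; have [le1 eq1] := chart_domain_codim (cell_in_domain FI) FJ.
have [le2 _] := chart_domain_codim (cell_in_domain FJ) FI.
by apply: eq1; apply/eqP; rewrite eqn_leq le1 le2.
Qed.

Definition cells (P : osp -> Prop) : set flag :=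
  [set F | exists2 I, P I & schubert_cell I F].

Hypothesis dN : (\sum_(i < m) d i)%N = N.

(** * Every flag lies in a Schubert cell *)

Section Jumps.
Variable F : flag.

Definition jump i (l : 'I_N) : bool :=
  ~~ (F i :&: coord_subspace R N l.+1 <= coord_subspace R N l)%VS.

Lemma dim_jump i (l : 'I_N) : \dim (F i :&: coord_subspace R N l.+1) =
  (\dim (F i :&: coord_subspace R N l) + jump i l)%N.
Proof.
have dimE k : (k <= N)%N -> \dim (coord_subspace R N k) = k.
  move=> kN; rewrite coord_subspaceE dim_cspan -sum1_card.
  by rewrite -(big_ord_widen _ (fun=> 1%N) kN) sum_nat_const card_ord muln1.
have le : (coord_subspace R N l <= coord_subspace R N l.+1)%VS by exact: coord_subspaceS.
have capE : (F i :&: coord_subspace R N l.+1 :&: coord_subspace R N l)%VS =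
    (F i :&: coord_subspace R N l)%VS by rewrite -capvA (capv_idPr le).
have sum_le : (\dim (F i :&: coord_subspace R N l.+1 + coord_subspace R N l) <= l.+1)%N.
  by rewrite -[leqRHS]dimE //; apply: dimvS; rewrite subv_add capvSr.
have := dimv_sum_cap (F i :&: coord_subspace R N l.+1) (coord_subspace R N l).
have dl := dimE l (ltnW (ltn_ord l)); rewrite capE dl => e; rewrite /jump.
case: (boolP (_ <= _)%VS) => [sub|nsub].
  by move: e; rewrite (addv_idPr sub) dl; lia.
have : (\dim (coord_subspace R N l) < \dim (F i :&: coord_subspace R N l.+1 + coord_subspace R N l))%N.
  rewrite ltnNge (geq_leqif (dimv_leqif_sup (addvSr _ _))).
  by apply: contra nsub; rewrite subv_add => /andP[].
rewrite dl /=; move: e sum_le; lia.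
Qed.

Lemma dim_count_jump i k : (k <= N)%N ->
  \dim (F i :&: coord_subspace R N k) = (\sum_(l < N | jump i l && (l < k)) 1)%N.
Proof.
elim: k => [_|k IH kN].
  rewrite big_pred0; last by move=> l; rewrite andbF.
  rewrite (_ : coord_subspace R N 0 = 0%VS) ?capv0 ?dimv0 //.
  apply/eqP; rewrite -subv0; apply/subvP => v /mem_coord_subspace v0.
  by rewrite memv0; apply/eqP/rowP => l; rewrite mxE v0.
rewrite (dim_jump i (Ordinal kN)) /= IH 1?ltnW // [RHS](bigID (fun l : 'I_N => l < k)%N) /=.
congr addn.
  apply: eq_bigl => l; rewrite -andbA; congr andb.
  by rewrite andb_idl // => lk; rewrite ltnS ltnW.
rewrite (eq_bigl (fun l => (l == Ordinal kN) && jump i l)); last first.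
  move=> l; rewrite -val_eqE /= ltnS -leqNgt eqn_leq [RHS]andbC.
  by rewrite -andbA.
by rewrite big_mkcondr /= (big_pred1 (Ordinal kN)).
Qed.

Lemma jumpS i i' l : (i <= i')%N -> jump i l -> jump i' l.
Proof.
move=> ii'; apply: contra; apply: subv_trans.
by apply: capvS => //; exact: flag_le.
Qed.

Lemma jump_last (l : 'I_N) (i : 'I_m) : i.+1 = m -> jump i l.
Proof.
move=> im; have Fi : F i = fullv.
  apply/eqP; rewrite eqEdim subvf dimvf /= /dim /= mul1n dim_flag /partial_dim -dN.
  apply: eq_leq; apply/esym/eq_bigl => j; by rewrite -ltnS im ltn_ord.
rewrite /jump Fi; apply/subvPn; exists (e_ l).
  rewrite memv_cap memvf; apply/mem_coord_subspace => k lk.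
  by rewrite mxE eqxx -val_eqE /= gtn_eqF.
apply/negP => /mem_coord_subspace/(_ l (leqnn l)).
by rewrite mxE !eqxx => /eqP; rewrite oner_eq0.
Qed.

End Jumps.

(** The letter at position [l] is the first [i] for which [F i] has a vector in E_(l+1) outside E_l.
    Dimensions of intersections then count letters, and the dimensions of the [F i] give the block
    sizes. *)
Lemma flag_in_cell F : exists I, schubert_cell I F.
Proof.
have /choice[f fP] (l : 'I_N) : exists j : 'I_m, forall i : 'I_m, (j <= i)%N = jump F i l.
  have m0 : (0 < m)%N.
    have N0 := leq_ltn_trans (leq0n l) (ltn_ord l).
    rewrite lt0n; apply: contraTneq N0 => m0; rewrite -leqNgt -dN big1 // => -[i im].
    by exfalso; rewrite m0 in im.
  have imax : (m.-1 < m)%N by rewrite prednK.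
  have jmax : jump F (Ordinal imax) l by apply: jump_last; rewrite /= prednK.
  case: (@arg_minnP _ _ (fun i => jump F i l) (fun i : 'I_m => i : nat) jmax) => j jj jmin; exists j => i.
  by apply/idP/idP => [ji|/jmin //]; exact: jumpS jj.
have sum_low (i : 'I_m) : (\sum_(l < N | f l <= i) 1)%N = partial_dim d i.
  rewrite -(dim_flag F i) -[F i]capvf -(_ : coord_subspace R N N = fullv); last first.
    by apply/vspaceP => v; rewrite memvf; apply/mem_coord_subspace => l; rewrite leqNgt ltn_ord.
  by rewrite dim_count_jump //; apply: eq_bigl => l; rewrite ltn_ord andbT fP.
have fosp : [forall j, #|[set k | [ffun l => f l] k == j]%classic| == d j].
  apply/forallP => j; rewrite card_cset; under eq_bigl do rewrite ffunE.
  have low_lt : (\sum_(l < N | f l < j) 1)%N = (\sum_(j' < m | j' < j) d j')%N.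
    case: j => -[|j] jm /=; first by rewrite !big_pred0.
    exact: (sum_low (Ordinal (ltnW jm))).
  have e1 : (\sum_(l < N | f l <= j) 1 = \sum_(l < N | f l == j) 1 + \sum_(l < N | f l < j) 1)%N.
    rewrite (bigID (fun l => f l == j)) /=; congr addn; apply: eq_bigl => l.
      by rewrite andb_idl // => /eqP ->.
    by rewrite ltn_neqAle andbC.
  have e2 : partial_dim d j = (d j + \sum_(j' < m | j' < j) d j')%N.
    rewrite /partial_dim (bigD1 j) //=; congr addn; apply: eq_bigl => j'.
    by rewrite ltn_neqAle andbC.
  by move/eqP: (sum_low j); rewrite e1 e2 low_lt eqn_add2r.
exists (Osp fosp) => i k; rewrite card_cset.
have [kN|Nk] := leqP k N.
  by rewrite dim_count_jump //; apply: eq_bigl => l; rewrite /= ffunE fP.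
rewrite (_ : coord_subspace R N k = coord_subspace R N N).
  rewrite dim_count_jump //; apply: eq_bigl => l.
  by rewrite /= ffunE fP ltn_ord (ltn_trans (ltn_ord l) Nk).
apply/vspaceP => v; apply/idP/idP => /mem_coord_subspace v0; apply/mem_coord_subspace => l kl.
  by have := ltn_ord l; rewrite ltnNge kl.
by have := ltn_ord l; rewrite ltnNge (leq_trans (ltnW Nk) kl).
Qed.

(** The union of cells equals the union of their charts. The condition compares different
    codimensions only, so cells of one codimension may be added one by one in any order. *)
Lemma cells_open (P : osp -> Prop) :
  (forall I J, P I -> (cell_codim J < cell_codim I)%N -> P J) -> open (cells P).
Proof.
move=> Pdown; rewrite (_ : cells P = \bigcup_(I in P) chart_domain I).
  by apply: bigcup_open => I _; exact: chart_domain_open.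
rewrite predeqE => F; split=> [[I PI FI]|[I PI FI]].
  by exists I => //; exact: cell_in_domain.
have [J FJ] := flag_in_cell F; exists J => //.
have [le eq] := chart_domain_codim FI FJ.
move: le; rewrite leq_eqVlt => /orP[/eqP e|]; last exact: Pdown.
by rewrite -eq.
Qed.

End FlagOpenSets.

(** * Closures of cells *)

Section Translations.
Variables (R : realType) (m N : nat) (d : 'I_m -> nat).
Local Notation V := 'rV[R]_N.
Local Notation flag := (flag R N d).
Local Notation osp := (osp N d).
Local Notation E_ k := (coord_subspace R N k).
Implicit Types (I J : osp) (i : 'I_m) (F : flag) (M g b : 'M[R]_N) (U : {vspace V}).

Definition mulr_fun b : 'End(V) := linfun (mulmxr b).

Lemma mulr_funE b v : mulr_fun b v = v *m b.
Proof. by rewrite lfunE. Qed.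

Lemma mem_mulr_img b U v : b \in unitmx ->
  (v \in (mulr_fun b @: U)%VS) = (v *m invmx b \in U).
Proof.
move=> bu; apply/memv_imgP/idP => [[u uU ->]|vU].
  by rewrite mulr_funE mulmxK.
by exists (v *m invmx b); rewrite ?mulr_funE ?mulmxKV.
Qed.

Lemma dim_mulr_img b U : b \in unitmx -> \dim (mulr_fun b @: U) = \dim U.
Proof.
move=> bu; apply: limg_dim_eq; apply/eqP; rewrite -subv0; apply/subvP => v.
rewrite memv_cap memv_ker mulr_funE memv0 => /andP[_ /eqP vb].
by rewrite -[v](mulmxK bu) vb mul0mx.
Qed.

Lemma translate_is_flag b F : b \in unitmx ->
  is_flag d [ffun i => (mulr_fun b @: F i)%VS].
Proof.
move=> bu; apply/andP; split; apply/forallP => i.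
  by rewrite ffunE dim_mulr_img // dim_flag.
apply/forallP => j; apply/implyP => ij; rewrite !ffunE.
by apply: limgS; exact: flag_le.
Qed.

Definition translate b (bu : b \in unitmx) F : flag := Flag (translate_is_flag F bu).

Lemma translateE b (bu : b \in unitmx) F i : translate bu F i = (mulr_fun b @: F i)%VS.
Proof. by rewrite /translate /= ffunE. Qed.

Lemma translateK b (bu : b \in unitmx) (bu' : invmx b \in unitmx) F :
  translate bu' (translate bu F) = F.
Proof.
apply: flag_eq => i; apply/subvP => v; rewrite translateE mem_mulr_img // translateE.
by rewrite mem_mulr_img // invmxK mulmxK.
Qed.

Lemma translate_continuous b (bu : b \in unitmx) : continuous (translate bu : flag -> flag).
Proof.
apply/continuousP => O oO; rewrite flag_openE in oO; rewrite flag_openE => F g OF gF.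
have adapt h F' : adapted h F' -> adapted (h *m b) (translate bu F').
  case=> hu hF'; split; first by rewrite unitmx_mul hu bu.
  move=> i; rewrite translateE hF' limg_span -map_comp; congr (<<_>>%VS).
  by apply: eq_map => l /=; rewrite mulr_funE row_mul.
have cts : {for g, continuous (fun h : 'M[R]_N => h *m b)}.
  apply: matrix_continuous; apply: mul_cts => k l; first exact: coord_continuous.
  exact: cst_continuous.
have := cts _ (oO _ _ OF (adapt _ _ gF)); rewrite nbhs_simpl /=.
by apply: filterS => h hO F' /adapt /hO.
Qed.

Definition preserves_flag b : Prop := forall k v, v \in E_ k -> v *m b \in E_ k.

Lemma preserves_flag_inv b : b \in unitmx -> preserves_flag b -> preserves_flag (invmx b).
Proof.
move=> bu bE k v vE; rewrite -mem_mulr_img //.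
suff -> : (mulr_fun b @: E_ k)%VS = E_ k by [].
apply/eqP; rewrite eqEdim dim_mulr_img // leqnn andbT.
by apply/subvP => _ /memv_imgP[u uE ->]; rewrite mulr_funE; exact: bE.
Qed.

Lemma translate_cell b (bu : b \in unitmx) I F : preserves_flag b ->
  schubert_cell I F -> schubert_cell I (translate bu F).
Proof.
move=> bE FI i k; rewrite -FI -(dim_mulr_img (F i :&: E_ k) bu).
congr (\dim _); apply/vspaceP => v; rewrite memv_cap translateE !mem_mulr_img // memv_cap.
congr andb; apply/idP/idP => [|vE]; first exact: (preserves_flag_inv bu).
by rewrite -[v](mulmxKV bu); exact: bE.
Qed.

Lemma translate_closure b (bu : b \in unitmx) I F : preserves_flag b ->
  schubert_variety I F -> schubert_variety I (translate bu F).
Proof.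
move=> bE FI B nB; have [F' [F'I BF']] := FI _ (@translate_continuous b bu F B nB).
by exists (translate bu F'); split=> //; exact: translate_cell.
Qed.

(** The matrix [chart_inv J F] serves as [b]: it is triangular by [cell_row], and its rows span [F],
    so it moves the coordinate flag [chart J 0] to [F]. *)
Lemma cell_translate J F : schubert_cell J F -> exists b (bu : b \in unitmx),
  preserves_flag b /\ translate bu (chart J 0) = F.
Proof.
move=> FJ; have FD := cell_in_domain FJ; pose b := chart_inv J F.
have bu : b \in unitmx by rewrite /b -(chart_invK FD) chartK chart_mx_unit.
exists b, bu; split=> [k v vE|].
  rewrite mulmx_sum_row; apply: memv_suml => p _.
  have [pk|kp] := ltnP p k; last first.
    by rewrite (mem_coord_subspace k v).1 // scale0r mem0v.
  by apply: memvZ; apply: (subvP (coord_subspaceS R N pk)); exact: cell_row.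
apply: flag_eq => i; rewrite translateE chartE limg_span -map_comp.
apply/span_subvP => _ /mapP[p + ->]; rewrite mem_enum /in_mem /= => pi.
rewrite mulr_funE (_ : row p _ = row p 1%:M); last first.
  by apply/rowP => l; rewrite !mxE; case: ifP => // /negbT; case: eqVneq => // ->; rewrite leqnn.
by rewrite -row_mul mul1mx; apply: (subvP (flag_le F pi)); exact: chart_inv_mem.
Qed.

(* The matrices preserving the coordinate subspaces act transitively on each cell
   and preserve every Schubert variety. *)
Lemma cell_sub_variety I J F : schubert_cell J F -> schubert_variety I F ->
  schubert_cell J `<=` (schubert_variety I : set flag).
Proof.
move=> FJ FI F' /cell_translate[b' [bu' [bE' <-]]]; apply: translate_closure => //.
have [b [bu [bE bF]]] := cell_translate FJ.
have biu : invmx b \in unitmx by rewrite unitmx_inv.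
rewrite -(translateK bu biu (chart J 0)) bF; apply: translate_closure => //.
exact: preserves_flag_inv.
Qed.

End Translations.

(** * Attaching cells *)

Section Truncation.
Variables (R : realType) (X : topologicalType) (A : comNzRingType).
Implicit Types (u z : cochain R X A) (V : set X) (k : nat).

Definition below k u : cochain R X A :=
  fun x => if ((projT1 x).+1 <= k)%N then u x else 0.

Lemma coboundary_below k u x :
  coboundary (below k u) x = if (projT1 x <= k)%N then coboundary u x else 0.
Proof.
case: x => -[|n] s /=; first by [].
have faceE (i : 'I_n.+2) : below k u (sub_simplex s (lift i)) =
    if (n < k)%N then u (sub_simplex s (lift i)) else 0 by [].
case: ifP => nk; first by apply: eq_bigr => i _; rewrite faceE nk.
by apply: big1 => i _; rewrite faceE nk mulr0.
Qed.

(** A primitive may have components of high degree that are cocycles on [V] alone. Dropping them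
    keeps the degree bound for the next cell. *)
Lemma coboundary_truncate k u z V :
  (forall x, (k < projT1 (x : singular_simplex R X))%N -> z x = 0) ->
  (forall x, inside V x -> z x = coboundary u x) ->
  forall x, inside V x -> z x = coboundary (below k u) x.
Proof.
move=> zlow zu x xV; rewrite coboundary_below; case: leqP => [_|kx]; first exact: zu.
exact: zlow.
Qed.

Lemma below_inside0 k u V : (forall x, inside V x -> u x = 0) ->
  forall x, inside V x -> below k u x = 0.
Proof. by move=> u0 x xV; rewrite /below u0 //; case: ifP. Qed.

End Truncation.

Section CellAttachment.
Variables (R : realType) (m N : nat) (d : 'I_m -> nat).
Local Notation flag := (flag R N d).
Local Notation osp := (osp N d).
Hypothesis dN : (\sum_(i < m) d i)%N = N.
Implicit Types (I J : osp) (P : pred osp) (z : cochain R flag 'F_2).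

Local Notation cellset P := (cells (fun J => is_true (P J)) : set flag).

Lemma cell_step P I z :
  (forall J K, P J -> (cell_codim K < cell_codim J)%N -> P K) -> P I ->
  (forall J, P J -> (cell_codim J <= cell_codim I)%N) ->
  (forall x, inside (cellset P) x -> coboundary z x = 0) ->
  (forall x, inside (cellset [pred J | P J && (J != I)]) x -> z x = 0) ->
  (forall x, (cell_codim I <= projT1 (x : singular_simplex R flag))%N -> z x = 0) ->
  exists2 u : cochain R flag 'F_2,
    (forall x, inside (cellset [pred J | P J && (J != I)]) x -> u x = 0) &
    forall x, inside (cellset P) x -> z x = coboundary u x.
Proof.
move=> Pdown PI Pmax dz z0 zlow.
have domP : chart_domain I `<=` cellset P.
  move=> F FI; have [J FJ] := flag_in_cell dN F; exists J => //.
  have [le eq] := chart_domain_codim FI FJ.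
  by move: le; rewrite leq_eqVlt => /orP[/eqP /esym /eq <-|/(Pdown _ _ PI)].
have diffE : cellset [pred J | P J && (J != I)] = cellset P `\` schubert_cell I.
  rewrite predeqE => F; split=> [[J /andP[PJ JI] FJ]|[[J PJ FJ] FI]].
    split; first by exists J.
    by move=> FI; move: JI; rewrite (cell_disjoint FJ FI) eqxx.
  by exists J => //=; rewrite PJ; apply: contra_notN FI => /eqP <-.
rewrite diffE in z0 *.
apply: (@attach_acyclic R N N flag (chart I) (chart_inv I) (chart_domain I) _ _
  (cellset P) (schubert_cell I) (transverse I)) => //.
- exact: chart_inv_continuous.
- exact: chart_invK.
- exact: enum_uniq.
- by move=> M; exact: chart_in_domain.
- by move=> M; exact: off_chart.
- by move=> F; exact: off_chart_inv.
- exact: chart_domain_open.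
- rewrite -diffE; apply: cells_open => // J K /andP[PJ JI] KJ /=.
  rewrite (Pdown _ _ PJ KJ) /=; apply: contraTneq KJ => ->.
  by rewrite -leqNgt Pmax.
- by move=> F [_ FI]; exact: cell_in_domain.
- by move=> x; rewrite size_transverse; exact: zlow.
Qed.

(** A cell of largest codimension in [P] is removed first, so that the rest is still open. Its
    codimension exceeds [k], hence the degrees of [z]. *)
Lemma cells_acyclic P k z :
  (forall J K, P J -> (cell_codim K < cell_codim J)%N -> P K) ->
  (forall J, (cell_codim J <= k)%N -> P J) ->
  (forall x, inside (cellset P) x -> coboundary z x = 0) ->
  (forall x, inside (codim_le k) x -> z x = 0) ->
  (forall x, (k < projT1 (x : singular_simplex R flag))%N -> z x = 0) ->
  exists2 u : cochain R flag 'F_2,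
    (forall x, inside (codim_le k : set flag) x -> u x = 0) &
    forall x, inside (cellset P) x -> z x = coboundary u x.
Proof.
have [n] := ubnP #|[pred J | P J && (k < cell_codim J)%N]|.
elim: n P => // n IH P /ltnSE le_n Pdown Pk dz z0 zlow.
have [none|] := boolP [forall J, P J ==> (cell_codim J <= k)%N].
  exists 0 => // x xP; rewrite linear0; apply: z0; apply: insideS xP => F [J PJ FJ].
  by exists J => //; move/forallP/(_ J)/implyP: none; exact.
rewrite negb_forall => /existsP[J0]; rewrite negb_imply -ltnNge => /andP[PJ0 kJ0].
case: (@arg_maxnP _ J0 P (fun J => cell_codim J) PJ0) => I PI Pmax.
have kI : (k < cell_codim I)%N by apply: leq_trans kJ0 _; exact: Pmax.
pose P' := [pred J | P J && (J != I)].
have subP : cellset P' `<=` cellset P by move=> F [J /andP[PJ _] FJ]; exists J.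
have UkP' : codim_le k `<=` cellset P'.
  move=> F [J Jk FJ]; exists J => //=; rewrite Pk //=.
  by apply: contraTneq kI => <-; rewrite -leqNgt.
have [||||||u' u'0 zu'] := IH P'.
- apply: leq_trans le_n; rewrite [leqRHS](cardD1 I) !inE PI kI ltnS.
  by apply: subset_leq_card; apply/fintype.subsetP => J; rewrite !inE => /andP[/andP[-> ->] ->].
- move=> J K /andP[PJ JI] KJ /=; rewrite (Pdown _ _ PJ KJ) /=.
  by apply: contraTneq KJ => ->; rewrite -leqNgt; exact: Pmax.
- by move=> J Jk /=; rewrite Pk //=; apply: contraTneq kI => <-; rewrite -leqNgt.
- by move=> x xP'; apply: dz; exact: insideS xP'.
- exact: z0.
- exact: zlow.
have [|||u'' u''0 zu''] := @cell_step P I (z - coboundary (below k u')) Pdown PI Pmax.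
- by move=> x xP; rewrite coboundaryB coboundary_coboundaryE subr0 dz.
- move=> x xP'; rewrite cochainBE -(coboundary_truncate zlow zu') ?subrr //.
- move=> x Ix; rewrite cochainBE coboundary_below zlow; last exact: leq_trans Ix.
  by rewrite leqNgt (leq_trans kI Ix) subrr.
exists (below k u' + u'') => x xU.
  rewrite cochainDE (below_inside0 _ u'0 xU) add0r; apply: u''0; exact: insideS xU.
by rewrite coboundaryD -zu'' // cochainBE subrKC.
Qed.

End CellAttachment.

(** * Reduction modulo 2 and integral lifts *)

Section ReductionModulo2.
Implicit Types a b : int.

Definition halfz a : int := (a %/ 2)%Z.

Lemma halfz_mul a : halfz (2 * a) = a.
Proof. by rewrite /halfz mulrC mulzK. Qed.

Lemma neq0_F2 (x : 'F_2) : x <> 0 -> x = 1.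
Proof.
by case: x => [[|[|]]] // i x0; [case: x0; exact: val_inj|exact: val_inj].
Qed.

Lemma int_F2 a : (a%:~R == 0 :> 'F_2) = (2 %| a)%Z.
Proof.
by rewrite (dvdz_pcharf (pchar_Fp (isT : prime 2))).
Qed.

Lemma sign_int_F2 i a : ((-1) ^+ i * a)%:~R = a%:~R :> 'F_2.
Proof. by rewrite rmorphM rmorphXn /= rmorphN1 signr_F2 mul1r. Qed.

Lemma odd_mul_F2 a b : a%:~R <> 0 :> 'F_2 -> (a * b)%:~R = b%:~R :> 'F_2.
Proof. by move=> a0; rewrite rmorphM /= (neq0_F2 a0) mul1r. Qed.

Lemma halfz_even a : a%:~R = 0 :> 'F_2 -> a = 2 * halfz a.
Proof. by move/eqP; rewrite int_F2 => /divzK e; rewrite mulrC /halfz e. Qed.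

(** Signs are invisible in F_2, so half of the absolute value in the theorem may be replaced by the
    exact half. *)
Lemma halfz_abs a : a%:~R = 0 :> 'F_2 -> (`|a| %/ 2)%N%:R = (halfz a)%:~R :> 'F_2.
Proof.
move=> /halfz_even ->; rewrite halfz_mul abszM mulKn //.
have F2N x : - x = x :> 'F_2 by exact: oppr_F2.
by case: (halfz a) => n //; rewrite NegzE mulrNz F2N.
Qed.

End ReductionModulo2.

Section Lifts.
Variables (R : realType) (X : topologicalType).
Implicit Types (c : cochain R X int) (u : cochain R X 'F_2).

Definition reduce c : cochain R X 'F_2 := fun x => (c x)%:~R.
Definition lift_int u : cochain R X int := fun x => (u x : nat)%:Z.

Lemma lift_intK u : reduce (lift_int u) = u.
Proof.
apply/funext => x; rewrite /reduce /lift_int; apply: val_inj.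
by case: (u x) => [[|[|]]].
Qed.

Lemma lift_int0 u x : u x = 0 -> lift_int u x = 0.
Proof. by rewrite /lift_int => ->. Qed.

Lemma reduceD c c' x : reduce (c + c') x = reduce c x + reduce c' x.
Proof. by rewrite /reduce -rmorphD. Qed.

Lemma reduceB c c' x : reduce (c - c') x = reduce c x - reduce c' x.
Proof. by rewrite /reduce -rmorphB. Qed.

Lemma coboundary_reduce c : coboundary (reduce c) = reduce (coboundary c).
Proof.
apply/funext => -[[|n] s] //; rewrite /reduce /= raddf_sum; apply: eq_bigr => i _.
by rewrite signr_F2 mul1r; exact/esym/sign_int_F2.
Qed.

Definition half_cochain c : cochain R X int := fun x => halfz (c x).

Lemma half_cochain_even c x : reduce c x = 0 -> c x = 2 * half_cochain c x.
Proof. exact: halfz_even. Qed.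

Lemma coboundary_double c x : coboundary (2 *: c) x = 2 * coboundary c x.
Proof. exact: coboundaryZ. Qed.

End Lifts.

(** * Coorientations are odd near their cells *)

Section Coorientations.
Variables (R : realType) (m N : nat) (d : 'I_m -> nat).
Local Notation flag := (flag R N d).
Local Notation osp := (osp N d).
Hypothesis dN : (\sum_(i < m) d i)%N = N.
Implicit Types (J : osp) (w : cochain R flag int).

Lemma codim_le_diff_open J : open ((codim_le (cell_codim J) : set flag) `\` schubert_cell J).
Proof.
rewrite (_ : _ `\` _ = cells (fun K : osp => (cell_codim K <= cell_codim J)%N /\ K <> J)).
  apply: cells_open => // K L [KJ KnJ] LK; split; first exact: leq_trans (ltnW LK) KJ.
  by move=> LJ; move: LK; rewrite LJ ltnNge KJ.
rewrite predeqE => F; split=> [[[K KJ FK] FJ]|[K [KJ KnJ] FK]].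
  by exists K => //; split=> // KJ'; rewrite KJ' in FK.
by split; [exists K|move=> FJ; apply: KnJ; exact: cell_disjoint FK FJ].
Qed.

(* If the reduction modulo 2 of a generator vanished on a neighbourhood of the
   cell, the generator would be twice a class, by excision. *)
Lemma coorientation_odd J w (W : set flag) (q : cochain R flag 'F_2) :
  coorientation J w -> open W -> schubert_cell J `<=` W ->
  W `<=` codim_le (cell_codim J) ->
  (forall x, inside (W `\` schubert_cell J) x -> q x = 0) ->
  ~ forall x, inside W x -> reduce w x = coboundary q x.
Proof.
case=> -[wdeg wV wU] wgen oW JW WU q0 wq.
set U := codim_le (cell_codim J) in wV wU wgen WU; pose Q := U `\` schubert_cell J.
have UE : U = W `|` Q.
  rewrite predeqE => F; split=> [UF|[/WU//|[]//]].
  by have [/JW|] := pselect (schubert_cell J F); [left|right].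
have dw x : inside U x -> coboundary w x = 0 by exact: wU.
have w0 x : inside Q x -> w x = 0 by exact: wV.
have [|||||u uQ wu] := @excision R flag W Q oW _ (reduce w) q.
- exact: codim_le_diff_open.
- by move=> x; rewrite -UE => xU; rewrite coboundary_reduce /reduce dw.
- by move=> x xQ; rewrite /reduce w0.
- by move=> x xWQ; apply: q0; apply: insideS xWQ => F [WF []].
- exact: wq.
rewrite -UE in wu; set p := cell_codim J in wdeg wgen.
(* Only the part of [u] in degree p - 1 is kept, because the half of [y] has to be homogeneous of
   degree p. *)
pose v : cochain R flag 'F_2 := fun x => if (projT1 x).+1 == p then u x else 0.
have dv x : coboundary v x = if projT1 x == p then coboundary u x else 0.
  case: x => -[|n] s /=; first by case: ifP.
  have faceE (i : 'I_n.+2) : v (sub_simplex s (lift i)) =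
      if n.+1 == p then u (sub_simplex s (lift i)) else 0 by [].
  case: ifP => np; first by apply: eq_bigr => i _; rewrite faceE np.
  by apply: big1 => i _; rewrite faceE np mulr0.
have v0 x : inside Q x -> v x = 0 by move=> xQ; rewrite /v uQ //; case: ifP.
have wv x : inside U x -> reduce w x = coboundary v x.
  move=> xU; rewrite dv; case: ifP => [_|/negbT xp]; first exact: wu.
  by rewrite /reduce wdeg.
pose y := w - coboundary (lift_int v).
have y2 x : inside U x -> y x = 2 * half_cochain y x.
  move=> xU; apply: half_cochain_even; rewrite reduceB -coboundary_reduce lift_intK.
  by rewrite wv // subrr.
have yrel : rel_cocycle U Q p (half_cochain y).
  split.
  - move=> x xp; rewrite /half_cochain /y cochainBE wdeg // sub0r.
    suff -> : coboundary (lift_int v) x = 0 by [].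
    case: x xp => -[|n] s //= np; apply: big1 => i _.
    rewrite lift_int0 ?mulr0 // /v.
    by have -> : (projT1 (sub_simplex s (lift i))).+1 == p = false by apply/negbTE.
  - move=> x xQ; rewrite /half_cochain /y cochainBE w0 // sub0r.
    rewrite (@coboundary_inside0 _ _ _ Q) // => z zQ; apply: lift_int0; exact: v0.
  - move=> x xU; have : coboundary y x = 2 * coboundary (half_cochain y) x.
      rewrite -coboundary_double; apply: coboundary_eq_inside xU => z zU; exact: y2.
    rewrite /y coboundaryB coboundary_coboundaryE dw // subr0 => /esym/eqP.
    by rewrite mulf_eq0 => /orP[//|/eqP].
(* If the half of [y] is k times the generator, then [w] is cohomologous to 2k times itself, and
   uniqueness of coefficients gives 1 = 2k. *)
have [k [[c cQ hc] _]] := wgen _ yrel.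
have wrel : rel_cocycle U Q p w by split.
have [k0 [_ k0_uniq]] := wgen _ wrel.
have k1 : k0 = 1.
  apply: k0_uniq; exists 0 => // x xU.
  by rewrite !cochainBE cochainZE linear0 mul1r subrr subr0.
have k2 : k0 = 2 * k.
  apply: k0_uniq; exists (2 *: c + lift_int v) => [x xQ|x xU].
    by rewrite cochainDE cochainZE cQ // mulr0 lift_int0 ?addr0 // v0.
  have := hc x xU; rewrite !cochainBE cochainZE => /eqP; rewrite subr_eq0 => /eqP e.
  rewrite cochainZE coboundaryD coboundary_double -e.
  have := y2 x xU; rewrite /y cochainBE => /eqP; rewrite subr_eq => /eqP ->.
  ring.
have := congr1 absz (etrans (esym k1) k2); rewrite abszM; lia.
Qed.

(** The test for parity of one coefficient. It serves for the incidence coefficients, and again for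
    their halves when the cell is not in the closure. *)
Lemma coorientation_even J w (W : set flag) (q : cochain R flag 'F_2) (a : int) :
  coorientation J w -> open W -> schubert_cell J `<=` W ->
  W `<=` codim_le (cell_codim J) ->
  (forall x, inside (W `\` schubert_cell J) x -> q x = 0) ->
  (forall x, inside W x -> reduce (a *: w) x = coboundary q x) -> a%:~R = 0 :> 'F_2.
Proof.
move=> wJ oW JW WU q0 aw; apply: contrapT => a0.
apply: (coorientation_odd wJ oW JW WU q0) => x xW; rewrite -aw //.
exact/esym/odd_mul_F2.
Qed.

End Coorientations.

(** * The first Steenrod square *)

Section SteenrodSquareOne.
Local Open Scope set_scope.
Variables (R : realType) (X : topologicalType).
Implicit Type c : cochain R X 'F_2.

Lemma sorted_enum n (A : {set 'I_n}) :
  sorted (fun x y : 'I_n => (x < y)%N) (enum A).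
Proof.
rewrite {1}/enum_mem; apply: sorted_filter; first by move=> y x z; exact: ltn_trans.
by rewrite -enumT; have := iota_ltn_sorted 0 n; rewrite -val_enum_ord sorted_map.
Qed.

Lemma enum_setC1 n (w : 'I_n.+1) : enum (~: [set w])%SET = [seq lift w i | i <- enum 'I_n].
Proof.
apply: (@irr_sorted_eq _ (fun x y : 'I_n.+1 => (x < y)%N)).
- by move=> y x z; exact: ltn_trans.
- by move=> x; exact: ltnn.
- exact: sorted_enum.
- rewrite sorted_map; have := sorted_enum [set: 'I_n]; rewrite enum_setT -enumT.
  apply: sub_sorted => x y /=; rewrite /bump; lia.
move=> x; rewrite mem_enum !inE; apply/idP/mapP => [xw|[i _ ->]].
  by case: (unliftP w x) xw => [i ->|->]; [exists i; rewrite ?mem_enum|rewrite eqxx].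
by rewrite eq_sym neq_lift.
Qed.

Lemma face_setC1 n (s : continuousType (std_simplex R n.+1) X) (w : 'I_n.+2) :
  face s (~: [set w])%SET = sub_simplex s (lift w).
Proof.
rewrite face_vertices /face sub_simplex_asx; congr (asx s _).
have cw : #|(~: [set w])%SET| = n.+1 by rewrite cardsC1 card_ord.
apply: (@eq_from_nth _ (vertex R n.+1 0)).
  by rewrite size_mkseq size_del size_vertices // cw.
move=> j; rewrite size_mkseq {1}cw /= => jn; rewrite nth_mkseq ?cw //.
rewrite nth_del ?size_vertices // nth_mkseq ?inordK ?cw //; last by rewrite /bump; lia.
by rewrite enum_setC1 (nth_map (Ordinal jn)) ?size_enum_ord // -[j]/(nat_of_ord (Ordinal jn)) nth_ord_enum.
Qed.

Lemma card_lt n (u : 'I_n) : #|[set c : 'I_n | (c < u)%N]%SET| = u.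
Proof.
rewrite cardsE -sum1_card -(big_ord_widen _ (fun=> 1%N) (ltnW (ltn_ord u))).
by rewrite sum_nat_const card_ord muln1.
Qed.

Lemma sum_sqr n (F : 'I_n -> int) :
  (\sum_(u < n) F u) ^+ 2 = \sum_(u < n) F u ^+ 2 + 2 * \sum_(u < n) \sum_(v < n | (u < v)%N) F u * F v.
Proof.
rewrite expr2 mulr_suml; under eq_bigr do rewrite mulr_sumr.
rewrite mulr_sumr -big_split /=.
transitivity (\sum_(u < n) (F u ^+ 2 + \sum_(v < n | (u < v)%N) F u * F v) +
  \sum_(u < n) \sum_(v < n | (v < u)%N) F u * F v).
  rewrite -big_split; apply: eq_bigr => u _ /=.
  rewrite (bigD1 u) //= (bigID (fun v : 'I_n => u < v)%N) /= addrA; congr (_ + _ + _).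
    by apply: eq_bigl => v; rewrite andb_idl // => uv; rewrite -val_eqE /= gtn_eqF.
  by apply: eq_bigl => v; rewrite -leqNgt ltn_neqAle -val_eqE.
rewrite (exchange_big_dep predT) //= -big_split; apply: eq_bigr => u _ /=.
rewrite mulr2n mulrDl mul1r -addrA; congr (_ + (_ + _)).
by apply: eq_bigr => v _; rewrite mulrC.
Qed.

(* With [a] even and [b] odd indices where [l] is true, the right-hand side is
   [C(a, 2) + C(b, 2)], of which [a ^ 2 - a + b ^ 2 - b] is the double. *)
Lemma half_alternating n (l : 'I_n -> bool) :
  2 * halfz (\sum_(u < n) (-1) ^+ u * (l u : nat)%:Z) = \sum_(u < n) (-1) ^+ u * (l u : nat)%:Z ->
  (halfz (\sum_(u < n) (-1) ^+ u * (l u : nat)%:Z))%:~R =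
  \sum_(u < n) \sum_(v < n | (u < v)%N && (odd u == odd v)) (l u && l v)%:R :> 'F_2.
Proof.
set S := \sum_(u < n) (-1) ^+ u * (l u : nat)%:Z; set k := halfz S => kS.
pose F (b : bool) (u : 'I_n) : int := ((odd u == b) && l u : nat)%:Z.
pose T b := \sum_(u < n) F b u.
pose Q b := \sum_(u < n) \sum_(v < n | (u < v)%N) F b u * F b v.
have SE : S = T false - T true.
  rewrite -sumrB; apply: eq_bigr => u _; rewrite /F -signr_odd.
  by case: (odd u) (l u) => -[].
have sq b : T b ^+ 2 = T b + 2 * Q b.
  rewrite sum_sqr; congr (_ + _); apply: eq_bigr => u _.
  by rewrite /F; case: (_ && _).
pose P : int := \sum_(u < n) \sum_(v < n | (u < v)%N && (odd u == odd v)) (l u && l v : nat)%:Z.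
have PQ : P = Q false + Q true.
  rewrite -big_split; apply: eq_bigr => u _ /=; rewrite -big_split big_mkcondr /=.
  apply: eq_bigr => v _; rewrite /F.
  by case: (odd u); case: (odd v); case: (l u); case: (l v).
(* With a the even count, b the odd count and a = b + 2k, this is C(a, 2) + C(b, 2). Modulo 2 only k
   is left, as b and its square agree. *)
have PE : P = k + 2 * (T true * k + k ^+ 2 - k) + (T true ^+ 2 - T true).
  have ak : T false = T true + 2 * k by rewrite kS SE subrKC.
  have dbl b : 2 * Q b = T b ^+ 2 - T b by rewrite sq addrAC subrr add0r.
  suff : 2 * P = 2 * (k + 2 * (T true * k + k ^+ 2 - k) + (T true ^+ 2 - T true)).
    exact: mulfI.
  by rewrite PQ mulrDr !dbl ak; ring.
have <- : P%:~R = k%:~R :> 'F_2.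
  rewrite PE rmorphD rmorphD /= [X in _ + X + _]rmorphM /= (_ : 2%:~R = 0 :> 'F_2); last exact/val_inj.
  rewrite mul0r addr0 rmorphB rmorphXn /=.
  have sqF (x : 'F_2) : x ^+ 2 = x by case: x => [[|[|]]] // i; apply/val_inj.
  by rewrite sqF subrr addr0.
rewrite raddf_sum; apply: eq_bigr => u _; rewrite raddf_sum; apply: eq_bigr => v _.
by case: (_ && _).
Qed.

Lemma sum_setC2 n (F : {set 'I_n.+2} -> 'F_2) :
  \sum_(C : {set 'I_n.+2} | #|C| == n) F C =
  \sum_(p : 'I_n.+2 * 'I_n.+2 | (p.1 < p.2)%N) F (~: [set p.1; p.2])%SET.
Proof.
rewrite [RHS](partition_big (fun p => ~: [set p.1; p.2])%SET (fun C => #|C| == n)) /=.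
  apply: eq_bigr => C /eqP Cn.
  have [u [v [uv CE]]] : exists u v : 'I_n.+2, (u < v)%N /\ C = (~: [set u; v])%SET.
    have /eqP/cards2P[u [v [uv CE]]] : #|(~: C)%SET| = 2%N.
      by have := cardsC C; rewrite card_ord Cn; lia.
    case: (ltngtP u v) => [lt|lt|/val_inj e]; last by rewrite e eqxx in uv.
      by exists u, v; split=> //; rewrite -CE finset.setCK.
    by exists v, u; split=> //; rewrite finset.setUC -CE finset.setCK.
  rewrite (big_pred1 (u, v)) /=; first by rewrite CE.
  move=> [u' v'] /=; apply/andP/eqP => [[u'v' /eqP e]|[-> ->]]; last by rewrite uv CE.
  have {}e : [set u'; v']%SET = [set u; v]%SET by apply: (can_inj (@finset.setCK _)); rewrite e CE.
  have := set21 u' v'; have := set22 u' v'; rewrite e !inE => m2 m1; move: u'v'.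
  case/orP: m2 => /eqP ->; case/orP: m1 => /eqP ->; rewrite ?ltnn // => vu.
  by have := ltn_trans uv vu; rewrite ltnn.
move=> [u v] /= uv; have := cardsC [set u; v]%SET; rewrite card_ord cards2.
by rewrite -val_eqE /= (ltn_eqF uv) /=; lia.
Qed.

Section CupBlocks.
Variables (n : nat) (u v : 'I_n.+2).
Hypothesis uv : (u < v)%N.
Let C := (~: [set u; v])%SET.

Lemma cuts_below_fst : #|[set c in C | (c < u)%N]%SET| = u.
Proof.
rewrite -[RHS]card_lt; apply: eq_card => c; rewrite !inE andb_idl // => cu.
by rewrite negb_or -!val_eqE /= !ltn_eqF // (ltn_trans cu).
Qed.

Lemma cuts_below_snd : #|[set c in C | (c < v)%N]%SET| = v.-1.
Proof.
have := cardsD1 u [set c : 'I_n.+2 | (c < v)%N]%SET; rewrite card_lt inE uv add1n.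
move/(congr1 predn) => /= vE; rewrite [RHS]vE.
apply: eq_card => c; rewrite !inE negb_or -andbA; congr andb.
by rewrite andb_idl // => cv; rewrite -val_eqE /= ltn_eqF.
Qed.

(** Every vertex other than [u] and [v] is a cut and belongs to both blocks. Below [u] there are u
    cuts and below [v] only v - 1, which explains the opposite tests. *)
Lemma mem_cup_blocks b w : (w \in cup_blocks C b) =
  if w == u then odd u == b else if w == v then odd v != b else true.
Proof.
have Cw : (w \in C) = (w != u) && (w != v) by rewrite !inE negb_or.
rewrite /cup_blocks inE Cw; case: (eqVneq w u) => [->|wu] /=; first by rewrite cuts_below_fst.
case: (eqVneq w v) => [->|//] /=; rewrite cuts_below_snd.
by have := uv; case: (v : nat) => // k _ /=; case: (odd k) b => -[].
Qed.

End CupBlocks.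

(** For equal parities each block misses exactly one of [u] and [v]. For different parities one
    block contains both, and its dimension is too large by one. *)
Lemma cup_edge n (s : continuousType (std_simplex R n.+2) X) c (u v : 'I_n.+3) : (u < v)%N ->
  component n.+1 c (face s (cup_blocks (~: [set u; v])%SET false)) *
  component n.+1 c (face s (cup_blocks (~: [set u; v])%SET true)) =
  if odd u == odd v then c (sub_simplex s (lift u)) * c (sub_simplex s (lift v)) else 0.
Proof.
move=> uv; have blockE b := mem_cup_blocks uv b.
have comp_face w : component n.+1 c (face s (~: [set w])%SET) = c (sub_simplex s (lift w)).
  by rewrite face_setC1 /component eqxx.
have compT : component n.+1 c (face s [set: 'I_n.+3]%SET) = 0.
  by rewrite /component /= cardsT card_ord /= gtn_eqF.
have nuv : (u == v) = false by rewrite -val_eqE /= ltn_eqF.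
have [ouv|ouv] := eqVneq (odd u) (odd v).
  have bu : cup_blocks (~: [set u; v])%SET (odd u) = (~: [set v])%SET.
    apply/setP => w; rewrite blockE !inE eqxx -ouv eqxx /=.
    by case: (eqVneq w u) => [->|_]; rewrite ?nuv //; case: eqP.
  have bv : cup_blocks (~: [set u; v])%SET (~~ odd u) = (~: [set u])%SET.
    apply/setP => w; rewrite blockE !inE -ouv.
    by case: (eqVneq w u) => _; case: (odd u) => //=; case: eqP.
  by move: bu bv; case: (odd u) => /= -> ->; rewrite !comp_face // mulrC.
have full : cup_blocks (~: [set u; v])%SET (odd u) = [set: 'I_n.+3]%SET.
  apply/setP => w; rewrite blockE !inE eqxx; case: eqVneq => // _; case: eqVneq => // _.
  by rewrite eq_sym.
by move: full; case: (odd u) => ->; rewrite compT ?mulr0 ?mul0r.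
Qed.

Definition bockstein c : cochain R X 'F_2 :=
  reduce (half_cochain (coboundary (lift_int c))).

Lemma Sq1_cochain c : (forall x, coboundary c x = 0) -> Sq_cochain 1 c = bockstein c.
Proof.
move=> dc; apply/funext => -[n s].
have evenl : coboundary (lift_int c) (existT _ n s) =
    2 * halfz (coboundary (lift_int c) (existT _ n s)).
  apply: halfz_even; suff : reduce (coboundary (lift_int c)) (existT _ n s) = 0 by [].
  by rewrite -coboundary_reduce lift_intK dc.
case: n s evenl => [|[|n]] s evenl.
- by rewrite /Sq_cochain /bockstein /reduce /half_cochain.
(* On an edge the square is 0 by its degree bound, and a cocycle has equal values at both ends, so
   their lifts cancel. *)
- rewrite /bockstein /reduce /half_cochain.
  suff -> : coboundary (lift_int c) (existT _ 1 s) = 0 by [].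
  have := dc (existT _ 1 s); rewrite /= !big_ord_recl !big_ord0 /= !addr0 !mul1r !mulN1r.
  by move/eqP; rewrite subr_eq0 /lift_int => /eqP ->; rewrite subrr.
have -> : Sq_cochain 1 c (existT _ n.+2 s) =
    \sum_(C : {set 'I_n.+3} | #|C| == n.+1)
      (component n.+1 c (face s (cup_blocks C false)) *
       component n.+1 c (face s (cup_blocks C true))).
  by rewrite /Sq_cochain /= subn1 subn2.
rewrite sum_setC2; pose l (u : 'I_n.+3) := c (sub_simplex s (lift u)) != 0.
have lE (u : 'I_n.+3) : lift_int c (sub_simplex s (lift u)) = (l u : nat)%:Z.
  by rewrite /lift_int /l; case: (c _) => [[|[|]]].
have dE : coboundary (lift_int c) (existT _ n.+2 s) =
    \sum_(u < n.+3) (-1) ^+ u * (l u : nat)%:Z.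
  by apply: eq_bigr => u _; rewrite lE.
rewrite /bockstein /reduce /half_cochain dE half_alternating -?dE //.
rewrite (pair_big_dep predT (fun u v : 'I_n.+3 => (u < v)%N && (odd u == odd v))
  (fun u v => (l u && l v)%:R)) /= big_mkcondr /=.
apply: eq_bigr => -[u v] /= uv; rewrite cup_edge //; case: ifP => // _.
by rewrite /l; case: (c _) => [[|[|]]] // i; case: (c _) => [[|[|]]] // j; apply: val_inj.
Qed.

End SteenrodSquareOne.

(** * The Bockstein homomorphism on classes *)

Section Bockstein.
Variables (R : realType) (X : topologicalType).
Implicit Types (c b : cochain R X 'F_2) (x : singular_simplex R X).

Lemma bockstein_half c x : coboundary c x = 0 ->
  coboundary (lift_int c) x = 2 * half_cochain (coboundary (lift_int c)) x.
Proof.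
by move=> dc; apply: half_cochain_even; rewrite -coboundary_reduce lift_intK.
Qed.

Lemma coboundary_bockstein c : (forall x, coboundary c x = 0) ->
  forall x, coboundary (bockstein c) x = 0.
Proof.
move=> dc x; rewrite coboundary_reduce.
have : coboundary (coboundary (lift_int c)) x =
    2 * coboundary (half_cochain (coboundary (lift_int c))) x.
  rewrite -coboundary_double; apply: (@coboundary_eq_inside _ _ _ setT) => // y _.
  by rewrite cochainZE -bockstein_half.
rewrite coboundary_coboundaryE /reduce => /esym/eqP.
by rewrite mulf_eq0 => /orP[//|/eqP ->].
Qed.

(** Lifting is not additive. The defect [y] is even, and the reduction of its half is the
    primitive. *)
Lemma bockstein_coboundary c c' b : (forall x, coboundary c x = 0) ->
  (forall x, coboundary c' x = 0) -> (forall x, c x - c' x = coboundary b x) ->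
  exists e, forall x, bockstein c x - bockstein c' x = coboundary e x.
Proof.
move=> dc dc' cb; pose y := lift_int c - lift_int c' - coboundary (lift_int b).
have y2 x : y x = 2 * half_cochain y x.
  apply: half_cochain_even; rewrite 2!reduceB -coboundary_reduce !lift_intK cb.
  exact: subrr.
exists (reduce (half_cochain y)) => x; rewrite coboundary_reduce -reduceB.
congr (_%:~R); apply: (@mulfI _ 2) => //; rewrite cochainBE mulrBr -!bockstein_half //.
rewrite -coboundary_double -coboundaryB.
transitivity (coboundary (lift_int c - lift_int c' - coboundary (lift_int b)) x).
  by rewrite (coboundaryB _ (coboundary _)) coboundary_coboundaryE subr0.
by apply: (@coboundary_eq_inside _ _ _ setT) => // z _; rewrite -/y y2.
Qed.

Local Open Scope quotient_scope.

(** [Sq] evaluates a chosen representative of the class, whose Bockstein has to be compared with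
    that of [z]. *)
Lemma Sq1_pi (z z' : cocycle R X 'F_2) (u : cochain R X 'F_2) :
  (forall x, bockstein z x - cocycle_val z' x = coboundary u x) ->
  Sq 1 (\pi_(cohomology R X 'F_2) z) = \pi_(cohomology R X 'F_2) z'.
Proof.
move=> zz'; have dz (c : cocycle R X 'F_2) x : coboundary (cocycle_val c) x = 0.
  by have /asboolP -> := cocycleP c.
rewrite /Sq; set c := generic_quotient.repr _.
have /asboolP[b cb] : c - z \in @coboundaries R X 'F_2.
  by rewrite Quotient.idealrBE reprK.
have cbx x : cocycle_val c x - cocycle_val z x = coboundary b x by rewrite -cb.
have [e he] := bockstein_coboundary (dz c) (dz z) cbx.
apply/eqP; rewrite -Quotient.idealrBE; apply/asboolP; exists (e + u).
have Bc : Sq_cochain 1 c \in @cocycles R X 'F_2.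
  apply/asboolP; rewrite (Sq1_cochain (dz c)); apply/funext => x.
  exact: coboundary_bockstein.
apply/funext => x; rewrite coboundaryD -he -zz'.
transitivity (cocycle_val (insubd 0 (Sq_cochain 1 c)) x - cocycle_val z' x) => //.
have -> : cocycle_val (insubd 0 (Sq_cochain 1 c)) = Sq_cochain 1 c by exact: insubdK.
by rewrite (Sq1_cochain (dz c)) addrA subrK.
Qed.

End Bockstein.

Lemma sum_cochainE (R : realType) (X : topologicalType) (A : comNzRingType) (K : finType)
    (P : pred K) (F : K -> cochain R X A) x :
  (\sum_(k | P k) F k) x = \sum_(k | P k) F k x.
Proof. exact: (big_morph (fun c : cochain R X A => c x)). Qed.

Lemma coboundary_sum (R : realType) (X : topologicalType) (A : comNzRingType) (K : finType)
    (P : pred K) (a : K -> A) (F : K -> cochain R X A) x :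
  coboundary (\sum_(k | P k) a k *: F k) x = \sum_(k | P k) a k * coboundary (F k) x.
Proof.
rewrite linear_sum sum_cochainE; apply: eq_bigr => k _; exact: coboundaryZ.
Qed.

(** * Bocksteins of Schubert classes *)

Section SchubertBockstein.
Variables (R : realType) (m N : nat) (d : 'I_m -> nat).
Local Notation flag := (flag R N d).
Local Notation osp := (osp N d).
Local Notation simplex := (singular_simplex R flag).
Hypothesis dN : (\sum_(i < m) d i)%N = N.
Variables (w : osp -> cochain R flag int) (inc : osp -> osp -> int).
Hypothesis hw : forall I, coorientation I (w I).
Hypothesis hinc : incidence_coefficients w inc.
Variable z : osp -> cochain R flag 'F_2.
Hypothesis dz : forall J x, coboundary (z J) x = 0.
Hypothesis zdeg : forall J, in_degree (cell_codim J) (z J).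
Hypothesis zvar : forall J, vanishes_on (~` schubert_variety J) (z J).
Hypothesis zw : forall J, rel_cohomologous (codim_le (cell_codim J))
  (codim_le (cell_codim J) `\` schubert_cell J) (z J) (reduce (w J)).
Variable I : osp.
Local Notation c := (cell_codim I).

Let U k : set flag := codim_le k.

Lemma domain_sub J k : (cell_codim J <= k)%N -> chart_domain J `<=` U k.
Proof.
move=> Jk F FJ; have [K FK] := flag_in_cell dN F; exists K => //.
by have [le _] := chart_domain_codim FJ FK; exact: leq_trans le Jk.
Qed.

Lemma domain_diff J k : cell_codim J = k.+1 -> chart_domain J `\` schubert_cell J `<=` U k.
Proof.
move=> Jk F [FJ nFJ]; have [K FK] := flag_in_cell dN F; exists K => //.
have [le eq] := chart_domain_codim FJ FK; rewrite -ltnS -Jk ltn_neqAle le andbT.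
by apply: contra_notN nFJ => /eqP e; rewrite (eq (esym e)).
Qed.

Lemma domain_other J K x : cell_codim J = cell_codim K -> J != K ->
  inside (chart_domain J) x -> w K x = 0.
Proof.
move=> JK nJK xJ; have [[_ wV _] _] := hw K; apply: wV.
apply: insideS xJ => F FJ; split; first by apply: domain_sub FJ; rewrite JK.
move=> FK; have [_ eq] := chart_domain_codim FJ FK.
by move: nJK; rewrite eq // eqxx.
Qed.

(** The chart of [J] avoids the other cells of the same codimension, where alone their
    coorientations are supported. *)
Lemma local_sum J (a : osp -> int) x : cell_codim J = c.+1 ->
  inside (chart_domain J) x ->
  (\sum_(K | cell_codim K == c.+1) a K *: w K) x = (a J *: w J) x.
Proof.
move=> Jc xJ; rewrite sum_cochainE (bigD1 J) ?Jc //= big1 ?addr0 // => K /andP[/eqP Kc KJ].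
by rewrite cochainZE (domain_other _ _ xJ) ?mulr0 // 1?eq_sym // Jc Kc.
Qed.

Lemma schubert_bockstein : (forall J, cell_codim J = c.+1 -> (inc I J)%:~R = 0 :> 'F_2) /\
  exists u : cochain R flag 'F_2, forall x, bockstein (z I) x -
    (\sum_(J | cell_covers R I J) (halfz (inc I J))%:~R *: z J) x = coboundary u x.
Proof.
have [a0 a0V za0] := zw I; have [g0 g0V wg0] := hinc I.
have [wdeg wV wU] := (hw I).1.
pose S (b : osp -> int) : cochain R flag int := \sum_(J | cell_codim J == c.+1) b J *: w J.
have Slow b x : (c.+1 < projT1 (x : simplex))%N -> S b x = 0.
  move=> cx; rewrite /S sum_cochainE big1 // => J /eqP Jc; have [[wJ _ _] _] := hw J.
  by rewrite cochainZE wJ ?mulr0 // Jc gtn_eqF.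
(* Truncation puts [a] in degrees below c and [g] in degrees at most c. Then q has no part above
   degree c, as the vanishing theorem requires. *)
pose a := below c a0; pose g := below c.+1 g0.
have aV x : inside (U c `\` schubert_cell I) x -> a x = 0 by exact: below_inside0.
have gV x : inside (U c) x -> g x = 0 by exact: below_inside0.
have za x : inside (U c) x -> (z I - reduce (w I)) x = coboundary a x.
  apply: coboundary_truncate => y cy.
    by rewrite cochainBE zdeg /reduce ?wdeg ?subrr // gtn_eqF.
  by apply/eqP; rewrite -subr_eq0; apply/eqP; exact: za0.
have wg x : inside (U c.+1) x -> (coboundary (w I) - S (inc I)) x = coboundary g x.
  apply: coboundary_truncate => y cy; last first.
    by apply/eqP; rewrite -subr_eq0; apply/eqP; exact: wg0.
  rewrite cochainBE Slow // subr0; case: y cy => -[|n] s //= cn.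
  by apply: big1 => i _; rewrite wdeg ?mulr0 //= gtn_eqF.
pose la := coboundary (lift_int a); pose G := lift_int (z I) - w I - la.
have lalow x : (c < projT1 (x : simplex))%N -> la x = 0.
  case: x => -[|n] s //= cn; apply: big1 => i _.
  by rewrite lift_int0 ?mulr0 // /a /below; case: leqP => //=; rewrite ltnNge -ltnS cn.
have GE x : G x = lift_int (z I) x - w I x - la x by [].
(* [G] is known to be even only inside U_c. There [e] is its half; [f] takes the values on all other
   simplices, so that G = 2 e + f holds everywhere. *)
pose e : cochain R flag int := fun x => if `[< inside (U c) x >] then halfz (G x) else 0.
pose f : cochain R flag int := fun x => if `[< inside (U c) x >] then 0 else G x.
have Gef x : G x = 2 * e x + f x.
  rewrite /e /f; case: asboolP => xU; last by rewrite mulr0 add0r.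
  rewrite addr0; apply: half_cochain_even; rewrite 2!reduceB lift_intK -coboundary_reduce lift_intK.
  by rewrite -za // cochainBE subrr.
have flow x : (c < projT1 (x : simplex))%N -> f x = 0.
  move=> cx; rewrite /f; case: asboolP => // _; rewrite GE lalow // subr0.
  by rewrite wdeg ?subr0 ?lift_int0 // ?zdeg // gtn_eqF.
pose q := f + g.
have qU x : inside (U c) x -> q x = 0.
  by move=> xU; rewrite /q cochainDE gV // addr0 /f; case: asboolP.
have qlow x : (c < projT1 (x : simplex))%N -> q x = 0.
  by move=> cx; rewrite /q cochainDE flow // add0r /g /below ltnNge cx.
have dliftE x : inside (U c.+1) x -> coboundary (lift_int (z I)) x =
    2 * coboundary e x + coboundary q x + S (inc I) x.
  move=> xU; have -> : coboundary (lift_int (z I)) x =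
      coboundary G x + coboundary (w I) x.
    by rewrite /G /la 2!coboundaryB coboundary_coboundaryE subr0 subrK.
  have -> : coboundary G x = 2 * coboundary e x + coboundary f x.
    rewrite -coboundary_double -coboundaryD.
    by apply: (@coboundary_eq_inside _ _ _ setT) => // y _; rewrite Gef.
  have := wg x xU; rewrite cochainBE => /eqP; rewrite subr_eq => /eqP ->.
  by rewrite /q coboundaryD; ring.
have redS x : inside (U c.+1) x -> reduce (S (inc I)) x = coboundary (reduce q) x.
  move=> xU; have := coboundary_reduce (lift_int (z I)); rewrite lift_intK => /(congr1 (fun h => h x)).
  rewrite dz /reduce dliftE // !rmorphD rmorphM /= (_ : 2%:~R = 0 :> 'F_2); last exact/val_inj.
  rewrite mul0r add0r => /esym/eqP; rewrite addr_eq0 oppr_F2 => /eqP e1.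
  by rewrite coboundary_reduce /reduce -e1.
have redqV (C : set flag) x : C `<=` U c -> inside C x -> reduce q x = 0.
  by move=> CU xC; rewrite /reduce qU //; exact: insideS xC.
have inc_even J : cell_codim J = c.+1 -> (inc I J)%:~R = 0 :> 'F_2.
  move=> Jc; apply: (@coorientation_even R m N d dN J (w J) (chart_domain J) (reduce q)).
  - exact: hw.
  - exact: chart_domain_open.
  - by move=> F; exact: cell_in_domain.
  - exact: domain_sub.
  - by move=> x; apply: redqV; exact: domain_diff.
  - move=> x xJ; rewrite -redS; last by apply: insideS xJ; apply: domain_sub; rewrite Jc.
    by rewrite /reduce /S (local_sum _ Jc xJ).
split; first exact: inc_even.
pose nJ J := halfz (inc I J).
have S2 x : S (inc I) x = 2 * S nJ x.
  rewrite /S !sum_cochainE mulr_sumr; apply: eq_bigr => J /eqP Jc.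
  by rewrite !cochainZE mulrA /nJ -halfz_even // inc_even.
have [|||||h hU qh] := @cells_acyclic R m N d dN (fun J => cell_codim J <= c.+1)%N c (reduce q).
- by move=> J K Jc KJ; exact: leq_trans (ltnW KJ) Jc.
- by move=> J Jc; exact: leqW.
- move=> x xU; rewrite -redS // /reduce S2 rmorphM /= (_ : 2%:~R = 0 :> 'F_2) ?mul0r //.
  exact/val_inj.
- by move=> x xU; exact: redqV xU.
- by move=> x cx; rewrite /reduce qlow.
(* Subtracting the coboundary of the lift of [h] leaves the coboundary of q unchanged and makes q
   even on U_(c+1), still zero on U_c. *)
pose k := half_cochain (q - coboundary (lift_int h)).
have qk x : inside (U c.+1) x -> q x - coboundary (lift_int h) x = 2 * k x.
  move=> xU; apply: half_cochain_even; rewrite reduceB -coboundary_reduce lift_intK.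
  by rewrite qh // subrr.
have kU x : inside (U c) x -> k x = 0.
  move=> xU; rewrite /k /half_cochain cochainBE qU // sub0r.
  rewrite (@coboundary_inside0 _ _ _ (U c)) // => y yU; apply: lift_int0; exact: hU.
have Bk x : inside (U c.+1) x -> bockstein (z I) x =
    reduce (S nJ) x + coboundary (reduce (e + k)) x.
  move=> xU; rewrite coboundary_reduce -reduceD; congr (_%:~R).
  apply: (@mulfI _ 2) => //; rewrite -bockstein_half // dliftE // S2.
  have -> : coboundary q x = 2 * coboundary k x.
    rewrite -coboundary_double; transitivity (coboundary (q - coboundary (lift_int h)) x).
      by rewrite coboundaryB coboundary_coboundaryE subr0.
    by apply: coboundary_eq_inside xU => y yU; rewrite cochainBE qk.
  rewrite cochainDE coboundaryD; ring.
have notcover J : cell_codim J = c.+1 -> ~~ cell_covers R I J -> (nJ J)%:~R = 0 :> 'F_2.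
  move=> Jc; rewrite /cell_covers (cell_codim_dim Jc) eqxx andbT => /asboolPn nsub.
  have disj (F : flag) : schubert_cell J F -> ~ schubert_variety I F.
    by move=> FJ FI; apply: nsub; exact: cell_sub_variety FJ FI.
  apply: (@coorientation_even R m N d dN J (w J) (chart_domain J `&` ~` schubert_variety I)
    (reduce (e + k))).
  - exact: hw.
  - apply: openI; first exact: chart_domain_open.
    by rewrite openC; exact: closed_closure.
  - by move=> F FJ; split; [exact: cell_in_domain|exact: disj].
  - by move=> F [FJ _]; move: F FJ; apply: domain_sub.
  - move=> x xC; have xU : inside (U c) x.
      by apply: insideS xC => F [[FJ _] nFJ]; apply: (domain_diff Jc).
    have xn : inside (~` schubert_variety I) x by apply: insideS xC => F [[]].
    have xUI : inside (U c `\` schubert_cell I) x.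
      move=> F xF; split; first exact: xU.
      by move=> FI; apply: (xn F xF); exact: subset_closure.
    (* Here [k] is zero since the simplex lies in U_c, and so is [e]: away from the closure of the
       cell [z I], [w I] and [la] all vanish. *)
    rewrite /reduce cochainDE kU // addr0 /e; case: asboolP => // _.
    rewrite GE (wV _ xUI) lift_int0; last exact: zvar xn.
    rewrite /la (@coboundary_inside0 _ _ _ (U c `\` schubert_cell I)) //.
    by move=> y yU; apply: lift_int0; exact: aV.
  - move=> x xW; have [xJ xn] := (insideI _ _ _).1 xW.
    have xU : inside (U c.+1) x by apply: insideS xJ; apply: domain_sub; rewrite Jc.
    rewrite {1}/reduce -(local_sum _ Jc xJ).
    have := Bk x xU; rewrite (_ : bockstein (z I) x = 0).
      by move/eqP; rewrite eq_sym addr_eq0 oppr_F2 => /eqP.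
    rewrite /bockstein /reduce /half_cochain (@coboundary_inside0 _ _ _ (~` schubert_variety I)) //.
    by move=> y yn; apply: lift_int0; exact: zvar yn.
(* A comparison of [z J] with its coorientation, selected for all [J] at once; existence is shown in
   [bP], so the default 0 is never a substitute. *)
pose b J := xget (0 : cochain R flag 'F_2) [set b | vanishes_on (U (cell_codim J) `\` schubert_cell J) b /\
  vanishes_on (U (cell_codim J)) (z J - reduce (w J) - coboundary b)].
have bP J x : inside (U (cell_codim J)) x -> z J x = reduce (w J) x + coboundary (b J) x.
  have [b0 b0V zb0] := zw J.
  have : exists b, vanishes_on (U (cell_codim J) `\` schubert_cell J) b /\
    vanishes_on (U (cell_codim J)) (z J - reduce (w J) - coboundary b) by exists b0.
  move/(xgetPex 0) => [_ zb] xU; apply/eqP; rewrite -subr_eq0 opprD addrA; apply/eqP.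
  exact: zb.
pose D := bockstein (z I) - \sum_(J | cell_covers R I J) (nJ J)%:~R *: z J.
pose m0 := reduce (e + k) - \sum_(J | cell_covers R I J) (nJ J)%:~R *: b J.
have coverP J : cell_covers R I J -> cell_codim J = c.+1.
  by case/andP => _ /eqP /cell_dim_codimS.
have Dm x : inside (U c.+1) x -> D x = coboundary m0 x.
  move=> xU; rewrite /D cochainBE Bk // /m0 coboundaryB coboundary_sum sum_cochainE.
  have -> : reduce (S nJ) x = \sum_(J | cell_covers R I J) (nJ J)%:~R * reduce (w J) x.
    rewrite /reduce /S sum_cochainE raddf_sum /= [RHS]big_mkcond [LHS]big_mkcond /=.
    apply: eq_bigr => J _; case: (boolP (cell_covers R I J)) => cIJ.
      by rewrite (coverP J cIJ) eqxx cochainZE rmorphM.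
    by case: eqP => // Jc; rewrite cochainZE rmorphM /= notcover // mul0r.
  rewrite addrAC -sumrB [X in X + _ = _](_ : _ =
    - \sum_(J | cell_covers R I J) (nJ J)%:~R * coboundary (b J) x) 1?addrC //.
  rewrite -sumrN; apply: eq_bigr => J cIJ; rewrite cochainZE bP; last first.
    by rewrite coverP.
  by rewrite mulrDr opprD addrA subrr add0r.
have Dlow x : (c.+1 < projT1 (x : simplex))%N -> D x = 0.
  move=> cx; rewrite /D cochainBE sum_cochainE big1 => [|J cIJ].
    rewrite subr0 /bockstein /reduce /half_cochain.
    suff -> : coboundary (lift_int (z I)) x = 0 by [].
    case: x cx => -[|n] s //= cn; apply: big1 => i _.
    by rewrite lift_int0 ?mulr0 // zdeg //= gtn_eqF.
  by rewrite cochainZE zdeg ?mulr0 // (coverP J cIJ) gtn_eqF.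
have dD x : coboundary D x = 0.
  rewrite /D coboundaryB coboundary_bockstein // coboundary_sum big1 ?subr0 // => J _.
  by rewrite dz mulr0.
have Dtr := coboundary_truncate Dlow Dm.
(* For [predT] the union of cells is the whole manifold, because every flag lies in a cell. *)
have [|||||u uU Du] := @cells_acyclic R m N d dN predT c.+1 (D - coboundary (below c.+1 m0)).
- by [].
- by [].
- by move=> x _; rewrite coboundaryB coboundary_coboundaryE subr0.
- by move=> x xU; rewrite cochainBE -Dtr // subrr.
- move=> x cx; rewrite cochainBE Dlow // coboundary_below leqNgt cx subrr //.
exists (u + below c.+1 m0) => x.
rewrite coboundaryD -Du; first by rewrite cochainBE subrK.
by move=> F _; have [J FJ] := flag_in_cell dN F; exists J.
Qed.

End SchubertBockstein.

Section CohomologyClasses.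
Variables (R : realType) (X : topologicalType).
Local Open Scope quotient_scope.
Local Notation H := (cohomology R X 'F_2).

Lemma cocycle_sumE (K : finType) (P : pred K) (F : K -> cocycle R X 'F_2) :
  cocycle_val (\sum_(k | P k) F k) = \sum_(k | P k) cocycle_val (F k).
Proof. exact: (big_morph (@cocycle_val R X 'F_2)). Qed.

Lemma pi_cohomology_sum (K : finType) (P : pred K) (a : K -> 'F_2)
    (F : K -> cocycle R X 'F_2) :
  \pi_H (\sum_(k | P k) a k *: F k) = \sum_(k | P k) a k *: \pi_H (F k).
Proof.
rewrite [LHS](raddf_sum (\pi_H : {additive _ -> _})).
by apply: eq_bigr => k _; exact/esym/cohomology_scaleE.
Qed.

End CohomologyClasses.

Theorem proposition6p3 (R : realType) (m N : nat) (d : 'I_m -> nat)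
    (hd : forall i, (0 < d i)%N) (hN : (\sum_(i < m) d i)%N = N)
    (w : osp N d -> cochain R (flag R N d) int)
    (hw : forall I, coorientation I (w I))
    (inc : osp N d -> osp N d -> int)
    (hinc : incidence_coefficients w inc)
    (sigma : osp N d -> cohomology R (flag R N d) 'F_2)
    (hsigma : forall I, schubert_class w I (sigma I))
    (I : osp N d) :
  Sq 1 (sigma I) =
  \sum_(J | cell_covers R I J) (`|inc I J| %/ 2)%N%:R *: sigma J.
Proof.
have /choice[z zP] := hsigma.
have dz J x : coboundary (cocycle_val (z J)) x = 0.
  by have /asboolP -> := cocycleP (z J).
have [inc_even [u zu]] := @schubert_bockstein R m N d hN w inc hw hinc
  (fun J => cocycle_val (z J)) dz
  (fun J => let: And4 _ h _ _ := zP J in h) (fun J => let: And4 _ _ h _ := zP J in h)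
  (fun J => let: And4 _ _ _ h := zP J in h) I.
have [-> _ _ _] := zP I.
rewrite (@Sq1_pi _ _ (z I) (\sum_(J | cell_covers R I J) (halfz (inc I J))%:~R *: z J) u).
  rewrite pi_cohomology_sum; apply: eq_bigr => J /andP[_ /eqP /cell_dim_codimS Jc].
  by have [-> _ _ _] := zP J; rewrite halfz_abs // inc_even.
by move=> x; rewrite -zu cocycle_sumE.
Qed.
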